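(* Let $\alpha\in(\frac13,\frac12]$, $0<\beta'\le\beta\le\alpha$, $\gamma_1,\gamma_2\in\mathbb{R}$, $m\in[2,\infty)$, $X\in C^\alpha([0,T],\mathbb{R}^e)$, $(Y,Y')\in\mathbf{D}_X^{\beta,\beta'}L_m\mathcal{H}_{\gamma_1}^{e_1}$ and $(G,G')\in\mathbf{D}_X^{\beta,\beta'}L_\infty\mathcal{L}_{\gamma_1,\gamma_2}(\mathcal{H}^{e_1},\mathcal{H}^{e_2})$. Then $(GY,GY'+G'Y)\in\mathbf{D}_X^{\beta,\beta'}L_m\mathcal{H}_{\gamma_2}^{e_2}$ and $$\|G_0Y_0\|_{m,\gamma_2}\lesssim\|G,G'\|_{\mathbf{D}_X^{\beta,\beta'}L_\infty\mathcal{L}_{\gamma_1,\gamma_2}}\|Y_0\|_{m,\gamma_1},$$ $$\|GY,GY'+G'Y\|_{\mathbf{D}_X^{\beta,\beta'}L_m\mathcal{H}_{\gamma_2}}\lesssim\|G,G'\|_{\mathbf{D}_X^{\beta,\beta'}L_\infty\mathcal{L}_{\gamma_1,\gamma_2}}\|Y,Y'\|_{\mathbf{D}_X^{\beta,\beta'}L_m\mathcal{H}_{\gamma_1}}.$$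
   Context: **Setting.** Fix $T>0$; $\Delta_2=\{(s,t):0\le s\le t\le T\}$. $(\Omega,\mathcal{F},(\mathcal{F}_t),\mathbb{P})$ is a filtered probability space satisfying the usual conditions; $\mathbb{E}_s=\mathbb{E}[\cdot|\mathcal{F}_s]$. $a\lesssim b$ means $a\le Cb$ with $C$ depending only on the fixed parameters ($\alpha,\beta,\beta',m,\gamma_1,\gamma_2,\dots$), on $T\vee1$ and on the fixed spaces. **Monotone family.** $(\mathcal{H}_\gamma,|\cdot|_\gamma)_{\gamma\in\mathbb{R}}$ is a monotone family of interpolation Hilbert spaces: each $\mathcal{H}_\gamma$ is a separable Hilbert space; for $\gamma_1\le\gamma_2$, $\mathcal{H}_{\gamma_2}$ is a continuously embedded dense subspace of $\mathcal{H}_{\gamma_1}$; and $|u|_{\gamma_2}^{\gamma_3-\gamma_1}\lesssim|u|_{\gamma_1}^{\gamma_3-\gamma_2}|u|_{\gamma_3}^{\gamma_2-\gamma_1}$ for $\gamma_1\le\gamma_2\le\gamma_3$, $u\in\mathcal{H}_{\gamma_3}$. **Notation.** $C^\alpha([0,T],\mathbb{R}^e)$ is the space of $\alpha$-Hölder continuous functions. $\mathcal{H}_\gamma^e=\mathcal{L}(\mathbb{R}^e,\mathcal{H}_\gamma)$, norm again $|\cdot|_\gamma$. $\mathcal{H}_\gamma^{e_1\times e}$ is identified with $\mathcal{L}(\mathbb{R}^e,\mathcal{H}_\gamma^{e_1})$. Operators on $\mathcal{H}^{e_1}$ act componentwise on $\mathcal{H}^{e_1\times e}$, and for $G'$ with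 values in $\mathcal{L}(\mathcal{H}^{e_1},\mathcal{H}^{e_2\times e})$, $(G'x)u:=(G'u)x$ for $x\in\mathbb{R}^e$. $\|\xi\|_{m,\gamma}=\||\xi|_\gamma\|_{L^m(\Omega)}$; $|\cdot|_{(\gamma_1,\gamma_2)\text{-}op}$ is the operator norm on $\mathcal{L}(\mathcal{H}_{\gamma_1}^{e_1},\mathcal{H}_{\gamma_2}^{e_2})$ and $\|\cdot\|_{\infty,(\gamma_1,\gamma_2)\text{-}op}$ the $L^\infty(\Omega)$-norm of it. $\delta Y_{s,t}=Y_t-Y_s$. $\mathbb{E}_\cdot A$ is the map $(s,t)\mapsto\mathbb{E}_sA_{s,t}$. $\|Y\|_{0,m,\gamma}=\sup_t\|Y_t\|_{m,\gamma}$, $\|A\|_{\beta,m,\gamma}=\sup_{s<t}\|A_{s,t}\|_{m,\gamma}/|t-s|^\beta$; similarly $\|\cdot\|_{0,\infty,(\gamma_1,\gamma_2)\text{-}op}$, $\|\cdot\|_{\beta,\infty,(\gamma_1,\gamma_2)\text{-}op}$. **Spaces of processes.** $C_2^\beta L_m\mathcal{H}_\gamma^{e_1}$: measurable adapted ($A_{s,t}$ is $\mathcal{F}_t$-measurable) bounded continuous $A:\Delta_2\to L^m(\Omega,\mathcal{H}_\gamma^{e_1})$ with $\|A\|_{\beta,m,\gamma}<\infty$. $CL_m\mathcal{H}_\gamma^{e_1}=C([0,T],L^m(\Omega,\mathcal{H}_\gamma^{e_1}))$. $C^\beta L_m\mathcal{H}_\gamma^{e_1}$: measurable adapted $Y\in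 CL_m\mathcal{H}_\gamma^{e_1}$ with $\|\delta Y\|_{\beta,m,\gamma}<\infty$. $E^\beta L_m\mathcal{H}_\gamma^{e_1}=CL_m\mathcal{H}_\gamma^{e_1}\cap C^\beta L_m\mathcal{H}_{\gamma-\beta}^{e_1}$, norm $\|Y\|_{E^\beta L_m\mathcal{H}_\gamma}=\|Y\|_{0,m,\gamma}+\|\delta Y\|_{\beta,m,\gamma-\beta}$. $CL_\infty\mathcal{L}(\mathcal{H}_{\gamma_1}^{e_1},\mathcal{H}_{\gamma_2}^{e_2})$, $C^\beta L_\infty\mathcal{L}(\cdot,\cdot)$ and $C_2^\beta L_\infty\mathcal{L}(\cdot,\cdot)$ are defined likewise with $L^\infty(\Omega,\mathcal{L}(\mathcal{H}_{\gamma_1}^{e_1},\mathcal{H}_{\gamma_2}^{e_2}))$ in place of $L^m(\Omega,\mathcal{H}_\gamma^{e_1})$. $E^\beta L_\infty\mathcal{L}_{\gamma_1,\gamma_2}(\mathcal{H}^{e_1},\mathcal{H}^{e_2})=CL_\infty\mathcal{L}(\mathcal{H}_{\gamma_1}^{e_1},\mathcal{H}_{\gamma_2}^{e_2})\cap C^\beta L_\infty\mathcal{L}(\mathcal{H}_{\gamma_1-\beta}^{e_1},\mathcal{H}_{\gamma_2-\beta}^{e_2})$, norm $\|f\|_{E^\beta L_\infty\mathcal{L}_{\gamma_1,\gamma_2}}=\|f\|_{0,\infty,(\gamma_1,\gamma_2)\text{-}op}+\|f\|_{0,\infty,(\gamma_1-\beta,\gamma_2-\beta)\text{-}op}+\|\delta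 f\|_{\beta,\infty,(\gamma_1-\beta,\gamma_2-\beta)\text{-}op}$. **Stochastic controlled rough paths.** $(Y,Y')\in\mathbf{D}_X^{\beta,\beta'}L_m\mathcal{H}_\gamma^{e_1}$ if $Y\in E^\beta L_m\mathcal{H}_\gamma^{e_1}$, $Y'\in E^{\beta'}L_m\mathcal{H}_{\gamma-\beta}^{e_1\times e}$ and $\mathbb{E}_\cdot R^Y\in C_2^{\beta+\beta'}L_m\mathcal{H}_{\gamma-\beta-\beta'}^{e_1}$, where $R^Y_{s,t}=\delta Y_{s,t}-Y'_s\delta X_{s,t}$. Norm: $\|Y,Y'\|_{\mathbf{D}_X^{\beta,\beta'}L_m\mathcal{H}_\gamma}=\|Y\|_{E^\beta L_m\mathcal{H}_\gamma}+\|Y'\|_{E^{\beta'}L_m\mathcal{H}_{\gamma-\beta}}+\|\mathbb{E}_\cdot R^Y\|_{\beta+\beta',m,\gamma-\beta-\beta'}$. **Stochastic controlled operator families.** $(G,G')\in\mathbf{D}_X^{\beta,\beta'}L_\infty\mathcal{L}_{\gamma_1,\gamma_2}(\mathcal{H}^{e_1},\mathcal{H}^{e_2})$ if $G\in E^\beta L_\infty\mathcal{L}_{\gamma_1,\gamma_2}(\mathcal{H}^{e_1},\mathcal{H}^{e_2})\cap E^{\beta'}L_\infty\mathcal{L}_{\gamma_1-\beta,\gamma_2-\beta}(\mathcal{H}^{e_1},\mathcal{H}^{e_2})$, $G'\in E^{\beta'}L_\infty\mathcal{L}_{\gamma_1,\gamma_2-\beta}(\mathcal{H}^{e_1},\mathcal{H}^{e_2\times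 e})$ and $\mathbb{E}_\cdot R^G\in C_2^{\beta+\beta'}L_\infty\mathcal{L}(\mathcal{H}_{\gamma_1}^{e_1},\mathcal{H}_{\gamma_2-\beta-\beta'}^{e_2})$, where $R^G_{s,t}=\delta G_{s,t}-G'_s\delta X_{s,t}$. Norm: $\|G,G'\|_{\mathbf{D}_X^{\beta,\beta'}L_\infty\mathcal{L}_{\gamma_1,\gamma_2}}=\|G\|_{E^\beta L_\infty\mathcal{L}_{\gamma_1,\gamma_2}}+\|G\|_{E^{\beta'}L_\infty\mathcal{L}_{\gamma_1-\beta,\gamma_2-\beta}}+\|G'\|_{E^{\beta'}L_\infty\mathcal{L}_{\gamma_1,\gamma_2-\beta}}+\|\mathbb{E}_\cdot R^G\|_{\beta+\beta',\infty,(\gamma_1,\gamma_2-\beta-\beta')\text{-}op}$.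
   Formalization: Continuity of E.R^{GY} on Δ_2 can fail when the filtration jumps at a fixed time; it is proved along s'≥s for every filtration with the usual conditions, and in full if also F_t=F_{t-} on (0,T]. All other clauses and both estimates are as stated. *)

(* Defs.v *)
(* MathComp and MathComp-Analysis. *)
From HB Require Import structures.
From mathcomp Require Export all_boot all_order all_algebra.
From mathcomp Require Export all_classical all_reals all_analysis.
Export Order.TTheory GRing.Theory Num.Theory numFieldNormedType.Exports.

Set Implicit Arguments.
Unset Strict Implicit.
Unset Printing Implicit Defensive.

#[export] Set Implicit Arguments.
#[export] Unset Strict Implicit.

Local Open Scope classical_set_scope.
Local Open Scope ring_scope.

(* The spaces H_gamma are realized inside one ambient vector space [mf_amb]
   through injections [mf_inj], so that "H_gamma2 is a subspace of H_gamma1"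
   means inclusion of the images, and u : H gamma, v : H gamma' are the same
   vector when mf_inj u = mf_inj v.  Such an ambient space always exists (the
   increasing union of the family). *)
Record monotone_family (R : realType) := MonotoneFamily {
  mf_space : R -> completeNormedModType R ;
  mf_dot : forall gamma, {dot (mf_space gamma) for idfun} ;
  mf_dotE : forall gamma (u : mf_space gamma), `|u| ^+ 2 = mf_dot gamma u u ;
  mf_separable : forall gamma,
    exists2 D : set (mf_space gamma), countable D & dense D ;
  mf_amb : lmodType R ;
  mf_inj : forall gamma, {linear mf_space gamma -> mf_amb} ;
  mf_injI : forall gamma, injective (mf_inj gamma) ;
  mf_sub : forall gamma1 gamma2, gamma1 <= gamma2 ->
    range (mf_inj gamma2) `<=` range (mf_inj gamma1) ;
  mf_continuous : forall gamma1 gamma2, gamma1 <= gamma2 ->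
    exists C : R, forall (u1 : mf_space gamma1) (u2 : mf_space gamma2),
      mf_inj gamma1 u1 = mf_inj gamma2 u2 -> `|u1| <= C * `|u2| ;
  mf_dense : forall gamma1 gamma2, gamma1 <= gamma2 ->
    dense (mf_inj gamma1 @^-1` range (mf_inj gamma2)) ;
  mf_interpolation : forall gamma1 gamma2 gamma3,
    gamma1 <= gamma2 -> gamma2 <= gamma3 ->
    exists C : R, forall (u1 : mf_space gamma1) (u2 : mf_space gamma2)
                         (u3 : mf_space gamma3),
      mf_inj gamma1 u1 = mf_inj gamma3 u3 ->
      mf_inj gamma2 u2 = mf_inj gamma3 u3 ->
      `|u2| `^ (gamma3 - gamma1)
        <= C * (`|u1| `^ (gamma3 - gamma2) * `|u3| `^ (gamma2 - gamma1)) }.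

(* A normed space is presented below as a vector space V with an extended norm
   N : V -> \bar R: its elements are the v with N v < +oo.  A space of operators
   is presented in the same way, by total functions of which only the values on
   the finite-norm vectors matter. *)

Section norms.
Context {R : realType}.
Local Open Scope ereal_scope.

Definition euclid (n : nat) (x : 'rV[R]_n) : \bar R :=
  (Num.sqrt (\sum_(i < n) x ord0 i ^+ 2)%R)%:E.

Definition linear_on (U W : lmodType R) (D : set U) (f : U -> W) : Prop :=
  forall (a : R) (u v : U), D u -> D v ->
    f (a *: u + v)%R = (a *: f u + f v)%R.

(* Operator norm on L((U, N), (W, M)); it is +oo exactly when f is not a bounded
   linear map from (U, N) to (W, M). *)
Definition opnorm (U W : lmodType R) (N : U -> \bar R) (M : W -> \bar R)
    (f : U -> W) : \bar R :=
  if `[< linear_on [set u | N u < +oo] f >]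
  then ereal_sup [set M (f u) | u in [set u | N u <= 1]]
  else +oo.

Variable H : monotone_family R.

(* |v|_gamma, equal to +oo (infimum of the empty set) if v is not in H_gamma. *)
Definition hnorm (gamma : R) (v : mf_amb H) : \bar R :=
  ereal_inf [set `|u|%:E | u in [set u : mf_space H gamma | mf_inj H gamma u = v]].

(* H_gamma^e = L(R^e, H_gamma). *)
Definition hnorme (e : nat) (gamma : R) : ('rV[R]_e -> mf_amb H) -> \bar R :=
  opnorm (@euclid e) (hnorm gamma).

(* H_gamma^{e1 x e} = L(R^e, H_gamma^e1). *)
Definition hnormee (e1 e : nat) (gamma : R) :
    ('rV[R]_e -> 'rV[R]_e1 -> mf_amb H) -> \bar R :=
  opnorm (@euclid e) (@hnorme e1 gamma).

(* L(H_gamma1^e1, H_gamma2^e2). *)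
Definition onorm (e1 e2 : nat) (gamma1 gamma2 : R) :
    (('rV[R]_e1 -> mf_amb H) -> 'rV[R]_e2 -> mf_amb H) -> \bar R :=
  opnorm (@hnorme e1 gamma1) (@hnorme e2 gamma2).

(* L(H_gamma1^e1, H_gamma2^{e2 x e}). *)
Definition onorme (e1 e2 e : nat) (gamma1 gamma2 : R) :
    (('rV[R]_e1 -> mf_amb H) -> 'rV[R]_e -> 'rV[R]_e2 -> mf_amb H) -> \bar R :=
  opnorm (@hnorme e1 gamma1) (@hnormee e2 e gamma2).

Definition holder_path (T alpha : R) (e : nat) (X : R -> 'rV[R]_e) : Prop :=
  exists K : R, forall s t, (0 <= s <= t)%R -> (t <= T)%R ->
    euclid (X t - X s)%R <= (K * (t - s) `^ alpha)%:E.

End norms.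

Section filtrations.
Context {R : realType} {d : measure_display} {Omega : measurableType d}.
Variables (P : probability Omega R) (T : R) (F : R -> set (set Omega)).

Definition usual_filtration : Prop :=
  [/\ forall t, t \in `[0, T] ->
        sigma_algebra setT (F t) /\ F t `<=` d.-measurable,
      forall s t, 0 <= s -> s <= t -> t <= T -> F s `<=` F t,
      forall t, t \in `[0, T[ -> F t = \bigcap_(s in `]t, T]) F s
    & forall N, P.-negligible N -> F 0 N].

Definition left_continuous_filtration : Prop :=
  forall t, t \in `]0, T] -> F t = <<s \bigcup_(s in `[0, t[) F s >>.

End filtrations.

Section bochner.
Context {R : realType} {d : measure_display} {Omega : measurableType d}.
Variable P : probability Omega R.
Context {V : lmodType R}.
Variable N : V -> \bar R.
Local Open Scope ereal_scope.

Implicit Types (G : set (set Omega)) (f Z W : Omega -> V).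

(* The list of the (B_i, v_i) stands for the simple function
   sum_i 1_{B_i} v_i. *)
Definition simple_rep : Type := seq (set Omega * V).

Definition simple_fun (g : simple_rep) (w : Omega) : V :=
  (\sum_(b <- g) (\1_(b.1) w : R) *: b.2)%R.

Definition simple_in G (g : simple_rep) : Prop :=
  forall i, (i < size g)%N ->
    G (nth (set0, 0%R) g i).1 /\ N (nth (set0, 0%R) g i).2 < +oo.

Definition simple_integral (A : set Omega) (g : simple_rep) : V :=
  (\sum_(b <- g) fine (P (A `&` b.1)) *: b.2)%R.

Definition ae_approx (g : nat -> simple_rep) f : Prop :=
  {ae P, forall w, N (f w - simple_fun (g n) w)%R @[n --> \oo] --> 0}.

Definition strongly_measurable G f : Prop :=
  exists2 g : nat -> simple_rep,
    forall n, simple_in G (g n) & ae_approx g f.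

(* v is the Bochner integral of f over A. *)
Definition is_bochner (A : set Omega) f (v : V) : Prop :=
  exists g : nat -> simple_rep,
    [/\ forall n, simple_in d.-measurable (g n),
        ae_approx g f,
        \int[P]_(w in A) N (f w - simple_fun (g n) w)%R @[n --> \oo] --> 0
      & N (simple_integral A (g n) - v)%R @[n --> \oo] --> 0].

(* W is a version of E[Z | G]. *)
Definition is_condexp G Z W : Prop :=
  [/\ strongly_measurable G W,
      \int[P]_w N (W w) < +oo
    & forall A, G A -> exists2 v, is_bochner A Z v & is_bochner A W v].

(* A version of E[Z | G]: it is determined up to P-null sets, and exists when
   (V, N) is complete and Z is Bochner integrable. *)
Definition condexp G Z : Omega -> V := xget (fun=> 0%R) [set W | is_condexp G Z W].

Variable p : \bar R.

(* || |f|_N ||_{L^p(Omega)}; p = m%:E or p = +oo. *)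
Definition Lpnorm f : \bar R := 'N[P]_p[N \o f].

Definition in_Lp G f : Prop := strongly_measurable G f /\ Lpnorm f < +oo.

Variables (T : R) (F : R -> set (set Omega)).

Implicit Types (Y : R -> Omega -> V) (A : R -> R -> Omega -> V).

Definition sup_norm Y : \bar R := ereal_sup [set Lpnorm (Y t) | t in `[0%R, T]].

Definition holder_norm (beta : R) A : \bar R :=
  ereal_sup [set Lpnorm (A q.1 q.2) * ((q.2 - q.1) `^ beta)^-1%:E |
    q in [set q : R * R | (0 <= q.1 < q.2)%R /\ (q.2 <= T)%R]].

Definition delta Y : R -> R -> Omega -> V := fun s t w => (Y t w - Y s w)%R.

(* C([0,T], L^p(Omega, V)). *)
Definition CL Y : Prop :=
  (forall t, t \in `[0%R, T] -> in_Lp d.-measurable (Y t)) /\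
  (forall t, t \in `[0%R, T] ->
     Lpnorm (fun w => Y s w - Y t w)%R @[s --> within `[0%R, T] (nbhs t)] --> 0).

(* C^beta L_p V.  Measurability in time of t |-> Y_t in L^p is implied by
   continuity. *)
Definition CbetaL (beta : R) Y : Prop :=
  [/\ CL Y,
      forall t, t \in `[0%R, T] -> strongly_measurable (F t) (Y t)
    & holder_norm beta (delta Y) < +oo].

Definition Delta2 : set (R * R) :=
  [set q : R * R | (0 <= q.1 <= q.2)%R /\ (q.2 <= T)%R].

(* C_2^beta L_p V, with continuity at each point q of Delta2 only required along
   the points of J q. *)
Definition C2L_along (J : R * R -> set (R * R)) (beta : R) A : Prop :=
  [/\ forall q, Delta2 q -> in_Lp (F q.2) (A q.1 q.2),
      ereal_sup [set Lpnorm (A q.1 q.2) | q in Delta2] < +oo,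
      forall q, Delta2 q ->
        Lpnorm (fun w => A r.1 r.2 w - A q.1 q.2 w)%R
          @[r --> within (Delta2 `&` J q) (nbhs q)] --> 0
    & holder_norm beta A < +oo].

End bochner.

Definition all_points {R : realType} (q : R * R) : set (R * R) := setT.

(* (s', t') with s' >= s, for q = (s, t).  For a filtration that jumps at a fixed
   time, s |-> E_s Z is right-continuous in L^p but may fail to be
   left-continuous. *)
Definition right_points {R : realType} (q : R * R) : set (R * R) :=
  [set r | q.1 <= r.1].

Section spaces.
Context {R : realType} {d : measure_display} {Omega : measurableType d}.
Variables (P : probability Omega R) (T : R) (F : R -> set (set Omega)).
Variable H : monotone_family R.
Context {e : nat}.
Variable X : R -> 'rV[R]_e.
Local Open Scope ereal_scope.

Local Notation V := (mf_amb H).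

Section rough_paths.
Variables (e1 : nat) (m beta beta' gamma : R).

Local Notation proc := (R -> Omega -> 'rV[R]_e1 -> V).
Local Notation proc' := (R -> Omega -> 'rV[R]_e -> 'rV[R]_e1 -> V).
Local Notation N := (@hnorme R H e1).
Local Notation Ne := (@hnormee R H e1 e).

Definition ELH (Y : proc) : Prop :=
  CL P (N gamma) m%:E T Y /\
  CbetaL P (N (gamma - beta)%R) m%:E T F beta Y.

Definition ELH_norm (Y : proc) : \bar R :=
  sup_norm P (N gamma) m%:E T Y +
  holder_norm P (N (gamma - beta)%R) m%:E T beta (delta Y).

(* E^{beta'} L_m H_{gamma - beta}^{e1 x e}. *)
Definition ELH' (Y' : proc') : Prop :=
  CL P (Ne (gamma - beta)%R) m%:E T Y' /\
  CbetaL P (Ne (gamma - beta - beta')%R) m%:E T F beta' Y'.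

Definition ELH'_norm (Y' : proc') : \bar R :=
  sup_norm P (Ne (gamma - beta)%R) m%:E T Y' +
  holder_norm P (Ne (gamma - beta - beta')%R) m%:E T beta' (delta Y').

Definition RY (Y : proc) (Y' : proc') : R -> R -> Omega -> 'rV[R]_e1 -> V :=
  fun s t w => (Y t w - Y s w - Y' s w (X t - X s))%R.

Definition ERY (Y : proc) (Y' : proc') : R -> R -> Omega -> 'rV[R]_e1 -> V :=
  fun s t => condexp P (N (gamma - beta - beta')%R) (F s) (RY Y Y' s t).

(* (Y, Y') in D_X^{beta, beta'} L_m H_gamma^e1, up to the continuity of E_. R^Y,
   which is only required along J (see [C2L_along]). *)
Definition DLH_along (J : R * R -> set (R * R)) (Y : proc) (Y' : proc') : Prop :=
  [/\ ELH Y, ELH' Y'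
    & C2L_along P (N (gamma - beta - beta')%R) m%:E T F J
        (beta + beta')%R (ERY Y Y')].

(* (Y, Y') in D_X^{beta, beta'} L_m H_gamma^e1. *)
Definition DLH (Y : proc) (Y' : proc') : Prop := DLH_along all_points Y Y'.

Definition DLH_norm (Y : proc) (Y' : proc') : \bar R :=
  ELH_norm Y + ELH'_norm Y' +
  holder_norm P (N (gamma - beta - beta')%R) m%:E T (beta + beta')%R (ERY Y Y').

End rough_paths.

Section operators.
Variables (e1 e2 : nat) (beta beta' gamma1 gamma2 : R).

Local Notation oproc := (R -> Omega -> ('rV[R]_e1 -> V) -> 'rV[R]_e2 -> V).
Local Notation oproc' :=
  (R -> Omega -> ('rV[R]_e1 -> V) -> 'rV[R]_e -> 'rV[R]_e2 -> V).
Local Notation N := (@onorm R H e1 e2).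
Local Notation Ne := (@onorme R H e1 e2 e).

(* E^b L_oo for the norms |.|_{(g1, g2)-op} and
   |.|_{(g1 - b, g2 - b)-op}, given as M and M'. *)
Definition ELop (W : lmodType R) (M M' : W -> \bar R) (b : R)
    (f : R -> Omega -> W) : Prop :=
  CL P M +oo T f /\ CbetaL P M' +oo T F b f.

Definition ELop_norm (W : lmodType R) (M M' : W -> \bar R) (b : R)
    (f : R -> Omega -> W) : \bar R :=
  sup_norm P M +oo T f + sup_norm P M' +oo T f
  + holder_norm P M' +oo T b (delta f).

Definition RG (G : oproc) (G' : oproc') :
    R -> R -> Omega -> ('rV[R]_e1 -> V) -> 'rV[R]_e2 -> V :=
  fun s t w => (G t w - G s w - (fun u => G' s w u (X t - X s)))%R.

Definition ERG (G : oproc) (G' : oproc') :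
    R -> R -> Omega -> ('rV[R]_e1 -> V) -> 'rV[R]_e2 -> V :=
  fun s t =>
    condexp P (N gamma1 (gamma2 - beta - beta')%R) (F s) (RG G G' s t).

(* (G, G') in D_X^{beta, beta'} L_oo L_{gamma1, gamma2}(H^e1, H^e2). *)
Definition DLop (G : oproc) (G' : oproc') : Prop :=
  [/\ ELop (N gamma1 gamma2) (N (gamma1 - beta)%R (gamma2 - beta)%R) beta G,
      ELop (N (gamma1 - beta)%R (gamma2 - beta)%R)
           (N (gamma1 - beta - beta')%R (gamma2 - beta - beta')%R) beta' G,
      ELop (Ne gamma1 (gamma2 - beta)%R)
           (Ne (gamma1 - beta')%R (gamma2 - beta - beta')%R)
           beta' G'
    & C2L_along P (N gamma1 (gamma2 - beta - beta')%R) +oo T F all_points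
        (beta + beta')%R (ERG G G')].

Definition DLop_norm (G : oproc) (G' : oproc') : \bar R :=
  ELop_norm (N gamma1 gamma2) (N (gamma1 - beta)%R (gamma2 - beta)%R) beta G
  + ELop_norm (N (gamma1 - beta)%R (gamma2 - beta)%R)
      (N (gamma1 - beta - beta')%R (gamma2 - beta - beta')%R) beta' G
  + ELop_norm (Ne gamma1 (gamma2 - beta)%R)
      (Ne (gamma1 - beta')%R (gamma2 - beta - beta')%R) beta' G'
  + holder_norm P (N gamma1 (gamma2 - beta - beta')%R) +oo T
      (beta + beta')%R (ERG G G').

End operators.

Definition opY (e1 e2 : nat)
    (G : R -> Omega -> ('rV[R]_e1 -> V) -> 'rV[R]_e2 -> V)
    (Y : R -> Omega -> 'rV[R]_e1 -> V) : R -> Omega -> 'rV[R]_e2 -> V :=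
  fun t w => G t w (Y t w).

(* G Y' + G' Y, where G acts componentwise: (G Y') x = G (Y' x). *)
Definition opY' (e1 e2 : nat)
    (G : R -> Omega -> ('rV[R]_e1 -> V) -> 'rV[R]_e2 -> V)
    (G' : R -> Omega -> ('rV[R]_e1 -> V) -> 'rV[R]_e -> 'rV[R]_e2 -> V)
    (Y : R -> Omega -> 'rV[R]_e1 -> V)
    (Y' : R -> Omega -> 'rV[R]_e -> 'rV[R]_e1 -> V) :
    R -> Omega -> 'rV[R]_e -> 'rV[R]_e2 -> V :=
  fun t w x => (G t w (Y' t w x) + G' t w (Y t w) x)%R.

End spaces.

(* Main.v *)
(* The remainder of the product splits as
     R^{GY}_{s,t} = R^G_{s,t} Y_s + G_s R^Y_{s,t} + (delta G)_{s,t} (delta Y)_{s,t}.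
   Under E_s the first two terms become (E_s R^G) Y_s and G_s (E_s R^Y), because Y_s and
   G_s are F_s-measurable, and the third one is already of order beta + beta' since
   delta G is beta'-Hoelder on H_{gamma1 - beta - beta'}, which contains H_{gamma1 - beta}.
   The derivative term G' Y needs the beta'-Hoelder regularity of Y in H_{gamma1 - beta'},
   obtained by interpolation.

   Conditional expectations of Hilbert-space-valued functions are constructed from
   conditional probabilities (Radon-Nikodym) by density of simple functions; they contract
   every L^m norm.  The continuity of s |-> E_s Z (from the right, and two-sided when the
   filtration is left-continuous) reduces in the same way to that of s |-> P(B | F_s), where
   the L^2 norm of P(B | F_s) is nondecreasing in s and the squared L^2 distance between two
   of these functions is the difference of their squared norms. *)

Require Import Defs.
From HB Require Import structures.
From mathcomp Require Import ring lra measurable_realfun ess_sup_inf.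

Local Open Scope classical_set_scope.
Local Open Scope ring_scope.

(** * Extended norms and operator norms *)

(** Three obstacles shape the development. An operator is a total function of which only the values
    at finite-norm vectors matter, so its norm is not definite. Almost sure identities are therefore
    stated as vanishing of the norm of a difference, and every bilinear operation is treated once,
    through [pairing], with one norm per level of the scale. The bound on R^G starts from
    H_{gamma1}, while Y is assumed adapted in H_{gamma1 - beta} only. Pulling Y_s out of E_s needs
    its F_s-measurability in the stronger norm, which conditional expectation itself supplies.
    Finally, E_s R^Y and E_s R^G are continuous by assumption, but E_s of (delta G)(delta Y) is a
    new conditional expectation whose integrand and sigma-algebra both move. Its continuity is the
    one point where the regularity of the filtration in time enters. In the final constant, 7 counts
    the terms bounded by the product of the two norms without any embedding: 2 for GY, 3 for its
    derivative, 2 for the remainder. *)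

Section extended_norms.
Context {R : realType}.
Local Open Scope ereal_scope.

(** A seminorm with value +oo off the space. Definiteness is kept apart, as [edefinite]: an operator
    norm vanishes on any function that is zero at the finite-norm vectors, whatever its other
    values. *)
Record enorm (V : lmodType R) (N : V -> \bar R) : Prop := Enorm {
  enorm_ge0 : forall v, 0 <= N v ;
  enormD : forall u v, N (u + v)%R <= N u + N v ;
  enormZ : forall a v, N (a *: v)%R = `|a|%:E * N v }.

Definition edefinite (V : lmodType R) (N : V -> \bar R) : Prop :=
  forall v, N v = 0 -> v = 0%R.

Definition ecauchy (V : lmodType R) (N : V -> \bar R) (u : nat -> V) : Prop :=
  forall eps : R, (0 < eps)%R -> exists n0, forall n k,
    (n0 <= n)%N -> (n0 <= k)%N -> N (u n - u k)%R <= eps%:E.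

(** Only differences need be finite, in the Cauchy condition as in the convergence, so terms of
    infinite norm are allowed. This is why the completeness proofs begin by subtracting a fixed term
    of the sequence. *)
Definition ecomplete (V : lmodType R) (N : V -> \bar R) : Prop :=
  forall u, ecauchy N u -> exists v, N (u n - v)%R @[n --> \oo] --> 0.

Section theory.
Variables (V : lmodType R) (N : V -> \bar R).
Hypothesis hN : enorm N.

Lemma enorm0 : N 0%R = 0.
Proof. by have := enormZ hN 0%R 0%R; rewrite scale0r normr0 mul0e. Qed.

Lemma enormN v : N (- v)%R = N v.
Proof. by rewrite -scaleN1r (enormZ hN) normrN1 mul1e. Qed.

Lemma enormB u v : N (u - v)%R <= N u + N v.
Proof. by rewrite (le_trans (enormD hN _ _))// enormN. Qed.

Lemma enorm_subC u v : N (u - v)%R = N (v - u)%R.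
Proof. by rewrite -enormN opprB. Qed.

Lemma enorm_triangle w u v : N (u - v)%R <= N (u - w)%R + N (w - v)%R.
Proof. by rewrite -[X in N X <= _](subrKA w); exact: enormD. Qed.

Lemma enorm_leDB u v : N u <= N (u - v)%R + N v.
Proof. by rewrite -{1}(subrK v u); exact: enormD. Qed.

Lemma enormD_lty u v : N u < +oo -> N v < +oo -> N (u + v)%R < +oo.
Proof. by move=> *; rewrite (le_lt_trans (enormD hN _ _))// lte_add_pinfty. Qed.

Lemma enormZ_lty a u : N u < +oo -> N (a *: u)%R < +oo.
Proof. by move=> Nu; rewrite (enormZ hN) lte_mul_pinfty. Qed.

Lemma enormB_lty u v : N u < +oo -> N v < +oo -> N (u - v)%R < +oo.
Proof. by move=> *; rewrite (le_lt_trans (enormB _ _))// lte_add_pinfty. Qed.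

Lemma enorm_fin_num u : N u < +oo -> N u \is a fin_num.
Proof. by move=> ?; rewrite ge0_fin_numE// enorm_ge0. Qed.

Lemma enorm_cvg_lty (u : nat -> V) v :
  N (u n - v)%R @[n --> \oo] --> 0 -> (forall n, N (u n) < +oo) -> N v < +oo.
Proof.
move=> /fine_cvgP[+ _] uy => -[n _ /(_ n (leqnn n))/= h].
rewrite (le_lt_trans (enorm_leDB v (u n)))// enorm_subC lte_add_pinfty//.
by rewrite -ge0_fin_numE// enorm_ge0.
Qed.

End theory.

(** The epsilon form tolerates infinite values away from the limit, as occur for extended norms.
    Nonnegativity removes the absolute value and reduces finiteness to an upper bound. *)
Lemma cvge0P T (F : set_system T) {FF : Filter F} (f : T -> \bar R) :
  (forall x, 0 <= f x) ->
  (f x @[x --> F] --> 0) <->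
  (forall eps : R, (0 < eps)%R -> \forall x \near F, f x <= eps%:E).
Proof.
move=> f0; split.
  move=> /fine_cvgP[ffin /cvgrPdist_le fc] eps /fc; apply: filterS2 ffin => x fx.
  rewrite sub0r normrN ger0_norm ?fine_ge0//= => h.
  by rewrite -(fineK fx) lee_fin.
move=> h; apply/fine_cvgP; split.
  by apply: filterS (h _ ltr01) => x fx; rewrite ge0_fin_numE// (le_lt_trans fx) ?ltry.
apply/cvgrPdist_le => eps /h; apply: filterS => x fx.
rewrite sub0r normrN ger0_norm ?fine_ge0//= -lee_fin fineK//.
by rewrite ge0_fin_numE// (le_lt_trans fx) ?ltry.
Qed.

Section cvge0.
Context {T : Type} {F : set_system T} {FF : Filter F}.
Implicit Types f g : T -> \bar R.

Lemma squeeze_cvge0 f g :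
  (forall x, 0 <= f x) -> (\forall x \near F, f x <= g x) ->
  g x @[x --> F] --> 0 -> f x @[x --> F] --> 0.
Proof.
move=> f0 fg g0; apply: (@squeeze_cvge _ _ _ _ (fun=> 0) _ _ _ 0 _ g0); last exact: cvg_cst.
by apply: filterS fg => x ->; rewrite f0.
Qed.

Lemma cvge0D f g : (forall x, 0 <= f x) -> (forall x, 0 <= g x) ->
  f x @[x --> F] --> 0 -> g x @[x --> F] --> 0 -> f x + g x @[x --> F] --> 0.
Proof.
move=> f0 g0 /(cvge0P f0) hf /(cvge0P g0) hg.
apply/cvge0P => //; first by move=> x; rewrite adde_ge0.
move=> eps e0; have e20 : (0 < eps / 2)%R by rewrite divr_gt0.
apply: filterS2 (hf _ e20) (hg _ e20) => x fx gx.
by rewrite (le_trans (leeD fx gx))// -EFinD -splitr.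
Qed.

Lemma cvge0Zl (c : \bar R) f : c \is a fin_num ->
  f x @[x --> F] --> 0 -> c * f x @[x --> F] --> 0.
Proof. by move=> cfin f0; rewrite -(mule0 c); exact: cvgeZl. Qed.

Lemma cvge0Zr (c : \bar R) f : c \is a fin_num ->
  f x @[x --> F] --> 0 -> f x * c @[x --> F] --> 0.
Proof. by move=> cfin f0; under eq_fun do rewrite muleC; exact: cvge0Zl. Qed.

Lemma cvge0M_bounded (c : \bar R) f g : c \is a fin_num ->
  (forall x, 0 <= f x) -> (forall x, 0 <= g x) ->
  (\forall x \near F, f x <= c) -> g x @[x --> F] --> 0 ->
  f x * g x @[x --> F] --> 0.
Proof.
move=> cfin f0 g0 fc /(cvge0Zl cfin); apply: squeeze_cvge0.
  by move=> x; rewrite mule_ge0.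
by apply: filterS fc => x fx; rewrite lee_wpmul2r.
Qed.

Lemma cvge0_near_le1 f : (forall x, 0 <= f x) -> f x @[x --> F] --> 0 ->
  \forall x \near F, f x <= 1.
Proof. by move=> f0 /cvge0P => /(_ f0 1%R ltr01). Qed.

End cvge0.

Lemma enorm_lim_eq0 (V : lmodType R) (N : V -> \bar R) (u : nat -> V) v w :
  enorm N -> N (u n - v)%R @[n --> \oo] --> 0 ->
  N (u n - w)%R @[n --> \oo] --> 0 -> N (v - w)%R = 0.
Proof.
move=> hN uv uw; apply/eqP; rewrite eq_le (enorm_ge0 hN) andbT.
have h : N (u n - v)%R + N (u n - w)%R @[n --> \oo] --> 0.
  by apply: cvge0D => // n; exact: (enorm_ge0 hN).
apply: (cvge_ge _ h).
by apply: nearW => n; rewrite (enorm_subC hN (u n) v); exact: enorm_triangle.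
Qed.

Lemma enorm_cvg (V : lmodType R) (N : V -> \bar R) (u : nat -> V) v :
  enorm N -> (forall n, N (u n) < +oo) ->
  N (u n - v)%R @[n --> \oo] --> 0 -> N (u n) @[n --> \oo] --> N v.
Proof.
move=> hN uy uv; have vy := enorm_cvg_lty hN uv uy.
rewrite -(fineK (enorm_fin_num hN vy)); apply/fine_cvgP; split.
  by apply: nearW => n; exact: enorm_fin_num.
apply/cvgrPdist_le => e e0; have /cvge0P := uv => /(_ (fun=> enorm_ge0 hN _) e e0).
apply: filterS => n un.
have [nf vf] := (enorm_fin_num hN (uy n), enorm_fin_num hN vy).
have h1 : (fine (N (u n)) <= e + fine (N v))%R.
  by rewrite -lee_fin EFinD !fineK// (le_trans (enorm_leDB hN _ v))// leeD2r.
have h2 : (fine (N v) <= e + fine (N (u n)))%R.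
  rewrite -lee_fin EFinD !fineK// (le_trans (enorm_leDB hN _ (u n)))//.
  by rewrite (enorm_subC hN) leeD2r.
by rewrite ler_norml; apply/andP; split; rewrite /=; lra.
Qed.

Section operator_norm.
Variables (U W : lmodType R) (N : U -> \bar R) (M : W -> \bar R).
Hypotheses (hN : enorm N) (hM : enorm M).
Implicit Types f g : U -> W.

Let D := [set u | N u < +oo].

Lemma opnorm_linear f : opnorm N M f < +oo -> linear_on D f.
Proof. by rewrite /opnorm; case: asboolP. Qed.

Lemma linear_on0 f : linear_on D f -> f 0%R = 0%R.
Proof.
have D0 : D 0%R by rewrite /D/= (enorm0 hN).
move=> /(_ (-1)%R 0%R 0%R D0 D0).
by rewrite scaler0 addr0 scaleN1r addNr.
Qed.

Lemma linear_onZ f a u : linear_on D f -> D u -> f (a *: u)%R = (a *: f u)%R.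
Proof.
move=> lf Du; have D0 : D 0%R by rewrite /D/= (enorm0 hN).
by rewrite -[in LHS](addr0 (a *: u)%R) lf// (linear_on0 lf) addr0.
Qed.

Lemma opnorm_le f (c : R) : (0 <= c)%R -> linear_on D f ->
  (forall u, N u <= 1 -> M (f u) <= c%:E) -> opnorm N M f <= c%:E.
Proof.
move=> c0 lf h; rewrite /opnorm; case: asboolP => // _.
by apply: ub_ereal_sup => _ [u Nu <-]; exact: h.
Qed.

Lemma opnorm_leM f (c : R) : (0 <= c)%R -> linear_on D f ->
  (forall u, N u < +oo -> M (f u) <= c%:E * N u) -> opnorm N M f <= c%:E.
Proof.
move=> c0 lf h; apply: opnorm_le => // u Nu.
rewrite (le_trans (h _ _)) ?(le_lt_trans Nu) ?ltry//.
by rewrite -[leRHS]mule1 lee_wpmul2l.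
Qed.

Lemma opnorm_ub f u : N u <= 1 -> M (f u) <= opnorm N M f.
Proof.
move=> Nu; rewrite /opnorm; case: asboolP => // _; last exact: leey.
by apply: ereal_sup_ubound; exists u.
Qed.

Lemma opnorm_ge0 f : 0 <= opnorm N M f.
Proof.
apply: le_trans (opnorm_ub f (u := 0%R) _); rewrite ?enorm_ge0//.
by rewrite (enorm0 hN).
Qed.

(** Normalising by [N u] fails when [N u] is zero, so [u] is divided by [N u + e], and [e] is then
    sent to 0. *)
Lemma opnorm_apply f u : opnorm N M f < +oo -> N u < +oo ->
  M (f u) <= opnorm N M f * N u.
Proof.
move=> fy uy; have lf := opnorm_linear fy.
have ofin : opnorm N M f \is a fin_num by rewrite ge0_fin_numE// opnorm_ge0.
have ufin := enorm_fin_num hN uy.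
have [c cE] : exists c, opnorm N M f = c%:E by exists (fine (opnorm N M f)); rewrite fineK.
have [n nE] : exists n, N u = n%:E by exists (fine (N u)); rewrite fineK.
have o0 : (0 <= c)%R by rewrite -lee_fin -cE opnorm_ge0.
have n0 : (0 <= n)%R by rewrite -lee_fin -nE (enorm_ge0 hN).
have key e : (0 < e)%R -> M (f u) <= (c * (n + e))%:E.
  move=> e0; have ne0 : (0 < n + e)%R by rewrite ltr_wpDl.
  have : N ((n + e)^-1 *: u)%R <= 1.
    rewrite (enormZ hN) nE gtr0_norm ?invr_gt0// -EFinM lee_fin.
    by rewrite mulrC ler_pdivrMr// mul1r lerDl ltW.
  move=> /(opnorm_ub f); rewrite linear_onZ// (enormZ hM) cE.
  by rewrite gtr0_norm ?invr_gt0// lee_pdivrMl// EFinM muleC.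
rewrite cE nE; apply/lee_addgt0Pr => e e0.
(* The divisor [c + 1] stays positive when [c] is zero, and it makes the excess [c * (e / (c + 1))]
   at most [e]. *)
have c1 : (0 < c + 1)%R by rewrite ltr_wpDl.
apply: (le_trans (key (e / (c + 1))%R _)); first by rewrite divr_gt0.
rewrite -EFinM -EFinD lee_fin mulrDr lerD2l mulrCA ger_pMr//.
by rewrite ler_pdivrMr// mul1r lerDl.
Qed.

Lemma opnorm_enorm : enorm (opnorm N M).
Proof.
have D0 : D 0%R by rewrite /D/= (enorm0 hN).
split; first exact: opnorm_ge0.
- move=> f g; have [fy|] := ltP (opnorm N M f) +oo; last first.
    by rewrite leye_eq => /eqP ->; rewrite addye ?leey// gt_eqF// (lt_le_trans _ (opnorm_ge0 g)).
  have [gy|] := ltP (opnorm N M g) +oo; last first.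
    by rewrite leye_eq => /eqP ->; rewrite addey ?leey// gt_eqF// (lt_le_trans _ (opnorm_ge0 f)).
  have ofin : opnorm N M f \is a fin_num by rewrite ge0_fin_numE// opnorm_ge0.
  have gfin : opnorm N M g \is a fin_num by rewrite ge0_fin_numE// opnorm_ge0.
  rewrite -(fineK ofin) -(fineK gfin) -EFinD; apply: opnorm_le.
  + by rewrite addr_ge0// fine_ge0// opnorm_ge0.
  + move=> a u v Du Dv; rewrite !fctE (opnorm_linear fy)// (opnorm_linear gy)//.
    by rewrite scalerDr addrACA.
  + move=> u Nu; rewrite fctE EFinD !fineK// (le_trans (enormD hM _ _))//.
    by rewrite leeD// opnorm_ub.
(* One inequality for all scalars is enough: applied to the inverse scalar it gives the reverse one,
   and also shows that [a *: f] has infinite norm when [f] has. *)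
- have key a f : opnorm N M f < +oo -> opnorm N M (a *: f)%R <= `|a|%:E * opnorm N M f.
    move=> fy; have ofin : opnorm N M f \is a fin_num by rewrite ge0_fin_numE// opnorm_ge0.
    rewrite -(fineK ofin) -EFinM; apply: opnorm_le.
    + by rewrite mulr_ge0// fine_ge0// opnorm_ge0.
    + move=> b u v Du Dv; rewrite !fctE (opnorm_linear fy)//.
      by rewrite scalerDr !scalerA mulrC.
    + move=> u Nu; rewrite fctE EFinM fineK// (enormZ hM).
      by rewrite lee_wpmul2l// ?lee_fin// opnorm_ub.
  move=> a f; have [->|a0] := eqVneq a 0%R.
    rewrite scale0r normr0 mul0e; apply/eqP; rewrite eq_le opnorm_ge0 andbT.
    apply: opnorm_le => //; first by move=> b u v _ _; change (0%R = b *: 0 + 0 :> W)%R; rewrite scaler0 addr0.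
    by move=> u _; change (M 0%R <= 0); rewrite (enorm0 hM).
  have [fy|fy] := ltP (opnorm N M f) +oo.
    apply/eqP; rewrite eq_le key//= -lee_pdivlMl ?normr_gt0// -normfV.
    rewrite -{1}(scalerK a0 f).
    apply: (key _ _ _); rewrite (le_lt_trans (key _ _ fy))// lte_mul_pinfty ?opnorm_ge0//.
  move: fy; rewrite leye_eq => /eqP fy.
  rewrite fy gt0_muley ?lte_fin ?normr_gt0//.
  apply/eqP; rewrite -leye_eq leNgt; apply/negP => afy.
  have := key a^-1%R _ afy; rewrite scalerK// fy leye_eq => /eqP.
  by apply/eqP; rewrite lt_eqF// lte_mul_pinfty ?opnorm_ge0.
Qed.

Lemma opnorm_definite : (forall u, N u < +oo) -> edefinite M ->
  edefinite (opnorm N M).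
Proof.
move=> Ny dM f f0; apply/funext => u; apply: dM; apply/eqP.
rewrite eq_le (enorm_ge0 hM) andbT.
by rewrite (le_trans (@opnorm_apply f u _ _))// f0 ?mul0e.
Qed.

(** The limit is taken pointwise at the finite-norm vectors, after subtracting [f n0], because the
    terms themselves need not be bounded operators. Definiteness of [M] turns linearity up to norm
    zero into the equality that [linear_on] demands. *)
Lemma opnorm_complete : edefinite M -> ecomplete M -> ecomplete (opnorm N M).
Proof.
move=> dM cM f cf.
have [n0 hn0] : exists n0, forall n k, (n0 <= n)%N -> (n0 <= k)%N ->
    opnorm N M (f n - f k)%R <= 1 by exact: cf.
pose g n := (f (n0 + n)%N - f n0)%R.
have gy n : opnorm N M (g n) < +oo.
  by rewrite (@le_lt_trans _ _ 1) ?ltry// hn0// leq_addr.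
have gB n k : (g n - g k = f (n0 + n)%N - f (n0 + k)%N)%R.
  by rewrite /g opprB addrA subrK.
have gc u : D u -> ecauchy M (fun n => g n u).
  move=> Du eps e0; have ufin := enorm_fin_num hN Du.
  have c0 : (0 < fine (N u) + 1)%R by rewrite ltr_wpDl// fine_ge0// (enorm_ge0 hN).
  have [n1 hn1] := cf (eps / (fine (N u) + 1))%R (divr_gt0 e0 c0).
  exists n1 => n k n1n n1k.
  have gnky : opnorm N M (g n - g k)%R < +oo by rewrite (enormB_lty opnorm_enorm).
  have -> : (g n u - g k u = (g n - g k) u)%R by rewrite !fctE.
  rewrite (le_trans (opnorm_apply gnky Du))// gB.
  rewrite (@le_trans _ _ ((eps / (fine (N u) + 1))%:E * N u))//.
    by rewrite lee_wpmul2r ?(enorm_ge0 hN)// hn1// (leq_trans _ (leq_addl _ _)).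
  rewrite -(fineK ufin) -EFinM lee_fin/= mulrAC ler_pdivrMr//.
  by rewrite ler_wpM2l ?(ltW e0)// lerDl.
have [h hh] : exists h : U -> W, forall u, D u -> M (g n u - h u)%R @[n --> \oo] --> 0.
  have /choice[h hh] : forall u, exists w, D u -> M (g n u - w)%R @[n --> \oo] --> 0.
    move=> u; have [Du|nDu] := pselect (D u); last by exists 0%R.
    by have [w ?] := cM _ (gc u Du); exists w.
  by exists h.
have lh : linear_on D h.
  move=> a u v Du Dv; apply/eqP; rewrite -subr_eq0; apply/eqP/dM.
  have Dauv : D (a *: u + v)%R by rewrite /D/= (enormD_lty hN)// (enormZ_lty hN).
  apply: (enorm_lim_eq0 hM (hh _ Dauv)).
  apply: (@squeeze_cvge0 _ _ _ _ (fun n => `|a|%:E * M (g n u - h u)%R + M (g n v - h v)%R)) => [n||].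
  - exact: (enorm_ge0 hM).
  - apply: nearW => n; rewrite (opnorm_linear (gy n))//.
    rewrite opprD addrACA -scalerBr.
    by rewrite (le_trans (enormD hM _ _))// (enormZ hM).
  - apply: cvge0D => [n|n||]; rewrite ?mule_ge0 ?(enorm_ge0 hM)//; last exact: hh.
    by apply: cvge0Zl => //; exact: hh.
exists (h + f n0)%R.
apply/cvge0P; first by move=> n; exact: opnorm_ge0.
move=> eps e0; have [n1 hn1] := cf eps e0.
exists (n0 + n1)%N => // n /= n01n.
have -> : (f n - (h + f n0) = g (n - n0)%N - h)%R.
  by rewrite /g subnKC ?(leq_trans (leq_addr _ _) n01n)// opprD addrCA addrC.
apply: opnorm_le; first exact: ltW.
  move=> a u v Du Dv; rewrite !fctE (opnorm_linear (gy _))// lh//.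
  by rewrite opprD addrACA -scalerBr.
move=> u Nu; rewrite fctE.
have Du : D u by rewrite /D/= (le_lt_trans Nu) ?ltry.
apply/lee_addgt0Pr => e e'0.
have /cvge0P := hh u Du => /(_ (fun=> enorm_ge0 hM _)) /(_ e e'0)[n2 _ hn2].
(* [n1] serves the Cauchy bound, which is uniform in [u], and [n2] the pointwise convergence at this
   [u]. The dependence of [k] on [u] leaves no trace in the final bound. *)
set k := (n1 + n2)%N.
rewrite (le_trans (enorm_triangle hM (g k u) _ _))// leeD//.
  have -> : (g (n - n0)%N u - g k u = (g (n - n0)%N - g k) u)%R by rewrite !fctE.
  rewrite (le_trans (opnorm_ub _ Nu))// gB hn1//.
    by rewrite subnKC ?(leq_trans (leq_addr _ _) n01n)// (leq_trans (leq_addl _ _) n01n).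
  by rewrite /k addnCA leq_addr.
by apply: hn2; rewrite /= /k leq_addl.
Qed.

End operator_norm.

End extended_norms.

(** * Bounded bilinear pairings between extended norms *)

Section pairing.
Context {R : realType}.
Local Open Scope ereal_scope.

(** The bound is demanded at finite-norm arguments only: in the extended reals a zero norm times an
    infinite one is zero, which would constrain values that carry no meaning. The constant 1 fits an
    operator applied to a vector, a composition, and either of them with the factors exchanged. *)
Record pairing (U V W : lmodType R) (NU : U -> \bar R) (NV : V -> \bar R)
    (NW : W -> \bar R) (B : U -> V -> W) : Prop := Pairing {
  pairing_le : forall u v, NU u < +oo -> NV v < +oo ->
    NW (B u v) <= NU u * NV v ;
  pairing_linl : forall v, NV v < +oo ->
    linear_on [set u | NU u < +oo] (B ^~ v) ;
  pairing_linr : forall u, NU u < +oo ->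
    linear_on [set v | NV v < +oo] (B u) }.

Lemma pairing_lty (U V W : lmodType R) (NU : U -> \bar R) (NV : V -> \bar R)
    (NW : W -> \bar R) (B : U -> V -> W) u v :
  enorm NU -> enorm NV -> pairing NU NV NW B ->
  NU u < +oo -> NV v < +oo -> NW (B u v) < +oo.
Proof.
move=> hU hV hB uy vy; rewrite (le_lt_trans (pairing_le hB uy vy))//.
by rewrite lte_mul_pinfty ?(enorm_ge0 hU)// enorm_fin_num.
Qed.

Lemma pairingB_le (U V W : lmodType R) (NU : U -> \bar R) (NV : V -> \bar R)
    (NW : W -> \bar R) (B : U -> V -> W) u u' v v' :
  enorm NU -> enorm NV -> enorm NW -> pairing NU NV NW B ->
  NU u < +oo -> NU u' < +oo -> NV v < +oo -> NV v' < +oo ->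
  NW (B u v - B u' v')%R <= NU (u - u')%R * NV v + NU u' * NV (v - v')%R.
Proof.
move=> hU hV hW hB uy u'y vy v'y.
have -> : (B u v - B u' v' = B (u - u') v + B u' (v - v'))%R.
  have -> : (u - u' = (-1) *: u' + u)%R by rewrite scaleN1r addrC.
  have -> : (v - v' = (-1) *: v' + v)%R by rewrite scaleN1r addrC.
  rewrite (pairing_linl hB vy)// (pairing_linr hB u'y)// !scaleN1r.
  by rewrite [in RHS](addrC (- B u' v)%R) [in RHS](addrC (- B u' v')%R) subrKA.
rewrite (le_trans (enormD hW _ _))// leeD// (pairing_le hB)//; exact: enormB_lty.
Qed.

Section opnorms.
Variables (U V W : lmodType R).
Variables (NU : U -> \bar R) (NV : V -> \bar R) (NW : W -> \bar R).
Hypotheses (hU : enorm NU) (hV : enorm NV) (hW : enorm NW).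

Lemma pairing_apply : pairing (opnorm NU NV) NU NV (fun f u => f u).
Proof.
split; first by move=> *; exact: opnorm_apply.
- by move=> u _ a f g _ _; rewrite !fctE.
- by move=> f fy; exact: opnorm_linear fy.
Qed.

Hypothesis NUy : forall u, NU u < +oo.

(** This is the componentwise action (G u) x = G (u x). Linearity in [f] is an equality of functions
    at every point, hence the assumption that all of [U] has finite norm, as R^e does. *)
Lemma pairing_comp :
  pairing (opnorm NV NW) (opnorm NU NV) (opnorm NU NW) (fun g f u => g (f u)).
Proof.
have fin f u : opnorm NU NV f < +oo -> NV (f u) < +oo.
  by move=> fy; exact: (pairing_lty (opnorm_enorm hU hV) hU pairing_apply).
split.
- move=> g f gy fy.
  have gfin := enorm_fin_num (opnorm_enorm hV hW) gy.
  have ffin := enorm_fin_num (opnorm_enorm hU hV) fy.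
  rewrite -(fineK gfin) -(fineK ffin) -EFinM; apply: opnorm_leM => //.
  + by rewrite mulr_ge0// fine_ge0// opnorm_ge0.
  + move=> a u v _ _; rewrite (opnorm_linear fy) ?inE//=.
    by rewrite (opnorm_linear gy)//; exact: fin.
  + move=> u _; rewrite (le_trans (opnorm_apply hV hW gy (fin _ _ fy)))//.
    rewrite EFinM !fineK// -muleA lee_wpmul2l ?opnorm_ge0//.
    exact: opnorm_apply.
- by move=> f _ a g g' _ _; rewrite !fctE.
- move=> g gy a f f' fy fy'; apply/funext => u; rewrite !fctE.
  by rewrite (opnorm_linear gy)//; exact: fin.
Qed.

End opnorms.

Lemma le_opnormr (U V : lmodType R) (NU : U -> \bar R) (NV NV' : V -> \bar R)
    (c : R) (f : U -> V) : enorm NU -> enorm NV' -> (0 < c)%R ->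
  (forall v, NV v <= c%:E * NV' v) ->
  opnorm NU NV f <= c%:E * opnorm NU NV' f.
Proof.
move=> hU hV' c0 h; have [fy|] := ltP (opnorm NU NV' f) +oo; last first.
  by rewrite leye_eq => /eqP ->; rewrite gt0_muley ?leey.
have ffin := enorm_fin_num (opnorm_enorm hU hV') fy.
rewrite -(fineK ffin) -EFinM; apply: opnorm_le.
- by rewrite mulr_ge0 ?(ltW c0)// fine_ge0// opnorm_ge0.
- exact: opnorm_linear fy.
- move=> u Nu; rewrite (le_trans (h _))// EFinM fineK// lee_wpmul2l ?lee_fin ?(ltW c0)//.
  exact: opnorm_ub.
Qed.

(** Fixing the second argument turns G' into the operator u |-> (G' u)(X_t - X_s) that is subtracted
    in R^G. *)
Lemma opnorm_slice_le (U V W : lmodType R) (NU : U -> \bar R) (NV : V -> \bar R)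
    (NW : W -> \bar R) (f : U -> V -> W) v :
  enorm NU -> enorm NV -> enorm NW -> NV v < +oo ->
  opnorm NU (opnorm NV NW) f < +oo ->
  opnorm NU NW (fun u => f u v) <= opnorm NU (opnorm NV NW) f * NV v.
Proof.
move=> hU hV hW vy fy; have hVW := opnorm_enorm hV hW.
have ffin := enorm_fin_num (opnorm_enorm hU hVW) fy.
have vfin := enorm_fin_num hV vy.
rewrite -(fineK ffin) -(fineK vfin) -EFinM; apply: opnorm_leM => //.
- by rewrite mulr_ge0// fine_ge0// ?opnorm_ge0// (enorm_ge0 hV).
- by move=> a u u' uy u'y; rewrite (opnorm_linear fy)// !fctE.
- move=> u uy.
  have fuy := pairing_lty (opnorm_enorm hU hVW) hU (pairing_apply hU hVW) fy uy.
  rewrite (le_trans (opnorm_apply hV hW fuy vy))// EFinM !fineK// muleAC.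
  by rewrite lee_wpmul2r ?(enorm_ge0 hV)//; exact: opnorm_apply.
Qed.

End pairing.

Section euclid.
Context {R : realType} {n : nat}.
Implicit Types x y : 'rV[R]_n.

Let sq x := \sum_(i < n) x ord0 i ^+ 2.

Let sq_ge0 x : 0 <= sq x. Proof. by apply: sumr_ge0 => i _; exact: sqr_ge0. Qed.

(** The sum of the squared coordinates of t x + y is a nonnegative quadratic in t; the bound is its
    value at the minimiser t = - b / sq x. *)
Let cauchy_schwarz x y : (\sum_(i < n) x ord0 i * y ord0 i) ^+ 2 <= sq x * sq y.
Proof.
set b := \sum_(i < n) _.
have quad t : 0 <= t ^+ 2 * sq x + 2 * t * b + sq y.
  rewrite (_ : _ + _ = sq (t *: x + y)) ?sq_ge0//.
  rewrite /sq /b !mulr_sumr -!big_split/=; apply: eq_bigr => i _.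
  by rewrite !mxE; ring.
have [x0|x0] := eqVneq (sq x) 0.
  rewrite x0 mul0r.
  have /psumr_eq0P h : sq x = 0 by [].
  rewrite (_ : b = 0) ?expr0n//; apply: big1 => i _.
  by have /eqP := h (fun i _ => sqr_ge0 _) i isT; rewrite sqrf_eq0 => /eqP ->; rewrite mul0r.
have x1 : 0 < sq x by rewrite lt_neqAle eq_sym x0 sq_ge0.
have := quad (- (b / sq x)).
have -> : (- (b / sq x)) ^+ 2 * sq x + 2 * - (b / sq x) * b + sq y = sq y - b ^+ 2 / sq x.
  by field.
by rewrite subr_ge0 ler_pdivrMr// mulrC.
Qed.

Lemma euclid_enorm : enorm (@euclid R n).
Proof.
split; first by move=> x; rewrite lee_fin sqrtr_ge0.
- move=> x y; rewrite /euclid -EFinD lee_fin -[leRHS]ger0_norm ?addr_ge0//.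
  rewrite -sqrtr_sqr ler_wsqrtr// sqrrD !sqr_sqrtr ?sq_ge0//.
  rewrite (_ : \sum_(i < n) _ = sq x + (\sum_(i < n) x ord0 i * y ord0 i) *+ 2 + sq y).
    rewrite lerD2r lerD2l lerMn2r/= -sqrtrM ?sq_ge0//.
    by rewrite (le_trans (ler_norm _))// -sqrtr_sqr ler_wsqrtr// cauchy_schwarz.
  rewrite /sq -sumrMnl -!big_split/=; apply: eq_bigr => i _.
  by rewrite !mxE; ring.
- move=> a x; rewrite /euclid -EFinM -sqrtr_sqr -sqrtrM ?sqr_ge0// mulr_sumr.
  by congr (Num.sqrt _)%:E; apply: eq_bigr => i _; rewrite mxE exprMn.
Qed.

Lemma euclid_lty x : (euclid x < +oo)%E. Proof. exact: ltry. Qed.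

End euclid.

(** * The scale of Hilbert spaces *)

Section scale_of_spaces.
Context {R : realType}.
Variable H : monotone_family R.
Local Open Scope ereal_scope.

Lemma hnormE gamma (u : mf_space H gamma) :
  hnorm gamma (mf_inj H gamma u) = `|u|%:E.
Proof.
rewrite /hnorm (_ : [set _ | _ in _] = [set `|u|%:E]) ?ereal_inf1//.
apply/seteqP; split => [_ [v /= /(mf_injI (gamma := gamma)) -> <-]//|_ /= ->].
by exists u.
Qed.

Lemma hnorm_ltyP gamma v :
  hnorm gamma v < +oo <-> exists u : mf_space H gamma, mf_inj H gamma u = v.
Proof.
split=> [|[u <-]]; last by rewrite hnormE ltry.
move=> vy; apply: contrapT => nv; move: vy.
rewrite /hnorm (_ : [set _ | _ in _] = set0) ?ereal_inf0 ?ltxx//.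
by apply/seteqP; split => [_ [u /= uv _]|//]; apply: nv; exists u.
Qed.

Lemma hnorm_ge0 gamma v : 0 <= hnorm (H := H) gamma v.
Proof. by apply: le_ereal_inf_tmp => _ [u _ <-]; rewrite lee_fin. Qed.

Lemma hnormP gamma v : (exists2 u, v = mf_inj H gamma u & hnorm gamma v = `|u|%:E) \/
  hnorm gamma v = +oo.
Proof.
have [/hnorm_ltyP[u <-]|] := ltP (hnorm gamma v) +oo; last first.
  by rewrite leye_eq => /eqP; right.
by left; exists u => //; rewrite hnormE.
Qed.

Lemma hnorm_enorm gamma : enorm (hnorm (H := H) gamma).
Proof.
have key a v : (a != 0)%R -> hnorm (H := H) gamma v < +oo -> hnorm (H := H) gamma (a *: v)%R = `|a|%:E * hnorm gamma v.
  by move=> a0 /hnorm_ltyP[u <-]; rewrite -linearZ/= !hnormE normrZ EFinM.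
split; first exact: hnorm_ge0.
- move=> v w; have [[u -> ->]|->] := hnormP gamma v; last first.
    by rewrite addye ?leey// gt_eqF// (lt_le_trans _ (hnorm_ge0 _ _)).
  have [[u' -> ->]|->] := hnormP gamma w; last by rewrite addey ?leey.
  by rewrite -linearD hnormE -EFinD lee_fin ler_normD.
- move=> a v; have [->|a0] := eqVneq a 0%R.
    by rewrite scale0r normr0 mul0e -(linear0 (mf_inj H gamma)) hnormE normr0.
  have [vy|vy] := ltP (hnorm gamma v) +oo; first exact: key.
  move: vy; rewrite leye_eq => /eqP vy; rewrite vy gt0_muley ?lte_fin ?normr_gt0//.
  apply/eqP; rewrite -leye_eq leNgt; apply/negP => avy.
  have := key a^-1%R _ (invr_neq0 a0) avy; rewrite scalerK// vy => /esym/eqP.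
  by apply/negP; rewrite lt_eqF// lte_mul_pinfty ?hnorm_ge0// ge0_fin_numE ?hnorm_ge0.
Qed.

Lemma hnorm_definite gamma : edefinite (hnorm (H := H) gamma).
Proof.
move=> v; have [[u -> ->]|->//] := hnormP gamma v.
by move=> [] /normr0_eq0 ->; rewrite linear0.
Qed.

(** From [n0] on, the differences from [f n0] have finite norm, so the shifted sequence lifts
    through [mf_inj] to a Cauchy sequence of the complete space. *)
Lemma hnorm_complete gamma : ecomplete (hnorm (H := H) gamma).
Proof.
move=> f cf; have [n0 hn0] := cf _ ltr01.
have /choice[g gE] : forall n, exists u : mf_space H gamma,
    mf_inj H gamma u = (f (n0 + n)%N - f n0)%R.
  by move=> n; apply/hnorm_ltyP; rewrite (le_lt_trans (hn0 _ _ _ _)) ?ltry// leq_addr.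
have gB n k : `|g n - g k|%:E = hnorm (H := H) gamma (f (n0 + n)%N - f (n0 + k)%N)%R.
  by rewrite -hnormE linearB/= !gE opprB addrA subrK.
have /cvg_ex[/= x gx] : cvgn (g : nat -> mf_space H gamma).
  apply/cauchy_cvgP/cauchy_exP => e e0.
  (* Half of [e] turns the non-strict Cauchy bound into the strict one that open balls ask for. *)
  have [n1 hn1] := cf _ (divr_gt0 e0 (ltr0Sn R 1)).
  exists (g n1); exists n1 => // n /= n1n; rewrite -ball_normE/=.
  rewrite -lte_fin gB (le_lt_trans (hn1 _ _ _ _)) ?leq_addl//.
    by rewrite (leq_trans n1n)// leq_addl.
  by rewrite lte_fin ltr_pdivrMr// ltr_pMr// ltr1n.
exists (mf_inj H gamma x + f n0)%R.
apply/cvge0P; first by move=> n; exact: hnorm_ge0.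
move=> eps eps0; move/cvgrPdist_le : gx => /(_ _ eps0)[n1 _ hn1].
exists (n0 + n1)%N => // n /= n01n.
have n0n : (n0 <= n)%N by rewrite (leq_trans _ n01n)// leq_addr.
have -> : (f n - (mf_inj H gamma x + f n0) = mf_inj H gamma (g (n - n0)%N - x))%R.
  by rewrite linearB/= gE subnKC// opprD addrA addrAC.
by rewrite hnormE lee_fin distrC; apply: hn1 => /=; rewrite leq_subRL.
Qed.

Lemma hnorm_embedding (gamma gamma' : R) : (gamma <= gamma')%R ->
  exists2 C : R, (0 < C)%R & forall v : mf_amb H,
    hnorm gamma v <= C%:E * hnorm gamma' v.
Proof.
move=> gg'; have [C hC] := mf_continuous H gg'.
(* The constant of [mf_continuous] carries no sign; the maximum with 1 makes it positive, so that
   its product with +oo is +oo. *)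
exists (Num.max C 1)%R; first by rewrite lt_max ltr01 orbT.
move=> v; have [[u' -> ->]|->] := hnormP gamma' v; last first.
  by rewrite gt0_muley ?leey// lte_fin lt_max ltr01 orbT.
have [u _ uE] : range (mf_inj H gamma) (mf_inj H gamma' u').
  exact: (@mf_sub _ H _ _ gg' _ (imageT _ u')).
rewrite -uE hnormE -EFinM lee_fin (le_trans (hC _ _ uE))//.
by rewrite ler_wpM2r// le_max lexx.
Qed.

(* Young's inequality makes the interpolation bound linear: the two terms of the
   sum are, up to [h `^ t], the factors of the product bounding the middle norm. *)
Lemma hnorm_interpolation (gamma s t : R) : (0 < t)%R -> (t <= s)%R ->
  exists2 C : R, (0 < C)%R & forall (h : R) (v : mf_amb H), (0 < h)%R ->
    hnorm (gamma - t)%R v <=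
      C%:E * ((h `^ (t - s))%:E * hnorm (gamma - s)%R v + (h `^ t)%:E * hnorm gamma v).
Proof.
move=> t0 ts; have s0 : (0 < s)%R by exact: lt_le_trans t0 ts.
have st : (gamma - s <= gamma - t)%R by rewrite lerD2l lerN2.
have tg : (gamma - t <= gamma)%R by rewrite gerBl ltW.
have sg : (gamma - s <= gamma)%R by rewrite gerBl ltW.
have [C0 hC0] := mf_interpolation H st tg.
pose C := (Num.max C0 1)%R.
have C1 : (0 < C)%R by rewrite lt_max ltr01 orbT.
exists (C `^ s^-1)%R; first exact: powR_gt0.
move=> h v h0; have [[u3 -> ->]|->] := hnormP gamma v; last first.
  rewrite [X in _ + X]gt0_muley ?lte_fin ?powR_gt0// addey; last first.
    by rewrite gt_eqF// (lt_le_trans ltNy0)// mule_ge0 ?hnorm_ge0// lee_fin powR_ge0.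
  by rewrite gt0_muley ?leey// lte_fin powR_gt0.
have [u1 _ u1E] : range (mf_inj H (gamma - s)) (mf_inj H gamma u3).
  exact: (@mf_sub _ H _ _ sg _ (imageT _ u3)).
have [u2 _ u2E] : range (mf_inj H (gamma - t)) (mf_inj H gamma u3).
  exact: (@mf_sub _ H _ _ tg _ (imageT _ u3)).
rewrite -{1}u2E -u1E !hnormE -!EFinM lee_fin.
have := hC0 _ _ _ u1E u2E.
have -> : (gamma - (gamma - s) = s)%R by ring.
have -> : (gamma - (gamma - t) = t)%R by ring.
have -> : (gamma - t - (gamma - s) = s - t)%R by ring.
move=> hu.
set a := `|u1|%R; set b := `|u2|%R; set c := `|u3|%R.
have sE : s != 0%R by rewrite gt_eqF.
(* The bracket on the right-hand side is h^t M, and both h^(-s) a and c are at most M. Since the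
   exponents t and s - t add up to s, the interpolation product is at most the s-th power of h^t
   M. *)
pose M := (h `^ (- s) * a + c)%R.
have [a'0 b0 c0] : [/\ (0 <= a)%R, (0 <= b)%R & (0 <= c)%R] by split; exact: normr_ge0.
have a0 : (0 <= h `^ (- s) * a)%R by rewrite mulr_ge0 ?powR_ge0.
have M0 : (0 <= M)%R by rewrite addr_ge0.
have aE : (a = h `^ s * (h `^ (- s) * a))%R.
  by rewrite mulrA -powRD ?addrN ?powRr0 ?mul1r// (gt_eqF h0) implybT.
have key : (b `^ s <= C * (h `^ t * M) `^ s)%R.
  have ME : (M `^ s = M `^ t * M `^ (s - t))%R.
    by rewrite -powRD addrC subrK // (negbTE sE).
  have hle : (a `^ t * c `^ (s - t) <= (h `^ t * M) `^ s)%R.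
    rewrite aE [in leLHS]powRM ?powR_ge0// [in leRHS]powRM ?powR_ge0// -!powRrM (mulrC s t) -mulrA.
    rewrite ler_wpM2l ?powR_ge0// ME ler_pM ?powR_ge0//.
    - by rewrite ge0_ler_powR ?nnegrE ?(ltW t0)// lerDl.
    - by rewrite ge0_ler_powR ?nnegrE ?subr_ge0// lerDr.
  apply: (le_trans hu); apply: (@le_trans _ _ (C * (a `^ t * c `^ (s - t)))%R).
    by rewrite ler_wpM2r ?mulr_ge0 ?powR_ge0// le_max lexx.
  by rewrite ler_wpM2l// ltW.
have -> : (h `^ (t - s) * a + h `^ t * c = h `^ t * M)%R.
  by rewrite mulrDr mulrA -powRD// (gt_eqF h0) implybT.
have bE : b = ((b `^ s) `^ s^-1)%R by rewrite -powRrM divff// powRr1.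
rewrite bE (le_trans (ge0_ler_powR _ _ _ key))// ?nnegrE ?invr_ge0 ?powR_ge0 ?(ltW s0)//.
  by rewrite mulr_ge0 ?powR_ge0 ?(ltW C1).
by rewrite (powRM s^-1 (ltW C1)) ?powR_ge0 ?(ltW C1)// -(powRrM _ s s^-1) divff// powRr1// mulr_ge0 ?powR_ge0.
Qed.

Lemma hnorme_enorm (e : nat) gamma : enorm (hnorme (H := H) (e := e) gamma).
Proof. exact: opnorm_enorm euclid_enorm (hnorm_enorm _). Qed.

Lemma hnorme_definite (e : nat) gamma : edefinite (hnorme (H := H) (e := e) gamma).
Proof.
exact: opnorm_definite euclid_enorm (hnorm_enorm _) euclid_lty (@hnorm_definite _).
Qed.

Lemma hnorme_complete (e : nat) gamma : ecomplete (hnorme (H := H) (e := e) gamma).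
Proof.
exact: opnorm_complete euclid_enorm (hnorm_enorm _) (@hnorm_definite _)
  (@hnorm_complete _).
Qed.

Lemma hnorme_embedding (e : nat) (gamma gamma' : R) : (gamma <= gamma')%R ->
  exists2 C : R, (0 < C)%R & forall f : 'rV[R]_e -> mf_amb H,
    hnorme gamma f <= C%:E * hnorme gamma' f.
Proof.
move=> /hnorm_embedding[C C0 hC]; exists C => // f.
exact: le_opnormr euclid_enorm (hnorm_enorm _) C0 hC.
Qed.

(** The parameter [h] is free and the bound is linear in the two norms. It therefore passes to the
    supremum over the unit ball, and later to L^m norms, with one [h] for all vectors and by the
    triangle inequality alone. *)
Lemma hnorme_interpolation (e : nat) (gamma s t : R) : (0 < t)%R -> (t <= s)%R ->
  exists2 C : R, (0 < C)%R & forall (h : R) (f : 'rV[R]_e -> mf_amb H), (0 < h)%R ->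
    hnorme (gamma - t)%R f <=
      C%:E * ((h `^ (t - s))%:E * hnorme (gamma - s)%R f + (h `^ t)%:E * hnorme gamma f).
Proof.
move=> t0 ts; have [C C0 hC] := hnorm_interpolation gamma t0 ts.
exists C => // h f h0.
pose M v := (h `^ (t - s))%:E * hnorm (H := H) (gamma - s)%R v + (h `^ t)%:E * hnorm gamma v.
have [ps pt] : (0 < h `^ (t - s))%R /\ (0 < h `^ t)%R by rewrite !powR_gt0.
have [fs|] := ltP (hnorme (gamma - s)%R f) +oo; last first.
  rewrite leye_eq => /eqP ->; rewrite gt0_muley// addye; last first.
    by rewrite gt_eqF// (lt_le_trans ltNy0)// mule_ge0 ?opnorm_ge0 ?lee_fin ?(ltW pt)//;
       [exact: euclid_enorm|exact: hnorm_enorm].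
  by rewrite gt0_muley ?leey.
have [fg|] := ltP (hnorme gamma f) +oo; last first.
  rewrite leye_eq => /eqP ->; rewrite [X in _ + X]gt0_muley// addey; last first.
    by rewrite gt_eqF// (lt_le_trans ltNy0)// mule_ge0 ?opnorm_ge0 ?lee_fin ?(ltW ps)//;
       [exact: euclid_enorm|exact: hnorm_enorm].
  by rewrite gt0_muley ?leey.
have fsf := enorm_fin_num (hnorme_enorm _ _) fs.
have fgf := enorm_fin_num (hnorme_enorm _ _) fg.
rewrite -(fineK fsf) -(fineK fgf) -!EFinM.
apply: opnorm_le.
- by rewrite mulr_ge0 ?addr_ge0 ?mulr_ge0 ?(ltW C0) ?(ltW ps) ?(ltW pt)// fine_ge0//;
    exact: (enorm_ge0 (hnorme_enorm _ _)).
- exact: opnorm_linear fs.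
- move=> u Nu; rewrite (le_trans (hC _ _ h0))// EFinM lee_wpmul2l ?lee_fin ?(ltW C0)//.
  rewrite EFinD !EFinM !fineK// leeD// lee_wpmul2l ?lee_fin ?(ltW ps) ?(ltW pt)//;
    exact: opnorm_ub.
Qed.

Lemma hnormee_enorm (e1 e : nat) gamma :
  enorm (hnormee (H := H) (e1 := e1) (e := e) gamma).
Proof. exact: opnorm_enorm euclid_enorm (hnorme_enorm _ _). Qed.

Lemma hnormee_embedding (e1 e : nat) (gamma gamma' : R) : (gamma <= gamma')%R ->
  exists2 C : R, (0 < C)%R & forall f : 'rV[R]_e -> 'rV[R]_e1 -> mf_amb H,
    hnormee gamma f <= C%:E * hnormee gamma' f.
Proof.
move=> /(hnorme_embedding e1)[C C0 hC]; exists C => // f.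
exact: le_opnormr euclid_enorm (hnorme_enorm _ _) C0 hC.
Qed.

Lemma onorm_enorm (e1 e2 : nat) gamma1 gamma2 :
  enorm (onorm (H := H) (e1 := e1) (e2 := e2) gamma1 gamma2).
Proof. exact: opnorm_enorm (hnorme_enorm _ _) (hnorme_enorm _ _). Qed.

Lemma onorm_complete (e1 e2 : nat) gamma1 gamma2 :
  ecomplete (onorm (H := H) (e1 := e1) (e2 := e2) gamma1 gamma2).
Proof.
exact: opnorm_complete (hnorme_enorm _ _) (hnorme_enorm _ _)
  (@hnorme_definite _ _) (@hnorme_complete _ _).
Qed.

Lemma onorm_embedding (e1 e2 : nat) (gamma1 gamma2 gamma2' : R) :
  (gamma2 <= gamma2')%R ->
  exists2 C : R, (0 < C)%R & forall f : ('rV[R]_e1 -> mf_amb H) -> 'rV[R]_e2 -> mf_amb H,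
    onorm gamma1 gamma2 f <= C%:E * onorm gamma1 gamma2' f.
Proof.
move=> /(hnorme_embedding e2)[C C0 hC]; exists C => // f.
exact: le_opnormr (hnorme_enorm _ _) (hnorme_enorm _ _) C0 hC.
Qed.

Lemma onorme_enorm (e1 e2 e : nat) gamma1 gamma2 :
  enorm (onorme (H := H) (e1 := e1) (e2 := e2) (e := e) gamma1 gamma2).
Proof. exact: opnorm_enorm (hnorme_enorm _ _) (hnormee_enorm _ _ _). Qed.

End scale_of_spaces.

(** * Strong measurability and L^p norms *)

Section simple_representations.
Context {R : realType} {d : measure_display} {Omega : measurableType d}.
Context {V : lmodType R}.
Local Open Scope ereal_scope.
Implicit Types (N : V -> \bar R) (G : set (set Omega)) (g : @simple_rep R _ Omega V).

Lemma simple_in_cons N G b g :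
  simple_in N G (b :: g) <-> [/\ G b.1, N b.2 < +oo & simple_in N G g].
Proof.
split=> [h|[Gb Nb h] [//|i]]; last exact: h.
by have [Gb Nb] := h 0%N isT; split=> // i ig; exact: (h i.+1).
Qed.

Lemma simple_in_cat N G g g' :
  simple_in N G g -> simple_in N G g' -> simple_in N G (g ++ g').
Proof.
move=> + hg'; elim: g => // b g ih /simple_in_cons[Gb Nb /ih hg].
by apply/simple_in_cons.
Qed.

Lemma simple_fun_nil w : simple_fun ([::] : @simple_rep R _ Omega V) w = 0%R.
Proof. by rewrite /simple_fun big_nil. Qed.

Lemma simple_fun_cons b g w :
  simple_fun (b :: g) w = ((\1_(b.1) w : R) *: b.2 + simple_fun g w)%R.
Proof. by rewrite /simple_fun big_cons. Qed.

Lemma simple_fun_cat g g' w :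
  simple_fun (g ++ g') w = (simple_fun g w + simple_fun g' w)%R.
Proof. by rewrite /simple_fun big_cat. Qed.

Lemma simple_fun_lty N G g w : enorm N -> simple_in N G g ->
  N (simple_fun g w) < +oo.
Proof.
move=> hN; elim: g => [|b g ih] => [_|/simple_in_cons[_ Nb /ih Ng]].
  by rewrite simple_fun_nil (enorm0 hN) ltry.
by rewrite simple_fun_cons (enormD_lty hN)// (enormZ_lty hN).
Qed.

End simple_representations.

Section simple_operations.
Context {R : realType} {d : measure_display} {Omega : measurableType d}.
Local Open Scope ereal_scope.
Implicit Types (G : set (set Omega)).

Section map.
Variables (V W : lmodType R) (N : V -> \bar R) (M : W -> \bar R).
Implicit Types g : @simple_rep R _ Omega V.

Definition simple_map (T : V -> W) g : @simple_rep R _ Omega W :=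
  [seq (b.1, T b.2) | b <- g].

Lemma simple_in_map T G g : (forall v, N v < +oo -> M (T v) < +oo) ->
  simple_in N G g -> simple_in M G (simple_map T g).
Proof.
move=> hT; elim: g => // b g ih /simple_in_cons[Gb Nb /ih hg].
by apply/simple_in_cons; split => //; exact: hT.
Qed.

Lemma simple_fun_map T G g w : enorm N -> linear_on [set v | N v < +oo] T ->
  simple_in N G g -> simple_fun (simple_map T g) w = T (simple_fun g w).
Proof.
move=> hN lT; elim: g => [_|b g ih /simple_in_cons[_ Nb hg]].
  by rewrite !simple_fun_nil (linear_on0 hN lT).
by rewrite !simple_fun_cons ih//= lT//=; exact: simple_fun_lty hg.
Qed.

End map.

Section restrict.
Variable V : lmodType R.
Implicit Types g : @simple_rep R _ Omega V.

Definition simple_restrict (D : set Omega) g : @simple_rep R _ Omega V :=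
  [seq (D `&` b.1, b.2) | b <- g].

Lemma simple_in_restrict (N : V -> \bar R) G D g :
  (forall A, G A -> G (D `&` A)) -> simple_in N G g ->
  simple_in N G (simple_restrict D g).
Proof.
move=> hD; elim: g => // b g ih /simple_in_cons[Gb Nb /ih hg].
by apply/simple_in_cons; split => //; exact: hD.
Qed.

Lemma simple_fun_restrict D g w :
  simple_fun (simple_restrict D g) w = ((\1_D w : R) *: simple_fun g w)%R.
Proof.
elim: g => [|b g ih]; first by rewrite !simple_fun_nil scaler0.
by rewrite !simple_fun_cons ih scalerDr scalerA indicI.
Qed.

End restrict.

Section pair.
Variables (U V W : lmodType R).
Variables (NU : U -> \bar R) (NV : V -> \bar R) (NW : W -> \bar R).
Variable B : U -> V -> W.
Hypotheses (hU : enorm NU) (hV : enorm NV) (hB : pairing NU NV NW B).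

(** The sets of a representation may overlap, with values adding up; bilinearity then expands the
    product into a double sum, carried by all pairwise intersections. *)
Fixpoint simple_pair (g : @simple_rep R _ Omega U) (h : @simple_rep R _ Omega V) :
    @simple_rep R _ Omega W :=
  if g is b :: g' then
    simple_restrict b.1 (simple_map (B b.2) h) ++ simple_pair g' h
  else [::].

Lemma simple_in_pair G g h : setI_closed G ->
  simple_in NU G g -> simple_in NV G h -> simple_in NW G (simple_pair g h).
Proof.
move=> GI + hh; elim: g => // b g ih /simple_in_cons[Gb Nb /ih hg] /=.
apply: simple_in_cat => //; apply: simple_in_restrict; first by move=> A; exact: GI.
by apply: simple_in_map hh => v Nv; exact: pairing_lty hU hV hB _ _.
Qed.

Lemma simple_fun_pair G g h w :
  simple_in NU G g -> simple_in NV G h ->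
  simple_fun (simple_pair g h) w = B (simple_fun g w) (simple_fun h w).
Proof.
move=> + hh; have hw := simple_fun_lty w hV hh.
have hL := pairing_linl hB hw.
elim: g => [_|b g ih /simple_in_cons[_ Nb hg]] /=.
  by rewrite !simple_fun_nil (linear_on0 hU hL).
rewrite simple_fun_cat simple_fun_cons ih// simple_fun_restrict.
rewrite (simple_fun_map _ hV (pairing_linr hB Nb) hh) hL//.
exact: simple_fun_lty hg.
Qed.

End pair.
End simple_operations.

(** * Complete sub-sigma-algebras and measurability with respect to them *)

Section sub_sigma_algebras.
Context {R : realType} {d : measure_display} {Omega : measurableType d}.
Variable P : probability Omega R.
Local Open Scope ereal_scope.
Implicit Types (G : set (set Omega)) (h k : Omega -> \bar R).

(** Containing the null sets matches the almost sure convergence in [ae_approx]: a function keeps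
    its measurability when it is changed on a null set. *)
Definition complete_sub G : Prop :=
  [/\ sigma_algebra setT G, G `<=` d.-measurable
    & forall N, P.-negligible N -> G N].

(** Stated on the type generated by [G], so that it is measurability between measurable types;
    [complete_subE] identifies the measurable sets of that type with [G]. *)
Definition gmeas G h : Prop :=
  measurable_fun setT (h : g_sigma_algebraType G -> \bar R).

Section fixed.
Variable G : set (set Omega).
Hypothesis hG : complete_sub G.

Lemma complete_subE : G.-sigma.-measurable = G.
Proof. by apply: measurable_g_measurableTypeE; case: hG. Qed.

Lemma complete_sub_measurable : G `<=` d.-measurable.
Proof. by case: hG. Qed.

Lemma complete_subN N : P.-negligible N -> G N.
Proof. by case: hG => _ _; exact. Qed.

Lemma complete_subT : G setT.
Proof. by rewrite -complete_subE; exact: measurableT. Qed.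

Lemma complete_subI : setI_closed G.
Proof. by move=> A B; rewrite -complete_subE; exact: measurableI. Qed.

Lemma complete_subD A B : G A -> G B -> G (A `\` B).
Proof. by rewrite -complete_subE; exact: measurableD. Qed.

Lemma complete_subU A B : G A -> G B -> G (A `|` B).
Proof. by rewrite -complete_subE; exact: measurableU. Qed.

Lemma gmeas_measurable h : gmeas G h -> measurable_fun setT h.
Proof.
move=> mh _ B mB; apply: complete_sub_measurable.
by rewrite -[X in X _]complete_subE; exact: mh.
Qed.

Lemma gmeas_preimage h B : gmeas G h -> measurable B -> G (h @^-1` B).
Proof.
by move=> mh mB; rewrite -[_ @^-1` _]setTI -[X in X _]complete_subE; exact: mh.
Qed.

Lemma gmeas_ae h k : {ae P, forall w, h w = k w} -> gmeas G h -> gmeas G k.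
Proof.
move=> hk mh _ B mB; rewrite setTI complete_subE.
pose E := [set w | h w <> k w].
have nE : P.-negligible E by exact: hk.
rewrite (_ : k @^-1` B = (h @^-1` B `\` E) `|` (k @^-1` B `&` E)).
  apply: complete_subU.
    by apply: complete_subD; [exact: gmeas_preimage|exact: complete_subN].
  by apply: complete_subN; apply: negligibleS nE => w [].
apply/seteqP; split => [w kB|w [[hB /contrapT /= <-]//|[]//]].
have [Ew|nEw] := pselect (E w); [by right|left; split => //].
by move/contrapT : nEw => /= ->.
Qed.

(** The upper limit of the sequence is measurable without exception and equals [h] off a null set,
    which a complete sigma-algebra ignores. *)
Lemma gmeas_lim (h_ : nat -> Omega -> \bar R) h :
  (forall n, gmeas G (h_ n)) ->
  {ae P, forall w, h_ n w @[n --> \oo] --> h w} -> gmeas G h.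
Proof.
move=> mh hh; apply: (@gmeas_ae (fun w => limn_esup (h_ ^~ w))).
  apply: filterS hh => w hw; rewrite is_cvg_limn_esupE; first exact: cvg_lim hw.
  by apply/cvg_ex; exists (h w).
exact: measurable_fun_limn_esup.
Qed.

End fixed.

Lemma complete_sub_all G : complete_sub G -> complete_sub d.-measurable.
Proof.
move=> [_ Gd GN]; split => //; first exact: sigma_algebra_measurable.
by move=> N /GN; exact: Gd.
Qed.

Lemma gmeas_all h : measurable_fun setT h -> gmeas d.-measurable h.
Proof.
move=> mh _ B mB; rewrite measurable_g_measurableTypeE; last exact: sigma_algebra_measurable.
exact: mh.
Qed.

End sub_sigma_algebras.

Section strong_measurability.
Context {R : realType} {d : measure_display} {Omega : measurableType d}.
Variable P : probability Omega R.
Local Open Scope ereal_scope.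

Section one_space.
Context {V : lmodType R}.
Variable N : V -> \bar R.
Hypothesis hN : enorm N.
Implicit Types (G : set (set Omega)) (f : Omega -> V).

Section fixed.
Variable G : set (set Omega).
Hypothesis hG : complete_sub P G.

(** A norm of a sum does not split, so the induction on the list carries an offset [v]: on the first
    set its value is added to the offset, off it nothing changes. *)
Lemma gmeas_simple (g : @simple_rep R _ Omega V) (v : V) :
  simple_in N G g -> gmeas G (fun w => N (v + simple_fun g w)%R).
Proof.
elim: g v => [v _|b g ih v /simple_in_cons[Gb _ hg]].
  by under [X in gmeas G X]eq_fun do rewrite simple_fun_nil; exact: measurable_cst.
have -> : (fun w => N (v + simple_fun (b :: g) w)%R) = (fun w => if w \in b.1
    then N (v + b.2 + simple_fun g w)%R else N (v + simple_fun g w)%R).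
  apply/funext => w; rewrite simple_fun_cons indicE.
  by case: ifPn => _; rewrite ?scale1r ?addrA// scale0r addr0.
apply: (@measurable_fun_ifT _ _ (g_sigma_algebraType G)); last 2 first.
- exact: ih.
- exact: ih.
apply: (@measurable_fun_bool _ (g_sigma_algebraType G) _ _ true).
rewrite setTI (complete_subE hG) (_ : _ @^-1` _ = b.1)//.
by apply/seteqP; split => w /=; [move=> /set_mem|move=> /mem_set].
Qed.

Lemma sm_lty f : strongly_measurable P N G f -> {ae P, forall w, N (f w) < +oo}.
Proof.
move=> [g hg]; apply: filterS => w gf.
apply: (enorm_cvg_lty hN _ (fun n => simple_fun_lty w hN (hg n))).
by under eq_fun do rewrite (enorm_subC hN).
Qed.

Lemma sm_gmeas f : strongly_measurable P N G f -> gmeas G (N \o f).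
Proof.
move=> [g hg gf]; apply: (gmeas_lim hG (h_ := fun n w => N (simple_fun (g n) w))).
  move=> n; under [X in gmeas G X]eq_fun do rewrite -(add0r (simple_fun _ _)).
  exact: gmeas_simple.
apply: filterS gf => w gf; apply: enorm_cvg => //.
  by move=> n; exact: simple_fun_lty (hg n).
by under eq_fun do rewrite (enorm_subC hN).
Qed.

Lemma sm_measurable f : strongly_measurable P N G f -> measurable_fun setT (N \o f).
Proof. by move=> /sm_gmeas; exact: (gmeas_measurable hG). Qed.

Lemma sm_simple g : simple_in N G g -> strongly_measurable P N G (simple_fun g).
Proof.
move=> hg; exists (fun=> g) => //; apply: aeW => w.
by under eq_fun do rewrite subrr (enorm0 hN); exact: cvg_cst.
Qed.

Lemma sm_cst v : N v < +oo -> strongly_measurable P N G (fun=> v).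
Proof.
move=> vy; rewrite (_ : (fun=> v) = simple_fun [:: (setT, v)]).
  by apply: sm_simple; apply/simple_in_cons; split => //=; exact: complete_subT hG.
apply/funext => w; rewrite simple_fun_cons simple_fun_nil addr0 indicE in_setT.
by rewrite scale1r.
Qed.

Lemma smD f f' : strongly_measurable P N G f -> strongly_measurable P N G f' ->
  strongly_measurable P N G (fun w => f w + f' w)%R.
Proof.
move=> [g hg gf] [g' hg' gf'].
exists (fun n => g n ++ g' n); first by move=> n; exact: simple_in_cat.
apply: filterS2 gf gf' => w fw f'w.
apply: (squeeze_cvge0 (g := fun n => N (f w - simple_fun (g n) w)%R + N (f' w - simple_fun (g' n) w)%R)).
- by move=> n; exact: (enorm_ge0 hN).
- by apply: nearW => n; rewrite simple_fun_cat opprD addrACA; exact: enormD.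
- by apply: cvge0D => // n; exact: (enorm_ge0 hN).
Qed.

Lemma sm_ae f f' : {ae P, forall w, N (f w - f' w)%R = 0} ->
  strongly_measurable P N G f -> strongly_measurable P N G f'.
Proof.
move=> ff' [g hg gf]; exists g => //; apply: filterS2 ff' gf => w ff' gf.
apply: (squeeze_cvge0 _ _ gf); first by move=> n; exact: (enorm_ge0 hN).
apply: nearW => n; rewrite (le_trans (enorm_triangle hN (f w) _ _))//.
by rewrite (enorm_subC hN) ff' add0e.
Qed.

End fixed.

Lemma sm_subset G G' f : G `<=` G' -> strongly_measurable P N G f ->
  strongly_measurable P N G' f.
Proof.
move=> GG' [g hg gf]; exists g => // n i ig.
by have [/GG'] := hg n i ig.
Qed.

End one_space.

Section two_spaces.
Variables (V W : lmodType R) (N : V -> \bar R) (M : W -> \bar R).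
Hypotheses (hN : enorm N) (hM : enorm M).
Implicit Types (G : set (set Omega)) (f : Omega -> V).

Lemma sm_map G f (T : V -> W) (c : R) : (0 <= c)%R ->
  linear_on [set v | N v < +oo] T ->
  (forall v, N v < +oo -> M (T v) <= c%:E * N v) ->
  strongly_measurable P N G f -> strongly_measurable P M G (T \o f).
Proof.
move=> c0 lT hT sf; have [g hg gf] := sf.
have TB u v : N u < +oo -> N v < +oo -> (T (u - v) = T u - T v)%R.
  by move=> *; rewrite -scaleN1r addrC lT//= scaleN1r addrC.
exists (fun n => simple_map T (g n)).
  move=> n; apply: (simple_in_map _ (hg n)) => v vy.
  by rewrite (le_lt_trans (hT _ vy))// lte_mul_pinfty.
apply: filterS2 gf (sm_lty hN sf) => w gf fw.
apply: (squeeze_cvge0 (g := fun n => c%:E * N (f w - simple_fun (g n) w)%R)).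
- by move=> n; exact: (enorm_ge0 hM).
- apply: nearW => n; have gy := simple_fun_lty w hN (hg n).
  by rewrite (simple_fun_map _ hN lT (hg n)) -TB// hT// (enormB_lty hN).
- exact: cvge0Zl.
Qed.

Lemma smZ G f (a : R) : strongly_measurable P N G f ->
  strongly_measurable P N G (fun w => a *: f w)%R.
Proof.
move=> [g hg gf]; exists (fun n => simple_map (fun v => a *: v)%R (g n)).
  by move=> n; apply: (simple_in_map _ (hg n)) => v; exact: enormZ_lty.
apply: filterS gf => w gf.
apply: (squeeze_cvge0 (g := fun n => `|a|%:E * N (f w - simple_fun (g n) w)%R)).
- by move=> n; exact: (enorm_ge0 hN).
- apply: nearW => n; rewrite (simple_fun_map _ hN _ (hg n)).
    by rewrite -scalerBr (enormZ hN).
  by move=> b u v _ _; rewrite scalerDr !scalerA mulrC.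
- exact: cvge0Zl.
Qed.

Lemma smB G f f' : strongly_measurable P N G f -> strongly_measurable P N G f' ->
  strongly_measurable P N G (fun w => f w - f' w)%R.
Proof.
move=> hf /(smZ (-1)) hf'; under eq_fun do rewrite -scaleN1r; exact: smD.
Qed.

End two_spaces.

Lemma sm_le (V : lmodType R) (N M : V -> \bar R) G (f : Omega -> V) (c : R) :
  enorm N -> enorm M -> (0 <= c)%R -> (forall v, M v <= c%:E * N v) ->
  strongly_measurable P N G f -> strongly_measurable P M G f.
Proof.
by move=> hN hM c0 NM; apply: (sm_map hN hM (T := id) (c := c)) => // v _.
Qed.

Lemma sm_pair (U V W : lmodType R) (NU : U -> \bar R) (NV : V -> \bar R)
    (NW : W -> \bar R) (B : U -> V -> W) G (f : Omega -> U) (h : Omega -> V) :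
  enorm NU -> enorm NV -> enorm NW -> pairing NU NV NW B -> setI_closed G ->
  strongly_measurable P NU G f -> strongly_measurable P NV G h ->
  strongly_measurable P NW G (fun w => B (f w) (h w)).
Proof.
move=> hU hV hW hB GI sf sh; have [g hg gf] := sf; have [k hk kh] := sh.
exists (fun n => simple_pair B (g n) (k n)).
  by move=> n; exact: simple_in_pair (hg n) (hk n).
apply: filterS2 (filterI gf kh) (filterI (sm_lty hU sf) (sm_lty hV sh)).
move=> w [gf' kh'] [fy hy].
have gy n := simple_fun_lty w hU (hg n).
have ky n := simple_fun_lty w hV (hk n).
apply: (squeeze_cvge0 (g := fun n => NU (f w - simple_fun (g n) w)%R * NV (h w) +
    (NU (f w - simple_fun (g n) w)%R + NU (f w)) * NV (h w - simple_fun (k n) w)%R)).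
- by move=> n; exact: (enorm_ge0 hW).
- apply: nearW => n.
  rewrite (simple_fun_pair hU hV hB _ (hg n) (hk n)).
  rewrite (le_trans (pairingB_le hU hV hW hB _ _ _ _))// leeD2l//.
  rewrite lee_wpmul2r ?(enorm_ge0 hV)// (enorm_subC hU).
  exact: enorm_leDB.
- apply: cvge0D.
  + by move=> n; rewrite mule_ge0 ?(enorm_ge0 hU) ?(enorm_ge0 hV).
  + by move=> n; rewrite mule_ge0 ?adde_ge0 ?(enorm_ge0 hU) ?(enorm_ge0 hV).
  + by apply: cvge0Zr => //; exact: enorm_fin_num.
  + apply: (cvge0M_bounded (c := 1 + NU (f w))) => //.
    * by rewrite fin_numD/= enorm_fin_num.
    * by move=> n; rewrite adde_ge0 ?(enorm_ge0 hU).
    * by move=> n; exact: (enorm_ge0 hV).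
    * have gf1 : \forall n \near \oo, NU (f w - simple_fun (g n) w)%R <= 1.
        by apply: cvge0_near_le1 => // n; exact: (enorm_ge0 hU).
      by apply: filterS gf1 => n gn; rewrite leeD2r.
Qed.

End strong_measurability.

(** * L^p norms of nonnegative extended-real functions *)

Section Lnorm_nonneg.
Context {R : realType} {d : measure_display} {Omega : measurableType d}.
Variable P : probability Omega R.
Local Open Scope ereal_scope.
Implicit Types (h k : Omega -> \bar R) (p : \bar R).

Let PT : 0 < P [set: Omega].
Proof. by rewrite probability_setT lte01. Qed.

Lemma measurable_abse_poweR h (r : R) : measurable_fun setT h ->
  measurable_fun setT (fun w => `|h w| `^ r).
Proof.
move=> mh; apply: (@measurableT_comp _ _ _ _ _ _ (fun x => x `^ r)) => //=.
  exact: (measurableT_comp (measurable_poweR _)).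
exact: measurableT_comp.
Qed.

Lemma Lnorm_le_ae p h k : 1 <= p -> measurable_fun setT h -> measurable_fun setT k ->
  {ae P, forall w, 0 <= h w <= k w} -> 'N[P]_p[h] <= 'N[P]_p[k].
Proof.
move=> + mh mk hk; rewrite unlock; case: p => [r|_|//]; last first.
  rewrite PT; apply: le_ess_sup; apply: filterS hk => w /andP[h0 hk] /=.
  by rewrite !gee0_abs// (le_trans h0).
rewrite lee_fin => r1; have r0 : (0 <= r)%R by exact: le_trans r1.
apply: gt0_ler_poweR; rewrite ?invr_ge0//.
- by rewrite in_itv/= leey andbT; apply: integral_ge0 => w _; exact: poweR_ge0.
- by rewrite in_itv/= leey andbT; apply: integral_ge0 => w _; exact: poweR_ge0.
apply: ae_ge0_le_integral => //.
- by move=> w _; exact: poweR_ge0.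
- exact: measurable_abse_poweR.
- by move=> w _; exact: poweR_ge0.
- exact: measurable_abse_poweR.
apply: filterS hk => w /andP[h0 hk] _.
have k0 := le_trans h0 hk.
by rewrite !gee0_abs// gt0_ler_poweR// in_itv/= ?h0 ?k0 ?leey.
Qed.

Lemma Lnorm_lty_ae p h : 1 <= p -> measurable_fun setT h -> (forall w, 0 <= h w) ->
  'N[P]_p[h] < +oo -> {ae P, forall w, h w < +oo}.
Proof.
move=> + mh h0; rewrite unlock; case: p => [r|_|//]; last first.
  rewrite PT => hy; have := ess_sup_ge P (abse \o h).
  by apply: filterS => w; rewrite /= gee0_abs// => /le_lt_trans; exact.
rewrite lee_fin => r1; have r0 : (0 < r)%R by exact: lt_le_trans r1.
have rN0 : r != 0%R by rewrite gt_eqF.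
move=> /lty_poweRy; rewrite invr_eq0 => /(_ rN0) hy.
have : P.-integrable setT (fun w => `|h w| `^ r).
  apply/integrableP; split; first exact: measurable_abse_poweR.
  by under eq_integral do rewrite gee0_abs ?poweR_ge0//.
move=> /(integrable_ae measurableT); apply: filterS => w /(_ I).
rewrite ge0_fin_numE ?poweR_ge0// gee0_abs// => /lty_poweRy; exact.
Qed.

(** When both norms are finite, [h] and [k] are finite almost everywhere, and Minkowski's inequality
    for the real functions [fine \o h] and [fine \o k] applies; an infinite norm makes the claim
    trivial. *)
Lemma LnormD_nonneg p h k : 1 <= p -> measurable_fun setT h -> measurable_fun setT k ->
  (forall w, 0 <= h w) -> (forall w, 0 <= k w) ->
  'N[P]_p[(fun w => h w + k w)] <= 'N[P]_p[h] + 'N[P]_p[k].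
Proof.
move=> p1 mh mk h0 k0.
have [hy|] := ltP ('N[P]_p[h]) +oo; last first.
  by rewrite leye_eq => /eqP ->; rewrite addye ?leey// gt_eqF// (lt_le_trans ltNy0)// Lnorm_ge0.
have [ky|] := ltP ('N[P]_p[k]) +oo; last first.
  by rewrite leye_eq => /eqP ->; rewrite addey ?leey// gt_eqF// (lt_le_trans ltNy0)// Lnorm_ge0.
have hf := Lnorm_lty_ae p1 mh h0 hy; have kf := Lnorm_lty_ae p1 mk k0 ky.
have mfh : measurable_fun setT (fine \o h) by exact: measurableT_comp.
have mfk : measurable_fun setT (fine \o k) by exact: measurableT_comp.
have mEh : measurable_fun setT (EFin \o (fine \o h)) by exact: measurableT_comp.
have mEk : measurable_fun setT (EFin \o (fine \o k)) by exact: measurableT_comp.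
apply: (@le_trans _ _ 'N[P]_p[EFin \o ((fine \o h) \+ (fine \o k))%R]).
  apply: Lnorm_le_ae => //; first exact: emeasurable_funD.
    by apply: measurableT_comp => //; exact: measurable_funD.
  apply: filterS2 hf kf => w hw kw /=.
  by rewrite EFinD !fineK ?ge0_fin_numE// adde_ge0/=.
rewrite (le_trans (eminkowski _ mfh mfk p1))// leeD//.
- apply: Lnorm_le_ae => //; apply: filterS hf => w hw /=.
  by rewrite fineK ?ge0_fin_numE// h0/=.
- apply: Lnorm_le_ae => //; apply: filterS kf => w kw /=.
  by rewrite fineK ?ge0_fin_numE// k0/=.
Qed.

Lemma LnormZ_nonneg p h (c : R) : 1 <= p -> measurable_fun setT h ->
  (forall w, 0 <= h w) -> (0 <= c)%R ->
  'N[P]_p[(fun w => c%:E * h w)] <= c%:E * 'N[P]_p[h].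
Proof.
move=> + mh h0 c0; rewrite unlock; case: p => [r|_|//]; last first.
  rewrite PT -(ess_supZl _ PT c0); apply: le_ess_sup; apply: nearW => w /=.
  by rewrite abseM gee0_abs ?lee_fin.
rewrite lee_fin => r1; have r0 : (0 < r)%R by exact: lt_le_trans r1.
have rN0 : r != 0%R by rewrite gt_eqF.
under eq_integral do rewrite abseM gee0_abs ?lee_fin// poweRM ?lee_fin//.
rewrite poweR_EFin ge0_integralZl_EFin//.
- rewrite poweRM ?lee_fin ?powR_ge0//; last first.
    by apply: integral_ge0 => w _; exact: poweR_ge0.
  by rewrite poweR_EFin -powRrM divff// powRr1.
- by move=> w _; exact: poweR_ge0.
- exact: measurable_abse_poweR.
- exact: powR_ge0.
Qed.

(** The total mass is 1: for a finite exponent r >= 1, h <= 1 + h^r pointwise, and for p = +oo the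
    essential supremum dominates. *)
Lemma Lnorm_integral_lty p h : 1 <= p -> measurable_fun setT h ->
  (forall w, 0 <= h w) -> 'N[P]_p[h] < +oo -> \int[P]_w h w < +oo.
Proof.
move=> + mh h0; rewrite unlock; case: p => [r|_|//]; last first.
  rewrite PT => hy; set M := ess_sup P (abse \o h) in hy.
  have hM : {ae P, forall w, h w <= M}.
    have := ess_sup_ge P (abse \o h).
    by apply: filterS => w; rewrite /= gee0_abs.
  have M0 : 0 <= M.
    by apply: ess_sup_gee => //; apply: nearW => w; exact: abse_ge0.
  apply: (@le_lt_trans _ _ (\int[P]_w (cst M w))); last first.
    by rewrite integral_cst// -/M [X in _ * X](probability_setT P) mule1.
  apply: ae_ge0_le_integral => //.
  by apply: filterS hM => w hw _.
rewrite lee_fin => r1; have r0 : (0 < r)%R by exact: lt_le_trans r1.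
have rN0 : r != 0%R by rewrite gt_eqF.
move=> /lty_poweRy; rewrite invr_eq0 => /(_ rN0) hy.
apply: (@le_lt_trans _ _ (\int[P]_w (cst 1 w + `|h w| `^ r))); last first.
  rewrite ge0_integralD//.
  - by rewrite integral_cst// [X in _ * X](probability_setT P) mule1 lte_add_pinfty ?ltry.
  - by move=> w _; exact: poweR_ge0.
  - exact: measurable_abse_poweR.
apply: ge0_le_integral => //.
- by apply: emeasurable_funD => //; exact: measurable_abse_poweR.
- move=> w _ /=; rewrite gee0_abs//; have [h1|h1] := leP (h w) 1.
    by rewrite (le_trans h1)// leeDl ?poweR_ge0.
  have [->|hwy] := eqVneq (h w) +oo; first by rewrite poweRyr// addey.
  have hwf : h w \is a fin_num by rewrite ge0_fin_numE// ltey.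
  rewrite -(fineK hwf) poweR_EFin -EFinD lee_fin.
  rewrite (@le_trans _ _ (fine (h w) `^ r)%R) ?lerDr// le1r_powR//.
  by rewrite -lee_fin fineK// ltW.
Qed.

End Lnorm_nonneg.

Section Lpnorm_theory.
Context {R : realType} {d : measure_display} {Omega : measurableType d}.
Variable P : probability Omega R.
Hypothesis hP : complete_sub P d.-measurable.
Local Open Scope ereal_scope.

Lemma Lpnorm_ge0 (V : lmodType R) (N : V -> \bar R) p f : 0 <= Lpnorm P N p f.
Proof. exact: Lnorm_ge0. Qed.

Lemma Lpnorm_le (V W : lmodType R) (N : V -> \bar R) (M : W -> \bar R) p f h :
  enorm N -> enorm M -> 1 <= p ->
  strongly_measurable P N d.-measurable f -> strongly_measurable P M d.-measurable h ->
  {ae P, forall w, N (f w) <= M (h w)} -> Lpnorm P N p f <= Lpnorm P M p h.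
Proof.
move=> hN hM p1 sf sh fh; apply: Lnorm_le_ae => //.
- exact: (sm_measurable hN hP).
- exact: (sm_measurable hM hP).
- by apply: filterS fh => w fh /=; rewrite (enorm_ge0 hN).
Qed.

Lemma Lpnorm_leZ (V W : lmodType R) (N : V -> \bar R) (M : W -> \bar R) p f h (c : R) :
  enorm N -> enorm M -> 1 <= p -> (0 <= c)%R ->
  strongly_measurable P N d.-measurable f -> strongly_measurable P M d.-measurable h ->
  {ae P, forall w, N (f w) <= c%:E * M (h w)} ->
  Lpnorm P N p f <= c%:E * Lpnorm P M p h.
Proof.
move=> hN hM p1 c0 sf sh fh.
have mh := sm_measurable hM hP sh.
apply: (@le_trans _ _ 'N[P]_p[(fun w => c%:E * M (h w))]); last first.
  by apply: LnormZ_nonneg => // w; exact: (enorm_ge0 hM).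
apply: Lnorm_le_ae => //.
- exact: (sm_measurable hN hP).
- exact: measurable_funeM.
- by apply: filterS fh => w fh /=; rewrite (enorm_ge0 hN).
Qed.

Lemma Lpnorm_leD (V W1 W2 : lmodType R) (N : V -> \bar R) (M1 : W1 -> \bar R)
    (M2 : W2 -> \bar R) p f h1 h2 :
  enorm N -> enorm M1 -> enorm M2 -> 1 <= p ->
  strongly_measurable P N d.-measurable f ->
  strongly_measurable P M1 d.-measurable h1 ->
  strongly_measurable P M2 d.-measurable h2 ->
  {ae P, forall w, N (f w) <= M1 (h1 w) + M2 (h2 w)} ->
  Lpnorm P N p f <= Lpnorm P M1 p h1 + Lpnorm P M2 p h2.
Proof.
move=> hN hM1 hM2 p1 sf sh1 sh2 fh.
have mh1 := sm_measurable hM1 hP sh1.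
have mh2 := sm_measurable hM2 hP sh2.
apply: (@le_trans _ _ 'N[P]_p[(fun w => M1 (h1 w) + M2 (h2 w))]); last first.
  by apply: LnormD_nonneg => // w; [exact: (enorm_ge0 hM1)|exact: (enorm_ge0 hM2)].
apply: Lnorm_le_ae => //.
- exact: (sm_measurable hN hP).
- exact: emeasurable_funD.
- by apply: filterS fh => w fh /=; rewrite (enorm_ge0 hN).
Qed.

Section one_space.
Variables (V : lmodType R) (N : V -> \bar R).
Hypothesis hN : enorm N.
Variable p : \bar R.
Hypothesis p1 : 1 <= p.
Implicit Types f h : Omega -> V.
Local Notation sm := (strongly_measurable P N d.-measurable).

Lemma LpnormD f h : sm f -> sm h ->
  Lpnorm P N p (fun w => f w + h w)%R <= Lpnorm P N p f + Lpnorm P N p h.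
Proof.
move=> sf sh; apply: Lpnorm_leD => //; first exact: smD.
by apply: aeW => w; exact: enormD.
Qed.

Lemma LpnormB f h : sm f -> sm h ->
  Lpnorm P N p (fun w => f w - h w)%R <= Lpnorm P N p f + Lpnorm P N p h.
Proof.
move=> sf sh; apply: Lpnorm_leD => //; first exact: smB.
by apply: aeW => w; exact: enormB.
Qed.

Lemma Lpnorm_subC f h :
  Lpnorm P N p (fun w => f w - h w)%R = Lpnorm P N p (fun w => h w - f w)%R.
Proof. by congr Lnorm; apply/funext => w /=; exact: enorm_subC. Qed.

Lemma Lpnorm_leDB f h : sm f -> sm h ->
  Lpnorm P N p f <= Lpnorm P N p (fun w => f w - h w)%R + Lpnorm P N p h.
Proof.
move=> sf sh; apply: Lpnorm_leD => //; first exact: smB.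
by apply: aeW => w; exact: enorm_leDB.
Qed.

Lemma Lpnorm_triangle k f h : sm f -> sm h -> sm k ->
  Lpnorm P N p (fun w => f w - h w)%R <=
  Lpnorm P N p (fun w => f w - k w)%R + Lpnorm P N p (fun w => k w - h w)%R.
Proof.
move=> sf sh sk; apply: Lpnorm_leD => //; try exact: smB.
by apply: aeW => w; exact: enorm_triangle.
Qed.

Lemma eq_Lpnorm_ae f h : sm f -> {ae P, forall w, N (f w - h w)%R = 0} ->
  Lpnorm P N p f = Lpnorm P N p h.
Proof.
move=> sf fh; have sh := sm_ae hN fh sf.
apply/eqP; rewrite eq_le; apply/andP; split; apply: Lpnorm_le => //.
- apply: filterS fh => w fh.
  by rewrite (le_trans (enorm_leDB hN _ (h w)))// fh add0e.
- apply: filterS fh => w fh.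
  by rewrite (le_trans (enorm_leDB hN _ (f w)))// (enorm_subC hN) fh add0e.
Qed.

Lemma Lpnorm0 : Lpnorm P N p (fun=> 0%R) = 0.
Proof.
rewrite /Lpnorm (_ : N \o _ = cst 0) ?Lnorm0//.
  by rewrite gt_eqF// (lt_le_trans _ p1)// lte01.
by apply/funext => w /=; rewrite (enorm0 hN).
Qed.

Lemma Lpnorm_integral_lty f : sm f -> Lpnorm P N p f < +oo ->
  \int[P]_w N (f w) < +oo.
Proof.
move=> sf; apply: Lnorm_integral_lty => //; first exact: (sm_measurable hN hP).
by move=> w; exact: (enorm_ge0 hN).
Qed.

End one_space.

Lemma Lpnorm_infty_ae (V : lmodType R) (N : V -> \bar R) f : enorm N ->
  {ae P, forall w, N (f w) <= Lpnorm P N +oo f}.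
Proof.
move=> hN; have PT : 0 < P [set: Omega] by rewrite probability_setT lte01.
rewrite /Lpnorm unlock PT.
have H : {ae P, forall w, (abse \o (N \o f)) w <= ess_sup P (abse \o (N \o f))} by exact: ess_sup_ge.
by apply: filterS H => w; rewrite /= gee0_abs// (enorm_ge0 hN).
Qed.

Lemma Lpnorm_pair (U V W : lmodType R) (NU : U -> \bar R) (NV : V -> \bar R)
    (NW : W -> \bar R) (B : U -> V -> W) p f h :
  enorm NU -> enorm NV -> enorm NW -> pairing NU NV NW B -> 1 <= p ->
  strongly_measurable P NU d.-measurable f -> strongly_measurable P NV d.-measurable h ->
  Lpnorm P NU +oo f < +oo ->
  Lpnorm P NW p (fun w => B (f w) (h w)) <= Lpnorm P NU +oo f * Lpnorm P NV p h.
Proof.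
move=> hU hV hW hB p1 sf sh fy.
have ffin : Lpnorm P NU +oo f \is a fin_num by rewrite ge0_fin_numE// Lpnorm_ge0.
rewrite -(fineK ffin); apply: Lpnorm_leZ => //.
- by rewrite fine_ge0// Lpnorm_ge0.
- by apply: sm_pair sf sh => //; exact: (complete_subI hP).
apply: filterS2 (Lpnorm_infty_ae f hU) (filterI (sm_lty hU sf) (sm_lty hV sh)).
move=> w fw [fwy hwy]; rewrite (le_trans (pairing_le hB _ _))// fineK//.
by rewrite lee_wpmul2r// (enorm_ge0 hV).
Qed.

End Lpnorm_theory.

(** * Dominated convergence in L^m and approximation by simple functions *)

Section Lp_approximation.
Context {R : realType} {d : measure_display} {Omega : measurableType d}.
Variable P : probability Omega R.
Local Open Scope ereal_scope.

(** Dominated convergence is applied to the m-th powers; the dominating function k^m is integrable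
    because [k] has finite L^m norm. *)
Lemma dominated_Lnorm_cvg0 (m : R) (h_ : nat -> Omega -> \bar R) (k : Omega -> \bar R) :
  (1 <= m)%R -> (forall n, measurable_fun setT (h_ n)) -> measurable_fun setT k ->
  (forall n w, 0 <= h_ n w) -> (forall w, 0 <= k w) ->
  {ae P, forall w, forall n, h_ n w <= k w} -> 'N[P]_m%:E[k] < +oo ->
  {ae P, forall w, h_ n w @[n --> \oo] --> 0} ->
  'N[P]_m%:E[h_ n] @[n --> \oo] --> 0.
Proof.
move=> m1 mh mk hn0 k0 hk ky h0; have m0 : (0 < m)%R by exact: lt_le_trans m1.
have mN0 : m != 0%R by rewrite gt_eqF.
have ik : P.-integrable setT (fun w => k w `^ m).
  apply/integrableP; split.
    by apply: (measurableT_comp (measurable_poweR m)).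
  under eq_integral do rewrite gee0_abs ?poweR_ge0//.
  move: ky; rewrite unlock => /lty_poweRy; rewrite invr_eq0 => /(_ mN0).
  by under eq_integral do rewrite gee0_abs//.
have [|||||_ + _] := @dominated_convergence _ _ _ P setT measurableT
  (fun n w => h_ n w `^ m) (cst 0) (fun w => k w `^ m).
- by move=> n; exact: (measurableT_comp (measurable_poweR m)).
- exact: measurable_cst.
- apply: filterS h0 => w h0 _; apply/cvge0P; first by move=> n; exact: poweR_ge0.
  move=> eps e0; have e1 : (0 < eps `^ m^-1)%R by rewrite powR_gt0.
  move/cvge0P : h0 => /(_ (hn0 ^~ w) _ e1); apply: filterS => n hn.
  rewrite (@le_trans _ _ ((eps `^ m^-1)%:E `^ m))//.
    by rewrite gt0_ler_poweR ?(ltW m0)// in_itv/= ?leey ?andbT ?lee_fin ?powR_ge0.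
  by rewrite poweR_EFin -powRrM mulVf// powRr1 ?(ltW e0).
- exact: ik.
- apply: filterS hk => w hk n _; rewrite gee0_abs ?poweR_ge0//.
  by rewrite gt0_ler_poweR ?(ltW m0)// in_itv/= ?leey ?andbT.
move=> ih; apply/cvge0P; first by move=> n; exact: Lnorm_ge0.
have I0 n : 0 <= \int[P]_w `|h_ n w `^ m - cst 0 w|.
  by apply: integral_ge0 => w _; exact: abse_ge0.
move=> eps e0; have e1 : (0 < eps `^ m)%R by rewrite powR_gt0.
move/cvge0P : ih => /(_ I0 _ e1); apply: filterS => n.
rewrite unlock; under eq_integral do rewrite sube0 gee0_abs ?poweR_ge0//.
under [in X in X -> _]eq_integral => w _ do rewrite -(gee0_abs (hn0 n w)).
set I := \int[P]_w _ => hI.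
have I0' : 0 <= I by apply: integral_ge0 => w _; exact: poweR_ge0.
rewrite (@le_trans _ _ ((eps `^ m)%:E `^ m^-1))//.
  by rewrite gt0_ler_poweR ?invr_ge0 ?(ltW m0)// in_itv/= ?leey ?andbT ?lee_fin ?powR_ge0.
by rewrite poweR_EFin -powRrM divff// powRr1 ?(ltW e0).
Qed.

Variables (V : lmodType R) (N : V -> \bar R).
Hypothesis hN : enorm N.
Variable G : set (set Omega).
Hypothesis hG : complete_sub P G.

(* The approximants are cut off where they exceed [2 * N f], so that [3 * N f]
   dominates the errors. *)
Lemma sm_dominated_approx f : strongly_measurable P N G f ->
  exists2 g : nat -> @simple_rep R _ Omega V, forall n, simple_in N G (g n) &
    ae_approx P N g f /\
    (forall n w, N (f w - simple_fun (g n) w)%R <= 3%:E * N (f w)).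
Proof.
move=> sf; have [g hg gf] := sf.
have mN n : gmeas G (fun w => N (simple_fun (g n) w)).
  under [X in gmeas G X]eq_fun do rewrite -(add0r (simple_fun _ _)).
  exact: (gmeas_simple hG _ (hg n)).
pose D n := [set w | N (simple_fun (g n) w) <= 2%:E * N (f w)].
have GD n : G (D n).
  rewrite -(complete_subE hG) -[D n]setTI.
  apply: (@measurable_lee _ (g_sigma_algebraType G)).
  - exact: measurableT.
  - exact: mN.
  - exact: (@measurable_funeM _ (g_sigma_algebraType G) _ _ (N \o f) 2%:E (sm_gmeas hN hG sf)).
exists (fun n => simple_restrict (D n) (g n)).
  by move=> n; apply: simple_in_restrict (hg n) => A; exact: (complete_subI hG).
have hD n w : D n w -> simple_fun (simple_restrict (D n) (g n)) w = simple_fun (g n) w.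
  by move=> Dw; rewrite simple_fun_restrict indicE mem_set// scale1r.
have hnD n w : ~ D n w -> simple_fun (simple_restrict (D n) (g n)) w = 0%R.
  by move=> Dw; rewrite simple_fun_restrict indicE memNset// scale0r.
split; last first.
  move=> n w; have [Dw|nDw] := pselect (D n w).
    rewrite hD// (le_trans (enormB hN _ _))//.
    rewrite (_ : 3%:E = 1 + 2%:E); last by rewrite -EFinD; congr _%:E; ring.
    by rewrite ge0_muleDl ?lee_fin// mul1e leeD2l.
  rewrite hnD// subr0 -{1}(mul1e (N (f w))) lee_wpmul2r ?(enorm_ge0 hN)//.
  by rewrite lee_fin ler1n.
apply: filterS2 gf (sm_lty hN sf) => w gf fy.
apply: (squeeze_cvge0 _ _ gf); first by move=> n; exact: (enorm_ge0 hN).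
(* Where [N (f w)] is zero, cutting off costs nothing. Where it is positive, the error eventually
   falls below it, the approximant has norm at most [2 * N (f w)], and the cut-off is inactive. *)
have [f0|f0] := eqVneq (N (f w)) 0.
  apply: nearW => n; have [Dw|nDw] := pselect (D n w); first by rewrite hD.
  by rewrite hnD// subr0 f0 (enorm_ge0 hN).
have ffin := enorm_fin_num hN fy.
have f1 : (0 < fine (N (f w)))%R.
  by rewrite fine_gt0// fy andbT lt_neqAle eq_sym f0 (enorm_ge0 hN).
move/cvge0P : gf => /(_ (fun=> enorm_ge0 hN _) _ f1); apply: filterS => n gn.
rewrite hD// /D/= (le_trans (enorm_leDB hN _ (f w)))// (enorm_subC hN).
rewrite (_ : 2%:E = 1 + 1); last by rewrite -EFinD; congr _%:E; ring.
by rewrite ge0_muleDl// mul1e leeD2r// -(fineK ffin).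
Qed.

Lemma sm_Lp_approx (m : R) f : (1 <= m)%R -> strongly_measurable P N G f ->
  Lpnorm P N m%:E f < +oo ->
  exists2 g : nat -> @simple_rep R _ Omega V, forall n, simple_in N G (g n) &
    ae_approx P N g f /\
    Lpnorm P N m%:E (fun w => f w - simple_fun (g n) w)%R @[n --> \oo] --> 0.
Proof.
move=> m1 sf fy; have [g hg [gf gle]] := sm_dominated_approx sf.
exists g => //; split => //.
have mf := sm_measurable hN hG sf.
apply: (@dominated_Lnorm_cvg0 m (fun n w => N (f w - simple_fun (g n) w)%R) (fun w => 3%:E * N (f w))) => //.
- move=> n; apply: (sm_measurable hN hG); exact: (smB hN sf (sm_simple P hN (hg n))).
- exact: measurable_funeM.
- by move=> n w; exact: (enorm_ge0 hN).
- by move=> w; rewrite mule_ge0 ?(enorm_ge0 hN).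
- by apply: aeW => w n.
- rewrite (le_lt_trans (LnormZ_nonneg _ _ mf _ _))//.
    by move=> w; exact: (enorm_ge0 hN).
  by rewrite lte_mul_pinfty// Lnorm_ge0.
Qed.

Lemma Lpnorm1E f : Lpnorm P N 1 f = \int[P]_w N (f w).
Proof.
rewrite /Lpnorm Lnorm1; apply: eq_integral => w _.
by rewrite gee0_abs// (enorm_ge0 hN).
Qed.

End Lp_approximation.

(** * Bochner integral *)

Section bochner_integral.
Context {R : realType} {d : measure_display} {Omega : measurableType d}.
Variable P : probability Omega R.
Hypothesis hP : complete_sub P d.-measurable.
Local Open Scope ereal_scope.

Section one_space.
Context {V : lmodType R}.
Variable N : V -> \bar R.
Hypothesis hN : enorm N.
Implicit Types (A D : set Omega) (f : Omega -> V) (g : @simple_rep R _ Omega V).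
Local Notation sm := (strongly_measurable P N d.-measurable).

Let fineP A : measurable A -> (fine (P A))%:E = P A.
Proof. by move=> mA; rewrite fineK// fin_num_measure. Qed.

Lemma simple_integral_split A D g : simple_in N d.-measurable g ->
  measurable A -> measurable D ->
  simple_integral P A g = (simple_integral P (A `&` D) g + simple_integral P (A `\` D) g)%R.
Proof.
move=> + mA mD; rewrite /simple_integral -big_split.
elim: g => [_|b g ih /simple_in_cons[mb _ /ih hg]]; first by rewrite !big_nil.
rewrite !big_cons hg /= -scalerDl; congr (_ *: _ + _)%R.
apply: EFin_inj; rewrite EFinD !fineP//; last 3 first.
- by apply: measurableI => //; exact: measurableD.
- by apply: measurableI => //; exact: measurableI.
- exact: measurableI.
rewrite -measureU//.
- by rewrite -setIUl setUIDK.
- by apply: measurableI => //; exact: measurableI.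
- by apply: measurableI => //; exact: measurableD.
- by apply/seteqP; split => // w [[[_ Dw] _] [[_ nDw] _]].
Qed.

(* Peeling off the pairs one at a time splits [A] along a set of [G] at each step,
   with the peeled value added to the offset [v]. *)
Lemma simple_ind (G : set (set Omega)) (Q : set Omega -> (Omega -> V) -> V -> Prop) :
  complete_sub P G ->
  (forall A v, G A -> N v < +oo -> Q A (fun=> v) (fine (P A) *: v)%R) ->
  (forall A D f x y, G A -> G D -> Q (A `&` D) f x -> Q (A `\` D) f y ->
    Q A f (x + y)%R) ->
  (forall A f f' x, G A -> (forall w, A w -> f w = f' w) -> Q A f x -> Q A f' x) ->
  forall g, simple_in N G g -> forall A v, G A -> N v < +oo ->
    Q A (fun w => v + simple_fun g w)%R (fine (P A) *: v + simple_integral P A g)%R.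
Proof.
move=> hG Q0 QU Qe; have Gd := complete_sub_measurable hG.
elim=> [_ A v GA vy|b g ih /simple_in_cons[Gb by_ hg] A v GA vy].
  rewrite /simple_integral big_nil addr0; apply: Qe (Q0 _ _ GA vy) => // w _.
  by rewrite simple_fun_nil addr0.
have GI := complete_subI hG GA Gb; have GD := complete_subD hG GA Gb.
have hg' : simple_in N d.-measurable g.
  by move=> i ig; have [/Gd] := hg i ig.
have -> : (fine (P A) *: v + simple_integral P A (b :: g) =
    (fine (P (A `&` b.1)) *: (v + b.2) + simple_integral P (A `&` b.1) g) +
    (fine (P (A `\` b.1)) *: v + simple_integral P (A `\` b.1) g))%R.
  rewrite {1}/simple_integral big_cons -/(simple_integral P A g).
  rewrite (simple_integral_split hg' (Gd _ GA) (Gd _ Gb)).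
  have -> : fine (P A) = (fine (P (A `&` b.1)) + fine (P (A `\` b.1)))%R.
    apply: EFin_inj; rewrite EFinD !fineP; try exact: Gd.
    rewrite -measureU//; try exact: Gd.
      by rewrite setUIDK.
    by apply/seteqP; split => // w [[_ ?] [_]].
  rewrite scalerDl scalerDr addrACA -[RHS]addrA; congr (_ + _)%R.
  exact: addrCA.
apply: (QU _ b.1) => //.
- apply: Qe (ih hg _ (v + b.2)%R GI (enormD_lty hN vy by_)) => // w [_ bw].
  by rewrite simple_fun_cons indicE mem_set// scale1r addrA.
- apply: Qe (ih hg _ v GD vy) => // w [_ bw].
  by rewrite simple_fun_cons indicE memNset// scale0r add0r.
Qed.

Lemma measurable_simple g v : simple_in N d.-measurable g ->
  measurable_fun setT (fun w => N (v + simple_fun g w)%R).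
Proof. by move=> hg; exact: (gmeas_measurable hP (gmeas_simple hP v hg)). Qed.

Lemma integral_split A D (h : Omega -> \bar R) : measurable A -> measurable D ->
  measurable_fun A h -> (forall w, 0 <= h w) ->
  \int[P]_(w in A) h w = \int[P]_(w in A `&` D) h w + \int[P]_(w in A `\` D) h w.
Proof.
move=> mA mD mh h0; rewrite -ge0_integral_setU//.
- by rewrite setUIDK.
- exact: measurableI.
- exact: measurableD.
- by rewrite setUIDK.
- by apply/disj_setPS => w [[_ ?] [_]].
Qed.

Lemma integral_cst_fine A v : measurable A ->
  \int[P]_(w in A) N v = N (fine (P A) *: v)%R.
Proof.
move=> mA; rewrite integral_cst// (enormZ hN) ger0_norm ?fine_ge0//.
by rewrite fineP// muleC.
Qed.

(** Equality holds on pieces where the function is constant, and the triangle inequality joins the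
    pieces. The predicate [Q] carries measurability of [N \o f], because splitting the integral
    needs it and an arbitrary [f] would not provide it. *)
Lemma simple_integral_le_offset A g v : measurable A -> simple_in N d.-measurable g ->
  N v < +oo ->
  N (fine (P A) *: v + simple_integral P A g)%R <=
    \int[P]_(w in A) N (v + simple_fun g w)%R.
Proof.
move=> mA hg vy.
pose Q B (f : Omega -> V) (x : V) :=
  measurable_fun B (N \o f) -> N x <= \int[P]_(w in B) N (f w).
apply: (simple_ind hP (Q := Q)) => //.
- by move=> B u mB _ _; rewrite integral_cst_fine.
- move=> B D f x y mB mD h1 h2 mf.
  rewrite (le_trans (enormD hN _ _))// (integral_split mB mD mf).
    by rewrite leeD ?h1 ?h2//; apply: measurable_funS mf => //; exact: subIsetl.
  by move=> w; exact: (enorm_ge0 hN).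
- move=> B f f' x mB ff' h mf'.
  have mf : measurable_fun B (N \o f).
    apply: eq_measurable_fun mf' => w; rewrite inE => Bw /=.
    by rewrite ff'.
  rewrite (le_trans (h mf))// (eq_integral (fun w => N (f' w)))// => w.
  by rewrite inE => Bw; rewrite ff'.
- by apply: measurable_funTS; exact: measurable_simple.
Qed.

Lemma simple_integral_le A g : measurable A -> simple_in N d.-measurable g ->
  N (simple_integral P A g) <= \int[P]_(w in A) N (simple_fun g w).
Proof.
move=> mA hg; have N0 : N 0%R < +oo by rewrite (enorm0 hN) ltry.
have := simple_integral_le_offset mA hg N0.
rewrite scaler0 add0r => /le_trans; apply.
by under eq_integral do rewrite add0r.
Qed.

Definition simple_opp g : @simple_rep R _ Omega V := simple_map -%R g.

Lemma simple_in_opp (G : set (set Omega)) g : simple_in N G g -> simple_in N G (simple_opp g).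
Proof. by apply: simple_in_map => v; rewrite (enormN hN). Qed.

Lemma simple_fun_opp g w : simple_fun (simple_opp g) w = (- simple_fun g w)%R.
Proof.
elim: g => [|b g ih]; first by rewrite !simple_fun_nil oppr0.
by rewrite !simple_fun_cons ih opprD scalerN.
Qed.

Lemma simple_integral_cat A g g' :
  simple_integral P A (g ++ g') = (simple_integral P A g + simple_integral P A g')%R.
Proof. by rewrite /simple_integral big_cat. Qed.

Lemma simple_integral_map (W : lmodType R) (T : V -> W) A g :
  simple_integral P A (simple_map T g) = (\sum_(b <- g) fine (P (A `&` b.1)) *: T b.2)%R.
Proof. by rewrite /simple_integral big_map. Qed.

Lemma simple_integral_opp A g :
  simple_integral P A (simple_opp g) = (- simple_integral P A g)%R.
Proof.
rewrite /simple_opp simple_integral_map -sumrN.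
by apply: eq_bigr => b _; rewrite scalerN.
Qed.

Lemma simple_integralB_le A g g' : measurable A ->
  simple_in N d.-measurable g -> simple_in N d.-measurable g' ->
  N (simple_integral P A g - simple_integral P A g')%R <=
    \int[P]_(w in A) N (simple_fun g w - simple_fun g' w)%R.
Proof.
move=> mA hg hg'; rewrite -simple_integral_opp -simple_integral_cat.
apply: le_trans (simple_integral_le mA _) _.
  by apply: simple_in_cat => //; exact: simple_in_opp.
by under eq_integral do rewrite simple_fun_cat simple_fun_opp.
Qed.

Lemma integral_subset_le A f : sm f -> measurable A ->
  \int[P]_(w in A) N (f w) <= \int[P]_w N (f w).
Proof.
move=> sf mA; apply: ge0_subset_integral => //.
  exact: (sm_measurable hN hP).
by move=> w _; exact: (enorm_ge0 hN).
Qed.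

Lemma le_integral_enorm A f f1 f2 : sm f -> sm f1 -> sm f2 -> measurable A ->
  (forall w, A w -> N (f w) <= N (f1 w) + N (f2 w)) ->
  \int[P]_(w in A) N (f w) <= \int[P]_(w in A) N (f1 w) + \int[P]_(w in A) N (f2 w).
Proof.
move=> sf sf1 sf2 mA h.
have m1 : measurable_fun A (N \o f1) by apply: measurable_funTS; exact: (sm_measurable hN hP).
have m2 : measurable_fun A (N \o f2) by apply: measurable_funTS; exact: (sm_measurable hN hP).
rewrite -ge0_integralD//; [|by move=> w _; exact: (enorm_ge0 hN)..].
apply: ge0_le_integral => //; first by move=> w _; exact: (enorm_ge0 hN).
- by apply: measurable_funTS; exact: (sm_measurable hN hP).
- exact: emeasurable_funD.
Qed.

Lemma is_bochner_sm A f v : is_bochner P N A f v -> sm f.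
Proof. by move=> [g [hg gf _ _]]; exists g. Qed.

Lemma is_bochner_lty A f v : is_bochner P N A f v -> N v < +oo.
Proof.
move=> [g [hg _ _ gv]]; apply: (enorm_cvg_lty hN gv) => n.
elim: (g n) (hg n) => [_|b k ih /simple_in_cons[_ bty /ih]].
  by rewrite /simple_integral big_nil (enorm0 hN) ltry.
rewrite /simple_integral big_cons => ?.
by rewrite (enormD_lty hN)// (enormZ_lty hN).
Qed.

Lemma is_bochner_le A f v : measurable A -> is_bochner P N A f v ->
  N v <= \int[P]_(w in A) N (f w).
Proof.
move=> mA hb; have sf := is_bochner_sm hb; move: hb => [g [hg gf g0 gv]].
have h : N (simple_integral P A (g n) - v)%R +
    \int[P]_(w in A) N (f w - simple_fun (g n) w)%R @[n --> \oo] --> 0.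
  apply: cvge0D => // n; first exact: (enorm_ge0 hN).
  by apply: integral_ge0 => w _; exact: (enorm_ge0 hN).
apply/lee_addgt0Pr => e e0.
have h0 n : 0 <= N (simple_integral P A (g n) - v)%R +
    \int[P]_(w in A) N (f w - simple_fun (g n) w)%R.
  by rewrite adde_ge0 ?(enorm_ge0 hN)//; apply: integral_ge0 => w _; exact: (enorm_ge0 hN).
move/cvge0P : h => /(_ h0 e e0) [n _ /(_ n (leqnn n)) hn].
have sg := sm_simple P hN (hg n).
rewrite (le_trans (enorm_leDB hN _ (simple_integral P A (g n))))// (enorm_subC hN).
apply: (@le_trans _ _ (N (simple_integral P A (g n) - v)%R +
   (\int[P]_(w in A) N (f w) + \int[P]_(w in A) N (f w - simple_fun (g n) w)%R))).
  rewrite leeD2l// (le_trans (simple_integral_le mA (hg n)))//.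
  apply: le_integral_enorm => //; first exact: smB.
  move=> w _; rewrite addeC (le_trans (enorm_leDB hN _ (f w)))//.
  by rewrite (enorm_subC hN).
by rewrite addeCA leeD2l.
Qed.

Lemma is_bochner_simple A g : simple_in N d.-measurable g ->
  is_bochner P N A (simple_fun g) (simple_integral P A g).
Proof.
move=> hg; exists (fun=> g); split => //.
- by apply: aeW => w; under eq_fun do rewrite subrr (enorm0 hN); exact: cvg_cst.
- under eq_fun do under eq_integral do rewrite subrr (enorm0 hN).
  by under eq_fun do rewrite integral0; exact: cvg_cst.
- by under eq_fun do rewrite subrr (enorm0 hN); exact: cvg_cst.
Qed.

Lemma is_bochner_cst A v : measurable A -> N v < +oo ->
  is_bochner P N A (fun=> v) (fine (P A) *: v)%R.
Proof.
move=> mA vy; have hg : simple_in N d.-measurable ([:: (setT, v)] : @simple_rep R _ Omega V).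
  by apply/simple_in_cons; split => //; exact: measurableT.
have := is_bochner_simple A hg.
rewrite /simple_integral big_seq1 setIT; congr is_bochner.
apply/funext => w; rewrite simple_fun_cons simple_fun_nil addr0.
by rewrite indicE in_setT scale1r.
Qed.

Lemma is_bochnerD A f f' v v' : measurable A ->
  is_bochner P N A f v -> is_bochner P N A f' v' ->
  is_bochner P N A (fun w => f w + f' w)%R (v + v')%R.
Proof.
move=> mA hb hb'; have sf := is_bochner_sm hb; have sf' := is_bochner_sm hb'.
move: hb hb' => [g [hg gf g0 gv]] [g' [hg' gf' g0' gv']].
have I0 k : 0 <= \int[P]_(w in A) N (k w).
  by apply: integral_ge0 => w _; exact: (enorm_ge0 hN).
exists (fun n => g n ++ g' n); split.
- by move=> n; exact: simple_in_cat.
- apply: filterS2 gf gf' => w fw f'w.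
  apply: (squeeze_cvge0 (g := fun n => N (f w - simple_fun (g n) w)%R + N (f' w - simple_fun (g' n) w)%R)).
  + by move=> n; exact: (enorm_ge0 hN).
  + by apply: nearW => n; rewrite simple_fun_cat opprD addrACA; exact: enormD.
  + by apply: cvge0D => // n; exact: (enorm_ge0 hN).
- apply: (squeeze_cvge0 (g := fun n => \int[P]_(w in A) N (f w - simple_fun (g n) w)%R +
     \int[P]_(w in A) N (f' w - simple_fun (g' n) w)%R)) => //.
  + apply: nearW => n.
    have [sg sg'] := (sm_simple P hN (hg n), sm_simple P hN (hg' n)).
    apply: le_integral_enorm => //; try exact: smB.
      apply: smB => //; first exact: smD.
      by apply: (sm_simple P hN); exact: simple_in_cat.
    by move=> w _; rewrite simple_fun_cat opprD addrACA; exact: enormD.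
  + exact: cvge0D.
- apply: (squeeze_cvge0 (g := fun n => N (simple_integral P A (g n) - v)%R +
     N (simple_integral P A (g' n) - v')%R)).
  + by move=> n; exact: (enorm_ge0 hN).
  + apply: nearW => n; rewrite simple_integral_cat opprD addrACA.
    exact: enormD.
  + by apply: cvge0D => // n; exact: (enorm_ge0 hN).
Qed.

Lemma is_bochner_eq0 A f v v' : N (v - v')%R = 0 ->
  is_bochner P N A f v -> is_bochner P N A f v'.
Proof.
move=> vv' [g [hg gf g0 gv]]; exists g; split => //.
apply: (squeeze_cvge0 _ _ gv); first by move=> n; exact: (enorm_ge0 hN).
apply: nearW => n; rewrite (le_trans (enorm_triangle hN v _ _))//.
by rewrite vv' adde0.
Qed.

Lemma is_bochner_ae A f f' v : measurable A -> {ae P, forall w, N (f w - f' w)%R = 0} ->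
  is_bochner P N A f v -> is_bochner P N A f' v.
Proof.
move=> mA ff' hb; have sf := is_bochner_sm hb; have sf' := sm_ae hN ff' sf.
move: hb => [g [hg gf g0 gv]]; exists g; split => //.
- apply: filterS2 gf ff' => w gf ff'.
  apply: (squeeze_cvge0 _ _ gf); first by move=> n; exact: (enorm_ge0 hN).
  apply: nearW => n; rewrite (le_trans (enorm_triangle hN (f w) _ _))//.
  by rewrite (enorm_subC hN) ff' add0e.
- apply: (squeeze_cvge0 _ _ g0).
    by move=> n; apply: integral_ge0 => w _; exact: (enorm_ge0 hN).
  apply: nearW => n; have sg := sm_simple P hN (hg n).
  apply: ae_ge0_le_integral => //.
  + by move=> w _; exact: (enorm_ge0 hN).
  + by apply: measurable_funTS; apply: (sm_measurable hN hP); exact: smB.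
  + by move=> w _; exact: (enorm_ge0 hN).
  + by apply: measurable_funTS; apply: (sm_measurable hN hP); exact: smB.
  apply: filterS ff' => w ff' _; rewrite (le_trans (enorm_triangle hN (f w) _ _))//.
  by rewrite (enorm_subC hN) ff' add0e.
Qed.

(** The integrals of simple functions that approximate [f] in L^1 form a Cauchy sequence, so
    completeness of [N] supplies the value. *)
Lemma is_bochner_exists A f : ecomplete N -> measurable A -> sm f ->
  \int[P]_w N (f w) < +oo -> exists v, is_bochner P N A f v.
Proof.
move=> cN mA sf fy.
have [|g hg [gf g0]] := sm_Lp_approx hN hP (lexx 1%R) sf; first by rewrite Lpnorm1E.
pose J n := \int[P]_(w in A) N (f w - simple_fun (g n) w)%R.
have J0 n : 0 <= J n by apply: integral_ge0 => w _; exact: (enorm_ge0 hN).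
have gJ : J n @[n --> \oo] --> 0.
  apply: (squeeze_cvge0 J0 _ g0); apply: nearW => n; rewrite Lpnorm1E//.
  by apply: integral_subset_le => //; apply: smB => //; exact: sm_simple (hg n).
have [v hv] : exists v, N (simple_integral P A (g n) - v)%R @[n --> \oo] --> 0.
  apply: cN => eps e0; have e20 : (0 < eps / 2)%R by rewrite divr_gt0.
  move/cvge0P : gJ => /(_ J0 _ e20) [n0 _ hn0]; exists n0 => n k n0n n0k.
  rewrite (le_trans (simple_integralB_le mA (hg n) (hg k)))//.
  rewrite (splitr eps) EFinD (@le_trans _ _ (J n + J k))//; last by rewrite leeD// hn0.
  have sg j := sm_simple P hN (hg j).
  apply: le_integral_enorm => //; try exact: smB.
  move=> w _; rewrite (le_trans (enorm_triangle hN (f w) _ _))//.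
  by rewrite leeD2r// (enorm_subC hN).
by exists v, g.
Qed.

End one_space.

Section map.
Variables (V W : lmodType R) (N : V -> \bar R) (M : W -> \bar R).
Hypotheses (hN : enorm N) (hM : enorm M).
Implicit Types (A : set Omega) (f : Omega -> V).

Lemma is_bochner_map A f v (T : V -> W) (c : R) : measurable A ->
  linear_on [set v | N v < +oo] T -> (0 <= c)%R ->
  (forall v, N v < +oo -> M (T v) <= c%:E * N v) ->
  strongly_measurable P M d.-measurable (T \o f) ->
  is_bochner P N A f v -> is_bochner P M A (T \o f) (T v).
Proof.
move=> mA lT c0 hT sTf hb; have sf := is_bochner_sm hb; have vy := is_bochner_lty hN hb.
move: hb => [g [hg gf g0 gv]].
have Ty u : N u < +oo -> M (T u) < +oo.
  by move=> uy; rewrite (le_lt_trans (hT _ uy))// lte_mul_pinfty.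
have TB u u' : N u < +oo -> N u' < +oo -> (T (u - u') = T u - T u')%R.
  by move=> *; rewrite -scaleN1r addrC lT//= scaleN1r addrC.
exists (fun n => simple_map T (g n)); split.
- by move=> n; exact: simple_in_map (hg n).
- apply: filterS2 gf (sm_lty hN sf) => w gf fy.
  apply: (squeeze_cvge0 (g := fun n => c%:E * N (f w - simple_fun (g n) w)%R)).
  + by move=> n; exact: (enorm_ge0 hM).
  + apply: nearW => n; have gy := simple_fun_lty w hN (hg n).
    by rewrite (simple_fun_map _ hN lT (hg n)) -TB// hT// (enormB_lty hN).
  + exact: cvge0Zl.
- apply: (squeeze_cvge0 (g := fun n => c%:E * \int[P]_(w in A) N (f w - simple_fun (g n) w)%R)).
  + by move=> n; apply: integral_ge0 => w _; exact: (enorm_ge0 hM).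
  + apply: nearW => n; have sg := sm_simple P hN (hg n).
    have mfg : measurable_fun A (fun w => N (f w - simple_fun (g n) w)%R).
      by apply: measurable_funTS; apply: (sm_measurable hN hP); exact: smB.
    rewrite -ge0_integralZl_EFin//; last by move=> w _; exact: (enorm_ge0 hN).
    apply: ae_ge0_le_integral => //.
    * by move=> w _; exact: (enorm_ge0 hM).
    * apply: measurable_funTS; apply: (sm_measurable hM hP); apply: smB => //.
      by apply: (sm_simple P hM); exact: simple_in_map (hg n).
    * by move=> w _; rewrite mule_ge0 ?(enorm_ge0 hN).
    * exact: measurable_funeM.
    apply: filterS (sm_lty hN sf) => w fy _.
    have gy := simple_fun_lty w hN (hg n).
    by rewrite (simple_fun_map _ hN lT (hg n)) -TB// hT// (enormB_lty hN).
  + exact: cvge0Zl.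
- have IT n : simple_integral P A (simple_map T (g n)) = T (simple_integral P A (g n)) /\
      N (simple_integral P A (g n)) < +oo.
    rewrite simple_integral_map /simple_integral.
    elim: (g n) (hg n) => [_|b k ih /simple_in_cons[_ bty /ih[h1 h2]]].
      by rewrite !big_nil (enorm0 hN) ltry (linear_on0 hN lT).
    by rewrite !big_cons h1 lT//; split => //; rewrite (enormD_lty hN)// (enormZ_lty hN).
  apply: (squeeze_cvge0 (g := fun n => c%:E * N (simple_integral P A (g n) - v)%R)).
  + by move=> n; exact: (enorm_ge0 hM).
  + apply: nearW => n; have [-> gy] := IT n.
    by rewrite -TB// hT// (enormB_lty hN).
  + exact: cvge0Zl.
Qed.

End map.

Section one_space_more.
Context {V : lmodType R}.
Variable N : V -> \bar R.
Hypothesis hN : enorm N.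
Implicit Types (A D : set Omega) (f : Omega -> V) (g : @simple_rep R _ Omega V).

Lemma is_bochnerZ A f v (a : R) : measurable A -> is_bochner P N A f v ->
  is_bochner P N A (fun w => a *: f w)%R (a *: v)%R.
Proof.
move=> mA hb; have sf := is_bochner_sm hb.
apply: (is_bochner_map hN hN (T := fun u => (a *: u)%R) (c := `|a|%R) mA _ _ _ _ hb) => //.
- by move=> b u u' _ _; rewrite scalerDr !scalerA mulrC.
- by move=> u _; rewrite (enormZ hN).
- exact: smZ.
Qed.

Lemma is_bochnerB A f f' v v' : measurable A ->
  is_bochner P N A f v -> is_bochner P N A f' v' ->
  is_bochner P N A (fun w => f w - f' w)%R (v - v')%R.
Proof.
move=> mA hb /(is_bochnerZ (-1) mA) hb'; rewrite -scaleN1r.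
under eq_fun do rewrite -scaleN1r; exact: is_bochnerD.
Qed.

Lemma is_bochner_dist A f f' v v' : measurable A ->
  is_bochner P N A f v -> is_bochner P N A f' v' ->
  N (v - v')%R <= \int[P]_(w in A) N (f w - f' w)%R.
Proof. by move=> mA hb hb'; apply: is_bochner_le => //; exact: is_bochnerB. Qed.

Lemma is_bochner_restrict A D f v : measurable A -> measurable D ->
  is_bochner P N (A `&` D) f v ->
  is_bochner P N A (fun w => (\1_D w : R) *: f w)%R v.
Proof.
move=> mA mD [g [hg gf g0 gv]]; exists (fun n => simple_restrict D (g n)); split.
- by move=> n; apply: simple_in_restrict (hg n) => B mB; exact: measurableI.
- apply: filterS gf => w gf; apply: (squeeze_cvge0 _ _ gf).
    by move=> n; exact: (enorm_ge0 hN).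
  apply: nearW => n; rewrite simple_fun_restrict -scalerBr (enormZ hN).
  rewrite indicE; case: (_ \in _); first by rewrite normr1 mul1e.
  by rewrite normr0 mul0e (enorm_ge0 hN).
- apply: cvg_trans g0; apply: near_eq_cvg; apply: nearW => n.
  rewrite integral_mkcondr; apply: eq_integral => w _.
  rewrite simple_fun_restrict -scalerBr (enormZ hN) indicE patchE.
  by case: (_ \in _); rewrite ?normr1 ?mul1e// normr0 mul0e.
- apply: cvg_trans gv; apply: near_eq_cvg; apply: nearW => n.
  rewrite /simple_integral /simple_restrict big_map.
  by under [in RHS]eq_bigr do rewrite setIA.
Qed.

End one_space_more.
End bochner_integral.

(** * Conditional expectation *)

Section trace_measure.
Context {R : realType} {d : measure_display} {Omega : measurableType d}.
Variables (P : probability Omega R) (G : set (set Omega)).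
Hypothesis hG : complete_sub P G.
Variable m : {finite_measure set Omega -> \bar R}.
Local Open Scope ereal_scope.

(** The restriction of [m] to [G]. The proof argument is a handle for instance inference: it carries
    the inclusion of [G] in the measurable sets, on which the measure structures declared below
    rest. *)
Definition trace_measure (_ : complete_sub P G) : set (g_sigma_algebraType G) -> \bar R := m.

Let sub (A : set (g_sigma_algebraType G)) : measurable A -> d.-measurable (A : set Omega).
Proof. by rewrite (complete_subE hG); exact: (complete_sub_measurable hG). Qed.

Let trace0 : trace_measure hG set0 = 0.
Proof. exact: measure0. Qed.

Let trace_ge0 A : 0 <= trace_measure hG A.
Proof. exact: measure_ge0. Qed.

Let trace_sigma_additive : semi_sigma_additive (trace_measure hG).
Proof.
move=> F mF tF mUF; apply: (@measure_semi_sigma_additive _ _ _ m F) => //.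
- by move=> n; exact: sub.
- exact: sub.
Qed.

HB.instance Definition _ := isMeasure.Build _ _ _
  (trace_measure hG) trace0 trace_ge0 trace_sigma_additive.

Let trace_fin : fin_num_fun (trace_measure hG).
Proof. by move=> A mA; apply: fin_num_measure; exact: sub. Qed.

HB.instance Definition _ := @Measure_isFinite.Build _ (g_sigma_algebraType G) _
  (trace_measure hG) trace_fin.

(** On [G], the trace is the push-forward of [m] under the identity, seen as a map from Omega to the
    same set equipped with [G]. *)
Lemma integral_trace (A : set Omega) (h : Omega -> \bar R) : G A -> gmeas G h ->
  (forall w, 0 <= h w) ->
  \int[trace_measure hG]_(w in A) h w = \int[m]_(w in A) h w.
Proof.
move=> GA mh h0.
have mA : measurable (A : set (g_sigma_algebraType G)) by rewrite (complete_subE hG).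
pose idG : Omega -> g_sigma_algebraType G := id.
have mid : measurable_fun setT idG.
  by move=> _ B mB; rewrite setTI; exact: sub.
rewrite -[RHS](@ge0_integral_pushforward _ _ _ _ _ idG mid m A h)//.
exact: (@measurable_funTS _ _ (g_sigma_algebraType G)).
Qed.

End trace_measure.

Section conditional_probability.
Context {R : realType} {d : measure_display} {Omega : measurableType d}.
Variables (P : probability Omega R) (G : set (set Omega)).
Hypothesis hG : complete_sub P G.
Local Open Scope ereal_scope.

(** The bounds 0 and 1 hold everywhere, not merely almost surely, so that later estimates by powers,
    weights and staircases carry no exceptional set. *)
Definition is_condprob (B : set Omega) (c : Omega -> R) : Prop :=
  [/\ gmeas G (EFin \o c), forall w, (0 <= c w <= 1)%R
    & forall A, G A -> \int[P]_(w in A) (c w)%:E = P (A `&` B)].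

(** The Radon-Nikodym derivative of A |-> P(A [&] B) with respect to P, both restricted to [G]. It
    is at most 1 almost surely, hence the truncation at 1 keeps its integrals. *)
Lemma condprob_exists B : measurable B -> exists c, is_condprob B c.
Proof.
move=> mB.
have PBy : P B < +oo by rewrite ltey_eq fin_num_measure.
pose mu : {finite_measure set (g_sigma_algebraType G) -> \bar R} := trace_measure P hG.
pose nu : {finite_measure set (g_sigma_algebraType G) -> \bar R} :=
  trace_measure (mfrestr mB PBy) hG.
have numu : nu `<< mu.
  apply/null_content_dominatesP => A mA PA0; apply/eqP; rewrite eq_le measure_ge0 andbT.
  have mAd : d.-measurable (A : set Omega).
    by apply: (complete_sub_measurable hG); rewrite -[G](complete_subE hG).
  rewrite -PA0; apply: le_measure; rewrite ?inE//.
  exact: measurableI.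
have [f [f0 mf fE']] : exists f : Omega -> \bar R, [/\ forall w, 0 <= f w, gmeas G f
    & forall A, G A -> \int[P]_(w in A) f w = P (A `&` B)].
  have [f [f0 intf fE]] := radon_nikodym_finite numu.
  have mf : gmeas G f by exact: (measurable_int _ intf).
  exists f; split => // A GA; rewrite -(integral_trace hG P GA mf f0) -fE//.
  by rewrite (complete_subE hG).
have mf' : measurable_fun setT f by exact: (gmeas_measurable hG mf).
have f1 : {ae P, forall w, f w <= 1}.
  (* On [E n] the derivative is at least 1 + 1/(n+1), while its integral there is at most P(E n);
     hence P(E n) = 0. The union of these sets is where the derivative exceeds 1. *)
  pose E n := [set w | (1 + n.+1%:R^-1)%:E <= f w].
  have GE n : G (E n).
    rewrite (_ : E n = f @^-1` `[(1 + n.+1%:R^-1)%:E, +oo]).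
      by apply: (gmeas_preimage hG mf); exact: emeasurable_itv.
    by apply/seteqP; split => w /=; rewrite /E/= in_itv/= leey andbT.
  have PE n : P (E n) = 0.
    have mE := complete_sub_measurable hG (GE n).
    have PEfin : P (E n) \is a fin_num by rewrite fin_num_measure.
    have h : (1 + n.+1%:R^-1)%:E * P (E n) <= P (E n).
      rewrite -integral_cst// (@le_trans _ _ (\int[P]_(w in E n) f w))//.
        apply: ge0_le_integral => //.
        - by move=> w _; rewrite lee_fin addr_ge0.
        - exact: measurable_funTS.
      rewrite fE'// le_measure ?inE//.
      exact: measurableI.
    move: h; rewrite -(fineK PEfin) -EFinM lee_fin mulrDl mul1r gerDl => h.
    apply/eqP; rewrite eqe eq_le fine_ge0// andbT.
    by rewrite pmulr_rle0 in h.
  apply: (@negligibleS _ _ _ P (\bigcup_n E n)).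
    move=> w /= /negP; rewrite -ltNge => fw.
    have [fy|fy] := eqVneq (f w) +oo; first by exists 0%N => //; rewrite /E/= fy leey.
    have ffin : f w \is a fin_num by rewrite ge0_fin_numE// ltey.
    have /ltr_add_invr[n hn] : (1 < fine (f w))%R by rewrite -lte_fin fineK.
    by exists n => //; rewrite /E/= -(fineK ffin) lee_fin ltW.
  apply: negligible_bigcup => n; apply/negligibleP; last exact: PE.
  exact: (complete_sub_measurable hG).
have cfin w : mine (f w) 1 \is a fin_num.
  by rewrite ge0_fin_numE ?le_min ?f0 ?lee01// gt_min ltry orbT.
have cE : EFin \o (fun w => fine (mine (f w) 1)) = (fun w => mine (f w) 1).
  by apply/funext => w /=; rewrite fineK.
exists (fun w => fine (mine (f w) 1)); split.
- rewrite cE; apply: (@measurable_mine _ (g_sigma_algebraType G)) => //.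
- by move=> w; rewrite -!lee_fin fineK// le_min f0 lee01 ge_min lexx orbT.
move=> A GA; rewrite -fE'//.
have mA := complete_sub_measurable hG GA.
under eq_integral do rewrite fineK//.
apply: ae_eq_integral => //.
- by apply: measurable_funTS; exact: measurable_mine.
- exact: measurable_funTS.
- by apply: filterS f1 => w fw _; rewrite min_l.
Qed.

End conditional_probability.

Section staircase.
Context {R : realType}.

(** For x >= 0 this is the minimum of n and the integer part of x, written as a sum of indicators of
    superlevel sets. After rescaling, it approximates a bounded function from below by simple
    functions, with an error equal to the step. *)
Definition staircase (n : nat) (x : R) : R := \sum_(k < n) (k.+1%:R <= x)%R%:R.

Lemma staircaseS n x : staircase n.+1 x = staircase n x + (n.+1%:R <= x)%R%:R.
Proof. by rewrite /staircase big_ord_recr. Qed.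

Lemma staircase_ge0 n x : 0 <= staircase n x.
Proof. by apply: sumr_ge0 => k _; rewrite ler0n. Qed.

Lemma staircase_eq n x : n%:R <= x -> staircase n x = n%:R.
Proof.
elim: n => [|n ih] nx; first by rewrite /staircase big_ord0.
by rewrite staircaseS nx ih ?(le_trans _ nx) ?ler_nat// -natr1.
Qed.

Lemma staircase_le n x : 0 <= x -> staircase n x <= x.
Proof.
move=> x0; elim: n => [|n ih]; first by rewrite /staircase big_ord0.
rewrite staircaseS; have [nx|nx] := leP n.+1%:R x; last by rewrite addr0.
have nx' : n%:R <= x by rewrite (le_trans _ nx)// ler_nat.
by rewrite (staircase_eq nx') natr1.
Qed.

Lemma staircase_ge n x : x <= n%:R -> x <= staircase n x + 1.
Proof.
elim: n => [|n ih] nx; first by rewrite /staircase big_ord0 add0r (le_trans nx).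
rewrite staircaseS; have [xn|xn] := leP x n%:R.
  by rewrite (le_trans (ih xn))// lerD2r lerDl ler0n.
by rewrite (staircase_eq (ltW xn)) (le_trans nx)// -natr1 lerD2r lerDl ler0n.
Qed.

End staircase.

Section conditional_expectation.
Context {R : realType} {d : measure_display} {Omega : measurableType d}.
Variable P : probability Omega R.
Hypothesis hP : complete_sub P d.-measurable.
Local Open Scope ereal_scope.

Lemma integral_enorm_eq0_ae (V : lmodType R) (N : V -> \bar R) (f : Omega -> V) :
  enorm N -> strongly_measurable P N d.-measurable f ->
  \int[P]_w N (f w) = 0 -> {ae P, forall w, N (f w) = 0}.
Proof.
move=> hN sf f0; have mf := sm_measurable hN hP sf.
have : ae_eq P setT (N \o f) (cst 0).
  apply/(ae_eq_integral_abs P measurableT mf); rewrite -[RHS]f0.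
  by apply: eq_integral => w _; rewrite /= gee0_abs// (enorm_ge0 hN).
by apply: filterS => w /(_ I).
Qed.

Section one_space.
Variables (V : lmodType R) (N : V -> \bar R).
Hypothesis hN : enorm N.
Variable G : set (set Omega).
Hypothesis hG : complete_sub P G.
Implicit Types (Z W : Omega -> V) (g : @simple_rep R _ Omega V).
Local Notation condexps := (is_condexp P N G).

Let Gd : G `<=` d.-measurable. Proof. exact: (complete_sub_measurable hG). Qed.

Lemma condexp_sm Z W : condexps Z W -> strongly_measurable P N d.-measurable Z.
Proof.
move=> [_ _ h]; have [v hv _] := h _ (complete_subT hG).
exact: is_bochner_sm hv.
Qed.

Lemma condexp_smG Z W : condexps Z W -> strongly_measurable P N G W.
Proof. by case. Qed.

Lemma condexp_smr Z W : condexps Z W -> strongly_measurable P N d.-measurable W.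
Proof. by move=> /condexp_smG; exact: sm_subset. Qed.

Lemma condexp_self W : ecomplete N -> strongly_measurable P N G W ->
  \int[P]_w N (W w) < +oo -> condexps W W.
Proof.
move=> cN sW Wy; split => // A /Gd mA.
have [|v hv] := is_bochner_exists hP hN cN mA _ Wy; first exact: sm_subset sW.
by exists v.
Qed.

(** [W] is approximated by a [G]-simple function. On a piece B where that function is a constant v,
    the norm of P(B) v exceeds the norm of the integral of [W] over B by at most the approximation
    error, and this integral equals that of [Z]. Summing over the pieces needs no convexity
    inequality. *)
Lemma condexp_integral_le Z W A : condexps Z W -> G A ->
  \int[P]_(w in A) N (W w) <= \int[P]_(w in A) N (Z w).
Proof.
move=> hZW GA; have sZ := condexp_sm hZW; have sW := condexp_smr hZW.
have mA := Gd GA; move: (hZW) => [sWG Wy hb].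
have mN f : strongly_measurable P N d.-measurable f -> measurable_fun setT (N \o f).
  exact: (sm_measurable hN hP).
have I0 f B : 0 <= \int[P]_(w in B) N (f w).
  by apply: integral_ge0 => w _; exact: (enorm_ge0 hN).
pose Q B (f : Omega -> V) (_ : V) :=
  measurable_fun B (fun w => N (f w)) -> measurable_fun B (fun w => N (W w - f w)%R) ->
  \int[P]_(w in B) N (f w) <=
  \int[P]_(w in B) N (Z w) + \int[P]_(w in B) N (W w - f w)%R.
have key g : simple_in N G g -> \int[P]_(w in A) N (simple_fun g w) <=
    \int[P]_(w in A) N (Z w) + \int[P]_(w in A) N (W w - simple_fun g w)%R.
  move=> hg; have N0 : N 0%R < +oo by rewrite (enorm0 hN) ltry.
  have sg : strongly_measurable P N d.-measurable (simple_fun g).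
    by apply: (sm_simple P hN) => i /hg[/Gd].
  have hQ := @simple_ind _ _ _ P _ N hN G Q hG _ _ _ g hg A 0%R GA N0.
  have E : (fun w => 0 + simple_fun g w)%R = simple_fun g by apply/funext => w; rewrite add0r.
  rewrite E /Q in hQ; apply: hQ; last 2 first.
  - by apply: measurable_funTS; exact: mN.
  - by apply: measurable_funTS; apply: (mN (fun w => W w - simple_fun g w)%R); exact: smB.
  - move=> B v GB vy _ _; have mB := Gd GB.
    rewrite (integral_cst_fine _ hN)//; have [x hZ hW] := hb _ GB.
    have hv := is_bochner_cst P hN mB vy.
    rewrite (le_trans (enorm_leDB hN _ x))// addeC leeD//.
      by rewrite (enorm_subC hN); exact: (is_bochner_dist hP hN mB hW hv).
    exact: (is_bochner_le hP hN mB hZ).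
  - move=> B D f _ _ GB GD h1 h2 mf mWf; have [mB mD] := (Gd GB, Gd GD).
    rewrite (integral_split P mB mD mf); last by move=> w; exact: (enorm_ge0 hN).
    rewrite (integral_split P mB mD mWf); last by move=> w; exact: (enorm_ge0 hN).
    rewrite (integral_split P mB mD (measurable_funTS (mN _ sZ))); last first.
      by move=> w; exact: (enorm_ge0 hN).
    rewrite addeACA leeD// ?h1 ?h2//; (apply: measurable_funS mf || apply: measurable_funS mWf) => //;
      exact: subIsetl.
  - move=> B f f' _ GB ff' h mf' mWf'.
    have mf : measurable_fun B (fun w => N (f w)).
      by apply: eq_measurable_fun mf' => w /set_mem Bw; rewrite ff'.
    have mWf : measurable_fun B (fun w => N (W w - f w)%R).
      by apply: eq_measurable_fun mWf' => w /set_mem Bw; rewrite ff'.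
    have -> : \int[P]_(w in B) N (f' w) = \int[P]_(w in B) N (f w).
      by apply: eq_integral => w /set_mem Bw; rewrite ff'.
    have -> : \int[P]_(w in B) N (W w - f' w)%R = \int[P]_(w in B) N (W w - f w)%R.
      by apply: eq_integral => w /set_mem Bw; rewrite ff'.
    exact: h.
have [|g hg [_ g0]] := sm_Lp_approx hN hG (lexx 1%R) sWG; first by rewrite Lpnorm1E.
apply/lee_addgt0Pr => e e0; have e20 : (0 < e / 2)%R by rewrite divr_gt0.
move/cvge0P : g0 => /(_ (fun=> Lpnorm_ge0 _ _ _ _) _ e20)[n _ /(_ n (leqnn n))].
rewrite /= Lpnorm1E// => hn; set e' := \int[P]_w _ in hn.
have sg : strongly_measurable P N d.-measurable (simple_fun (g n)).
  by apply: (sm_simple P hN) => i /(hg n i)[/Gd].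
have hn' : \int[P]_(w in A) N (W w - simple_fun (g n) w)%R <= (e / 2)%:E.
  rewrite (le_trans _ hn)//; apply: (integral_subset_le hP hN) => //; exact: smB.
apply: (@le_trans _ _ (\int[P]_(w in A) N (W w - simple_fun (g n) w)%R +
    \int[P]_(w in A) N (simple_fun (g n) w))).
  apply: (le_integral_enorm hP hN) => //; first exact: smB.
  by move=> w _; exact: enorm_leDB.
rewrite (le_trans (leeD hn' (le_trans (key _ (hg n)) (leeD (lexx _) hn'))))//.
by rewrite addeCA -EFinD -splitr.
Qed.

Lemma condexp_ae Z Z' W W' : {ae P, forall w, N (Z w - Z' w)%R = 0} ->
  {ae P, forall w, N (W w - W' w)%R = 0} -> condexps Z W -> condexps Z' W'.
Proof.
move=> ZZ' WW' hZW; have [sWG Wy hb] := hZW; split.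
- exact: sm_ae WW' sWG.
- rewrite -Lpnorm1E// -(eq_Lpnorm_ae hP hN (lexx 1) _ WW') ?Lpnorm1E//.
  exact: condexp_smr hZW.
- move=> A GA; have [v hZ hW] := hb _ GA; exists v.
    exact: (is_bochner_ae hP hN (Gd GA) ZZ').
  exact: (is_bochner_ae hP hN (Gd GA) WW').
Qed.

Lemma condexp_eq_norm Z Z' W : {ae P, forall w, N (Z w - Z' w)%R = 0} ->
  condexps Z W -> condexps Z' W.
Proof.
move=> ZZ'; apply: condexp_ae => //.
by apply: aeW => w; rewrite subrr (enorm0 hN).
Qed.

Lemma condexpD Z Z' W W' : condexps Z W -> condexps Z' W' ->
  condexps (fun w => Z w + Z' w)%R (fun w => W w + W' w)%R.
Proof.
move=> h h'; have sW := condexp_smr h; have sW' := condexp_smr h'.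
move: h h' => [sWG Wy hb] [sWG' Wy' hb']; split.
- exact: smD.
- rewrite -Lpnorm1E// (le_lt_trans (LpnormD hP hN _ sW sW'))//.
  by rewrite !Lpnorm1E// lte_add_pinfty.
- move=> A GA; have [v hZ hW] := hb _ GA; have [v' hZ' hW'] := hb' _ GA.
  by exists (v + v')%R; apply: (is_bochnerD hP hN (Gd GA)).
Qed.

Lemma condexpZ Z W (a : R) : condexps Z W ->
  condexps (fun w => a *: Z w)%R (fun w => a *: W w)%R.
Proof.
move=> h; have sW := condexp_smr h; move: h => [sWG Wy hb]; split.
- exact: smZ.
- under eq_integral do rewrite (enormZ hN).
  rewrite ge0_integralZl_EFin//; last 2 first.
  + by move=> w _; exact: (enorm_ge0 hN).
  + exact: (sm_measurable hN hP sW).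
  rewrite lte_mul_pinfty//; apply: integral_ge0 => w _; exact: (enorm_ge0 hN).
- move=> A GA; have [v hZ hW] := hb _ GA.
  by exists (a *: v)%R; apply: (is_bochnerZ hP hN _ (Gd GA)).
Qed.

Lemma condexpB Z Z' W W' : condexps Z W -> condexps Z' W' ->
  condexps (fun w => Z w - Z' w)%R (fun w => W w - W' w)%R.
Proof.
move=> h /(condexpZ (-1)) h'.
under eq_fun do rewrite -scaleN1r; under [X in condexps _ X]eq_fun do rewrite -scaleN1r.
exact: condexpD.
Qed.

Lemma condexp_dist Z Z' W W' : condexps Z W -> condexps Z' W' ->
  \int[P]_w N (W w - W' w)%R <= \int[P]_w N (Z w - Z' w)%R.
Proof.
by move=> h h'; apply: condexp_integral_le (complete_subT hG); exact: condexpB.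
Qed.

(** The L^1 contraction compares [W] and [W'] as conditional expectations of one and the same
    [Z]. *)
Lemma condexp_unique Z W W' : condexps Z W -> condexps Z W' ->
  {ae P, forall w, N (W w - W' w)%R = 0}.
Proof.
move=> h h'; apply: integral_enorm_eq0_ae => //.
  by apply: smB => //; [exact: condexp_smr h|exact: condexp_smr h'].
apply/eqP; rewrite eq_le (le_trans (condexp_dist h h'))/=.
  by apply: integral_ge0 => w _; exact: (enorm_ge0 hN).
by under eq_integral do rewrite subrr (enorm0 hN); rewrite integral0.
Qed.

(** Testing the truncated functions on [A] amounts to testing the original ones on [A] intersected
    with [D], which is again in [G]. *)
Lemma condexp_indic Z W D : G D -> condexps Z W ->
  condexps (fun w => (\1_D w : R) *: Z w)%R (fun w => (\1_D w : R) *: W w)%R.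
Proof.
move=> GD h; have sW := condexp_smr h; have mD := Gd GD.
move: h => [[g hg gW] Wy hb].
have le1 w v : N ((\1_D w : R) *: v)%R <= N v.
  rewrite (enormZ hN) indicE; case: (_ \in _); first by rewrite normr1 mul1e.
  by rewrite normr0 mul0e (enorm_ge0 hN).
have sDW : strongly_measurable P N G (fun w => (\1_D w : R) *: W w)%R.
  exists (fun n => simple_restrict D (g n)).
    by move=> n; apply: simple_in_restrict (hg n) => B; exact: (complete_subI hG).
  apply: filterS gW => w gW; apply: (squeeze_cvge0 _ _ gW).
    by move=> n; exact: (enorm_ge0 hN).
  by apply: nearW => n; rewrite simple_fun_restrict -scalerBr.
split => //.
- rewrite (le_lt_trans _ Wy)//; apply: ge0_le_integral => //.
  + by move=> w _; exact: (enorm_ge0 hN).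
  + by apply: (sm_measurable hN hG sDW).
  + exact: (sm_measurable hN hP sW).
- move=> A GA; have [v hZ hW] := hb _ (complete_subI hG GA GD).
  by exists v; apply: (is_bochner_restrict hN (Gd GA) mD).
Qed.

(** The Bochner integrals of [Z] and [W] over [A] differ by at most the sum of the two L^1 errors,
    so the defining identity passes to the limit. *)
Lemma condexp_lim (Z_ W_ : nat -> Omega -> V) Z W : ecomplete N ->
  (forall n, condexps (Z_ n) (W_ n)) ->
  strongly_measurable P N d.-measurable Z -> \int[P]_w N (Z w) < +oo ->
  strongly_measurable P N G W -> \int[P]_w N (W w) < +oo ->
  \int[P]_w N (Z_ n w - Z w)%R @[n --> \oo] --> 0 ->
  \int[P]_w N (W_ n w - W w)%R @[n --> \oo] --> 0 -> condexps Z W.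
Proof.
move=> cN hn sZ Zy sWG Wy Z0 W0; split => // A GA; have mA := Gd GA.
have sW : strongly_measurable P N d.-measurable W by exact: sm_subset sWG.
have [z hz] := is_bochner_exists hP hN cN mA sZ Zy.
have [w hw] := is_bochner_exists hP hN cN mA sW Wy.
exists z => //; apply: (is_bochner_eq0 hN _ hw).
have I0 (f : Omega -> V) : 0 <= \int[P]_x N (f x).
  by apply: integral_ge0 => x _; exact: (enorm_ge0 hN).
apply/eqP; rewrite eq_le (enorm_ge0 hN) andbT; apply/lee_addgt0Pr => e e0; rewrite add0e.
have ZW0 : \int[P]_x N (Z_ n x - Z x)%R + \int[P]_x N (W_ n x - W x)%R @[n --> \oo] --> 0.
  by apply: cvge0D.
have ZW0' n : 0 <= \int[P]_x N (Z_ n x - Z x)%R + \int[P]_x N (W_ n x - W x)%R.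
  by rewrite adde_ge0.
move/cvge0P : ZW0 => /(_ ZW0' _ e0) [n _ /(_ n (leqnn n)) hZW].
have sZn := condexp_sm (hn n); have sWn := condexp_smr (hn n).
have [_ _ /(_ _ GA)[v hZv hWv]] := hn n.
rewrite (le_trans (enorm_triangle hN v _ _))// (le_trans _ hZW)// addeC leeD//.
- rewrite (enorm_subC hN) (le_trans (is_bochner_dist hP hN mA hWv hw))//.
  by apply: (integral_subset_le hP hN) => //; exact: smB.
- rewrite (le_trans (is_bochner_dist hP hN mA hZv hz))//.
  by apply: (integral_subset_le hP hN) => //; exact: smB.
Qed.

End one_space.
End conditional_expectation.

(** * Existence of conditional expectations by rapid L^1 approximation *)

Section dyadic.
Variable R : realType.

(** Written as a quotient to match the terms of [cvg_geometric_eseries_half], by which these numbers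
    sum to 1. *)
Definition dyadic (n : nat) : R := 1 / (2 ^ (n + 1))%:R.

Lemma dyadic_gt0 n : 0 < dyadic n.
Proof. by rewrite divr_gt0// ltr0n expn_gt0. Qed.

Lemma dyadicS_le n : dyadic n.+1 <= dyadic n.
Proof.
rewrite /dyadic ler_pM2l// lef_pV2 ?posrE ?ltr0n ?expn_gt0//.
by rewrite ler_nat leq_exp2l// addSn.
Qed.

Lemma dyadic_cvg0 : ((dyadic n)%:E @[n --> \oo] --> 0)%E.
Proof.
apply: cvg_EFin; first exact: nearW.
have -> : fine \o (fun n => (dyadic n)%:E) = geometric 2^-1 2^-1.
  by apply/funext => n; rewrite /dyadic/= natrX addn1 exprS invfM mul1r exprVn.
by apply: cvg_geometric; rewrite ger0_norm ?invr_ge0// invf_lt1// ltr1n.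
Qed.

End dyadic.

Section existence.
Context {R : realType} {d : measure_display} {Omega : measurableType d}.
Variable P : probability Omega R.
Hypothesis hP : complete_sub P d.-measurable.
Local Open Scope ereal_scope.

Section one_space.
Variables (V : lmodType R) (N : V -> \bar R).
Hypotheses (hN : enorm N) (cN : ecomplete N).
Local Notation sm := (strongly_measurable P N d.-measurable).

Let sum_dyadic : \sum_(0 <= n <oo) (dyadic R n)%:E = 1.
Proof.
have := @cvg_geometric_eseries_half R 1%R 0%N.
by rewrite expr0 divr1 => /cvg_lim; exact.
Qed.

(** The argument of Riesz and Fischer: the increments have a finite sum of integrals, so their
    series converges almost surely, and its sum dominates every distance to the limit. Where it
    diverges the limit is set to 0. *)
Lemma rapid_cauchy_lim (S : nat -> Omega -> V) (c : R) :
  (forall n, sm (S n)) -> (0 <= c)%R ->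
  (forall n, \int[P]_w N (S n.+1 w - S n w)%R <= (c * dyadic R n)%:E) ->
  exists W, {ae P, forall w, N (W w - S n w)%R @[n --> \oo] --> 0} /\
    \int[P]_w N (W w - S n w)%R @[n --> \oo] --> 0.
Proof.
move=> sS c0 hS.
pose D n w := N (S n.+1 w - S n w)%R.
have D0 n w : 0 <= D n w by exact: (enorm_ge0 hN).
have mN f : sm f -> measurable_fun setT (N \o f) by exact: (sm_measurable hN hP).
have mD n : measurable_fun setT (D n) by apply: mN; exact: smB.
pose T n w := \sum_(n <= i <oo) D i w.
have T0 n w : 0 <= T n w by apply: nneseries_ge0 => i _ _; exact: D0.
have mT : measurable_fun setT (T 0%N).
  by apply: ge0_emeasurable_sum => // n w _ _; exact: D0.
have intT : \int[P]_w T 0%N w < +oo.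
  rewrite integral_nneseries//.
  apply: (@le_lt_trans _ _ (\sum_(0 <= n <oo) (c%:E * (dyadic R n)%:E))).
    apply: lee_nneseries => [n _ _|n _]; first exact: integral_ge0.
    by have := hS n; rewrite EFinM.
  rewrite nneseriesZl; first by rewrite sum_dyadic mule1 ltry.
  by move=> n _; rewrite lee_fin ltW// dyadic_gt0.
have Ty : {ae P, forall w, T 0%N w < +oo}.
  apply: (Lnorm_lty_ae (lexx 1) mT (T0 0%N)).
  by rewrite Lnorm1; under eq_integral do rewrite gee0_abs//.
have tail w : T 0%N w < +oo -> T n w @[n --> \oo] --> 0.
  by move=> Tw; apply: nneseries_tail_cvg => // k _; exact: D0.
have SST n k w : (n <= k)%N -> N (S k w - S n w)%R <= T n w.
  move=> nk; apply: (@le_trans _ _ (\sum_(n <= i < k) D i w)); last first.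
    by apply: nneseries_lim_ge => i _ _; exact: D0.
  elim: k nk => [|k ih]; first by rewrite leqn0 => /eqP ->; rewrite big_geq// subrr (enorm0 hN).
  rewrite leq_eqVlt => /predU1P[->|nk]; first by rewrite big_geq// subrr (enorm0 hN).
  rewrite big_nat_recr//= addeC (le_trans (enorm_triangle hN (S k w) _ _))// leeD2l//.
  exact: ih.
have [W hW] : exists W : Omega -> V, forall w, T 0%N w < +oo ->
    N (S n w - W w)%R @[n --> \oo] --> 0.
  have /choice[W hW] : forall w, exists v : V, T 0%N w < +oo ->
      N (S n w - v)%R @[n --> \oo] --> 0.
    move=> w; have [Tw|nTw] := pselect (T 0%N w < +oo); last by exists 0%R.
    have [v hv] : exists v, N (S n w - v)%R @[n --> \oo] --> 0.
      apply: cN => e e0; have e20 : (0 < e / 2)%R by rewrite divr_gt0.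
      move/cvge0P : (tail w Tw) => /(_ (T0 ^~ w) _ e20)[n0 _ /(_ n0 (leqnn n0)) h].
      exists n0 => n k n0n n0k.
      rewrite (le_trans (enorm_triangle hN (S n0 w) _ _))// (splitr e) EFinD leeD//.
        by rewrite (le_trans (SST _ _ _ n0n)).
      by rewrite (enorm_subC hN) (le_trans (SST _ _ _ n0k)).
    by exists v.
  by exists W.
have hW' : {ae P, forall w, N (W w - S n w)%R @[n --> \oo] --> 0}.
  apply: filterS Ty => w /hW; under eq_fun do rewrite (enorm_subC hN); exact.
have WT w n : T 0%N w < +oo -> N (W w - S n w)%R <= T 0%N w.
  move=> Tw; apply/lee_addgt0Pr => e e0.
  move/cvge0P : (hW w Tw) => /(_ (fun=> enorm_ge0 hN _) _ e0)[k _ hk].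
  have {}hk := hk (maxn k n) (leq_maxl _ _).
  rewrite (le_trans (enorm_triangle hN (S (maxn k n) w) _ _))// addeC leeD//; last first.
    by rewrite (enorm_subC hN).
  rewrite (le_trans (SST _ _ _ (leq_maxr k n)))//.
  rewrite /T [leRHS](@nneseries_split _ _ 0 n) ?add0n ?leeDr//.
    by apply: sume_ge0 => i _; exact: D0.
(* [W] is only a pointwise choice of limits; the measurability of its distance to [S n] comes from
   the distances between [S k] and [S n], of which it is an almost sure limit. *)
have mWS n : measurable_fun setT (fun w => N (W w - S n w)%R).
  apply: (gmeas_measurable hP); apply: (gmeas_lim hP (h_ := fun k w => N (S k w - S n w)%R)).
    by move=> k; apply: gmeas_all; apply: mN; exact: smB.
  apply: filterS2 Ty (filterI (ae_foralln (fun k => sm_lty hN (sS k))) hW') => w Tw [Sy hw].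
  apply: enorm_cvg => //; first by move=> k; exact: (enormB_lty hN).
  under eq_fun do rewrite opprB addrA subrK (enorm_subC hN); exact: hw.
exists W; split => //.
under eq_fun do under eq_integral do rewrite -(gee0_abs (enorm_ge0 hN _)).
under eq_fun do rewrite -(@Lnorm1 _ _ _ P (fun w => N (W w - S _ w)%R)).
apply: (dominated_Lnorm_cvg0 (k := T 0%N)) => //.
- by move=> n w; exact: (enorm_ge0 hN).
- by apply: filterS Ty => w Tw n; exact: WT.
- by rewrite Lnorm1; under eq_integral do rewrite gee0_abs//.
Qed.

End one_space.
End existence.

Lemma indic_pred (R : realType) (T : Type) (p : pred T) w :
  \1_[set w | p w] w = (p w)%:R :> R.
Proof.
rewrite indicE; suff -> : (w \in [set w | p w]) = p w by [].
by apply/idP/idP => [/set_mem|?]; last exact/mem_set.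
Qed.

Section condexp_existence.
Context {R : realType} {d : measure_display} {Omega : measurableType d}.
Variable P : probability Omega R.
Hypothesis hP : complete_sub P d.-measurable.
Local Open Scope ereal_scope.

Variable G : set (set Omega).
Hypothesis hG : complete_sub P G.

Let Gd : G `<=` d.-measurable. Proof. exact: (complete_sub_measurable hG). Qed.

Section one_space.
Variables (V : lmodType R) (N : V -> \bar R).
Hypothesis hN : enorm N.
Local Notation sm := (strongly_measurable P N d.-measurable).
Local Notation condexps := (is_condexp P N G).

(** [c] is not simple, so [c w *: v] has to be exhibited as a limit of [G]-simple functions. The
    staircase of step 1/(n+1) lies below [c] within that step; the pointwise error, its integral and
    the error of the integrals are all at most N v / (n+1). *)
Lemma condexp_condprob B c v : measurable B -> is_condprob P G B c -> N v < +oo ->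
  condexps (fun w => (\1_B w : R) *: v)%R (fun w => c w *: v)%R.
Proof.
move=> mB [mc c01 cB] vy.
pose E (J k : nat) := [set w | (k.+1%:R <= J%:R * c w)%R].
pose st (J : nat) w := (J%:R^-1 * staircase J (J%:R * c w))%R.
have c0 w : (0 <= c w)%R by have /andP[] := c01 w.
have c1 w : (c w <= 1)%R by have /andP[] := c01 w.
have mc' : measurable_fun setT (EFin \o c) by exact: (gmeas_measurable hG mc).
have st_le n w : (st n.+1 w <= c w)%R.
  rewrite /st -(@mulKf R n.+1%:R _ (c w)) ?pnatr_eq0// ler_wpM2l ?invr_ge0//.
  by rewrite mulKf ?pnatr_eq0// staircase_le// mulr_ge0.
have st_ge n w : (c w <= st n.+1 w + n.+1%:R^-1)%R.
  rewrite /st -{1}(@mulKf R n.+1%:R _ (c w)) ?pnatr_eq0// -[X in (_ <= _ + X)%R]mulr1 -mulrDr.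
  by rewrite ler_wpM2l ?invr_ge0// staircase_ge// ler_piMr.
have st0 n w : (0 <= st n w)%R by rewrite mulr_ge0 ?invr_ge0// staircase_ge0.
have GE J k : G (E J k).
  have -> : E J k = (EFin \o c) @^-1` [set x | (k.+1%:R)%:E <= J%:R%:E * x].
    by apply/seteqP; split => w; rewrite /E/= -EFinM lee_fin.
  apply: (gmeas_preimage hG mc); rewrite -[X in measurable X]setTI.
  by apply: measurable_lee => //; exact: measurable_funeM.
pose g (n : nat) : @simple_rep R _ Omega V :=
  [seq (E n.+1 k, (n.+1%:R^-1 *: v)%R) | k <- [seq nat_of_ord k | k <- index_enum 'I_n.+1]].
have hg n : simple_in N G (g n).
  rewrite /g; elim: [seq nat_of_ord k | k <- _] => // k s ih.
  by apply/simple_in_cons; split; [exact: GE|exact: (enormZ_lty hN)|].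
have gE n w : simple_fun (g n) w = (st n.+1 w *: v)%R.
  rewrite /simple_fun /g big_map big_map/=.
  under eq_bigr do rewrite scalerA mulrC.
  rewrite -scaler_suml -mulr_sumr /st /staircase; congr (_ * _ *: _)%R.
  by apply: eq_bigr => k _; rewrite indic_pred.
have inv0 : (n.+1%:R^-1 : R)%:E @[n --> \oo] --> 0.
  by apply: cvg_EFin; [exact: nearW|exact: cvg_harmonic].
have vfin := enorm_fin_num hN vy.
have inv0v : (n.+1%:R^-1 : R)%:E * N v @[n --> \oo] --> 0 by exact: cvge0Zr.
have dist n w : N (c w *: v - simple_fun (g n) w)%R <= (n.+1%:R^-1 : R)%:E * N v.
  rewrite gE -scalerBl (enormZ hN) lee_wpmul2r ?(enorm_ge0 hN)// lee_fin.
  have := st_le n w; have := st_ge n w => h1 h2.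
  by rewrite ger0_norm ?subr_ge0// lerBlDl.
have gc : ae_approx P N g (fun w => c w *: v)%R.
  apply: aeW => w; apply: (squeeze_cvge0 _ _ inv0v); first by move=> n; exact: (enorm_ge0 hN).
  exact: nearW.
have sW : strongly_measurable P N G (fun w => c w *: v)%R by exists g.
have hgd n : simple_in N d.-measurable (g n) by move=> i /(hg n i)[/Gd].
split => //.
- apply: (@le_lt_trans _ _ (\int[P]_w (cst (N v) w))); last first.
    by rewrite integral_cst// [X in _ * X](probability_setT P) mule1.
  apply: ge0_le_integral => //.
  + by move=> w _; exact: (enorm_ge0 hN).
  + exact: (sm_measurable hN hG sW).
  + move=> w _; rewrite (enormZ hN) ger0_norm// -[leRHS]mul1e.
    by rewrite lee_wpmul2r ?(enorm_ge0 hN)// lee_fin.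
move=> A GA; have mA := Gd GA; have mAB : measurable (A `&` B) by exact: measurableI.
exists (fine (P (A `&` B)) *: v)%R.
  by apply: (is_bochner_restrict hN mA mB); exact: is_bochner_cst.
exists g; split => //.
- apply: (squeeze_cvge0 _ _ inv0v).
    by move=> n; apply: integral_ge0 => w _; exact: (enorm_ge0 hN).
  apply: nearW => n; set b := _ * N v.
  have b0 : 0 <= b by rewrite mule_ge0 ?(enorm_ge0 hN)// lee_fin invr_ge0.
  apply: (@le_trans _ _ (\int[P]_(w in A) cst b w)).
    apply: ge0_le_integral => //; first by move=> w _; exact: (enorm_ge0 hN).
    apply: measurable_funTS; apply: (sm_measurable hN hG).
    exact: (smB hN sW (sm_simple P hN (hg n))).
  rewrite integral_cst// -[leRHS]mule1 lee_wpmul2l//.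
  exact: probability_le1.
- apply: (squeeze_cvge0 _ _ inv0v); first by move=> n; exact: (enorm_ge0 hN).
  apply: nearW => n.
  have -> : simple_integral P A (g n) =
      (fine (\int[P]_(w in A) (st n.+1 w)%:E) *: v)%R.
    rewrite /simple_integral /g big_map big_map/=.
    under eq_bigr do rewrite scalerA mulrC.
    rewrite -scaler_suml -mulr_sumr; congr (_ *: _)%R.
    rewrite /st /staircase.
    under [in RHS]eq_integral do rewrite EFinM -sumEFin.
    rewrite ge0_integralZl_EFin//; last 2 first.
    + by move=> w _; apply: sume_ge0 => k _; rewrite lee_fin ler0n.
    + apply: emeasurable_sum => k; apply: measurable_funTS.
      rewrite (_ : (fun _ => _) = EFin \o \1_(E n.+1 k)).
        by apply: measurableT_comp => //; exact: measurable_indic (Gd (GE _ _)).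
      by apply/funext => w /=; rewrite indic_pred.
    rewrite ge0_integral_sum//; last first.
    + move=> k; apply: measurable_funTS.
      rewrite (_ : (fun _ => _) = EFin \o \1_(E n.+1 k)).
        by apply: measurableT_comp => //; exact: measurable_indic (Gd (GE _ _)).
      by apply/funext => w /=; rewrite indic_pred.
    have IE (k : 'I_n.+1) : \int[P]_(w in A) ((k.+1%:R <= n.+1%:R * c w)%R%:R : R)%:E = P (A `&` E n.+1 k).
      rewrite setIC -(integral_indic P mA (Gd (GE _ _))).
      by apply: eq_integral => w _; rewrite indic_pred.
    under [in RHS]eq_bigr do rewrite IE.
    have Pfin (k : 'I_n.+1) : P (A `&` E n.+1 k) \is a fin_num.
      by rewrite fin_num_measure//; apply: measurableI => //; exact: Gd.
    have -> : \sum_(k < n.+1) P (A `&` E n.+1 k) = (\sum_(k < n.+1) fine (P (A `&` E n.+1 k)))%R%:E.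
      by rewrite -sumEFin; apply: eq_bigr => k _; rewrite fineK.
    by rewrite -EFinM.
  have mst : measurable_fun A (fun w => (st n.+1 w)%:E).
    have -> : (fun w => (st n.+1 w)%:E) =
        (fun w => (n.+1%:R^-1)%:E * \sum_(k < n.+1) (\1_(E n.+1 k) w)%:E).
      apply/funext => w; rewrite /st /staircase EFinM -sumEFin; congr (_ * _).
      by apply: eq_bigr => k _; rewrite indic_pred.
    apply: measurable_funeM; apply: emeasurable_sum => k; apply: measurable_funTS.
    by apply: measurableT_comp => //; exact: measurable_indic (Gd (GE _ _)).
  have ABfin : P (A `&` B) \is a fin_num by rewrite fin_num_measure.
  set I := \int[P]_(w in A) _.
  have I_le : I <= P (A `&` B).
    rewrite -cB//; apply: ge0_le_integral => //.
    - by move=> w _; rewrite lee_fin.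
    - exact: measurable_funTS.
    - by move=> w _; rewrite lee_fin.
  have I0 : 0 <= I by apply: integral_ge0 => w _; rewrite lee_fin.
  have Ifin : I \is a fin_num by rewrite ge0_fin_numE// (le_lt_trans I_le)// ltey_eq ABfin.
  have I_ge : P (A `&` B) <= I + (n.+1%:R^-1)%:E.
    apply: (@le_trans _ _ (\int[P]_(w in A) ((st n.+1 w)%:E + cst (n.+1%:R^-1)%:E w))).
      rewrite -cB//; apply: ge0_le_integral => //.
      - by move=> w _; rewrite lee_fin.
      - exact: measurable_funTS.
      - by apply: emeasurable_funD.
      - by move=> w _; rewrite /= -EFinD lee_fin.
    rewrite ge0_integralD//; last 2 first.
    - by move=> w _; rewrite lee_fin.
    - by move=> w _; rewrite lee_fin invr_ge0.
    rewrite leeD2l// integral_cst// -[leRHS]mule1 lee_wpmul2l//.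
    exact: probability_le1.
  rewrite -scalerBl (enormZ hN) lee_wpmul2r ?(enorm_ge0 hN)// lee_fin distrC.
  rewrite ger0_norm; first by rewrite lerBlDl -lee_fin EFinD !fineK.
  by rewrite subr_ge0 -lee_fin !fineK.
Qed.

End one_space.
End condexp_existence.

Section condexp_existence.
Context {R : realType} {d : measure_display} {Omega : measurableType d}.
Variable P : probability Omega R.
Hypothesis hP : complete_sub P d.-measurable.
Local Open Scope ereal_scope.

Variable G : set (set Omega).
Hypothesis hG : complete_sub P G.

Let Gd : G `<=` d.-measurable. Proof. exact: (complete_sub_measurable hG). Qed.

Section one_space.
Variables (V : lmodType R) (N : V -> \bar R).
Hypothesis hN : enorm N.
Local Notation sm := (strongly_measurable P N d.-measurable).
Local Notation condexps := (is_condexp P N G).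

Let I0 A (f : Omega -> V) : 0 <= \int[P]_(w in A) N (f w).
Proof. by apply: integral_ge0 => w _; exact: (enorm_ge0 hN). Qed.

Lemma condexp_cst v : N v < +oo -> condexps (fun=> v) (fun=> v).
Proof.
move=> vy; split; first exact: sm_cst.
- by rewrite integral_cst// [X in _ * X](probability_setT P) mule1.
- by move=> A /Gd mA; exists (fine (P A) *: v)%R; exact: is_bochner_cst.
Qed.

Lemma condexp_simple_exists g : simple_in N d.-measurable g ->
  exists W, condexps (simple_fun g) W.
Proof.
elim: g => [_|b g ih /simple_in_cons[mb bty /ih[W hW]]].
  exists (fun=> 0%R); rewrite (_ : simple_fun [::] = fun=> 0%R).
    by apply: condexp_cst; rewrite (enorm0 hN) ltry.
  by apply/funext => w; rewrite simple_fun_nil.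
have [c hc] := condprob_exists hG mb.
exists (fun w => c w *: b.2 + W w)%R.
rewrite (_ : simple_fun (b :: g) = fun w => (\1_(b.1) w : R) *: b.2 + simple_fun g w)%R.
  by apply: (condexpD hP hN hG) => //; exact: condexp_condprob.
by apply/funext => w; rewrite simple_fun_cons.
Qed.

Lemma L1_simple_approx (G' : set (set Omega)) f (e : R) : complete_sub P G' ->
  strongly_measurable P N G' f -> \int[P]_w N (f w) < +oo -> (0 < e)%R ->
  exists2 g, simple_in N G' g & \int[P]_w N (f w - simple_fun g w)%R <= e%:E.
Proof.
move=> hG' sf fy e0; have [|g hg [_ g0]] := sm_Lp_approx hN hG' (lexx 1%R) sf.
  by rewrite Lpnorm1E.
move/cvge0P : g0 => /(_ (fun=> Lpnorm_ge0 _ _ _ _) _ e0)[n _ /(_ n (leqnn n))].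
by rewrite /= Lpnorm1E//; exists (g n).
Qed.

Lemma integral_triangle k f h : sm f -> sm h -> sm k ->
  \int[P]_w N (f w - h w)%R <=
  \int[P]_w N (f w - k w)%R + \int[P]_w N (k w - h w)%R.
Proof.
by move=> sf sh sk; rewrite -!Lpnorm1E//; apply: (Lpnorm_triangle hP hN).
Qed.

Lemma integral_subC f h : \int[P]_w N (f w - h w)%R = \int[P]_w N (h w - f w)%R.
Proof. by apply: eq_integral => w _; exact: enorm_subC. Qed.

(** Two approximations are interleaved: [Z] by simple functions, whose conditional expectations
    exist by linearity, and each of these by a [G]-simple function. The second makes the limit
    strongly [G]-measurable, being an almost sure limit of [G]-simple functions. *)
Lemma condexp_exists Z : ecomplete N -> sm Z -> \int[P]_w N (Z w) < +oo ->
  exists W, condexps Z W.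
Proof.
move=> cN sZ Zy; pose e n := dyadic R n.
have e0 n : (0 < e n)%R by exact: dyadic_gt0.
have /choice[Zn hZn] : forall n, exists g, simple_in N d.-measurable g /\
    \int[P]_w N (Z w - simple_fun g w)%R <= (e n)%:E.
  by move=> n; have [g ? ?] := L1_simple_approx hP sZ Zy (e0 n); exists g.
have /choice[Wn hWn] : forall n, exists W, condexps (simple_fun (Zn n)) W.
  by move=> n; have [hg _] := hZn n; exact: condexp_simple_exists.
have /choice[Sn hSn] : forall n, exists g, simple_in N G g /\
    \int[P]_w N (Wn n w - simple_fun g w)%R <= (e n)%:E.
  move=> n; have [sWG Wy _] := hWn n.
  by have [g ? ?] := L1_simple_approx hG sWG Wy (e0 n); exists g.
have sZn n : sm (simple_fun (Zn n)) by apply: sm_simple => //; case: (hZn n).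
have sSG n : strongly_measurable P N G (simple_fun (Sn n)) by apply: sm_simple => //; case: (hSn n).
have sS n : sm (simple_fun (Sn n)) by exact: sm_subset (sSG n).
have sWn n : sm (Wn n) by exact: (condexp_smr hG (hWn n)).
have [W [Wae W1]] : exists W,
    {ae P, forall w, N (W w - simple_fun (Sn n) w)%R @[n --> \oo] --> 0} /\
    \int[P]_w N (W w - simple_fun (Sn n) w)%R @[n --> \oo] --> 0.
  (* Going from [Sn n.+1] to [Sn n] through [Wn n.+1] and [Wn n] costs e(n+1), then e(n+1) + e(n) by
     contraction, then e(n): at most four times e(n). *)
  apply: (rapid_cauchy_lim hP hN cN (c := 4) sS) => // n.
  have [_ Zn1] := hZn n; have [_ Zn2] := hZn n.+1.
  have [_ Sn1] := hSn n; have [_ Sn2] := hSn n.+1.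
  have dle := dyadicS_le R n; rewrite -/(e n) -/(e n.+1) in dle *.
  have hW := condexp_dist hP hN hG (hWn n.+1) (hWn n).
  have hZ := integral_triangle (sZn n.+1) (sZn n) sZ.
  have h1 := integral_triangle (sS n.+1) (sS n) (sWn n.+1).
  have h2 := integral_triangle (sWn n.+1) (sS n) (sWn n).
  rewrite (le_trans h1)// (@le_trans _ _ ((e n.+1)%:E + ((e n.+1 + e n)%:E + (e n)%:E)))//.
    rewrite leeD//; first by rewrite integral_subC.
    rewrite (le_trans h2)// leeD// (le_trans hW)// (le_trans hZ)// EFinD leeD//.
    by rewrite integral_subC.
  by rewrite -!EFinD lee_fin; lra.
have sWG : strongly_measurable P N G W by exists Sn => // n; case: (hSn n).
have sW : sm W by exact: sm_subset sWG.
have Wy : \int[P]_w N (W w) < +oo.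
  move/cvge0P : W1 => /(_ (fun=> I0 _ _) _ ltr01)[n _ /(_ n (leqnn n)) h].
  rewrite -Lpnorm1E// (le_lt_trans (Lpnorm_leDB hP hN (lexx 1) sW (sS n)))// !Lpnorm1E//.
  rewrite lte_add_pinfty ?(le_lt_trans h) ?ltry//.
  rewrite -Lpnorm1E// (le_lt_trans (Lpnorm_leDB hP hN (lexx 1) (sS n) (sWn n)))//.
  rewrite !Lpnorm1E// lte_add_pinfty//; last by case: (hWn n).
  by rewrite integral_subC; have [_ /le_lt_trans] := hSn n; apply; rewrite ltry.
exists W; apply: (condexp_lim hP hN hG cN hWn sZ Zy sWG Wy).
- apply: (@squeeze_cvge0 _ _ _ _ _ (fun n => (e n)%:E)) => //; last exact: dyadic_cvg0.
  by apply: nearW => n; rewrite integral_subC; case: (hZn n).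
- apply: (@squeeze_cvge0 _ _ _ _ _ (fun n => (e n)%:E + \int[P]_w N (W w - simple_fun (Sn n) w)%R)) => //.
    apply: nearW => n; rewrite (le_trans (integral_triangle (sWn n) sW (sS n)))// leeD//.
      by case: (hSn n).
    by rewrite integral_subC.
  apply: cvge0D => //; last exact: dyadic_cvg0.
  by move=> n; rewrite lee_fin ltW.
Qed.

End one_space.

Section map.
Variables (V W : lmodType R) (NV : V -> \bar R) (NW : W -> \bar R).
Hypotheses (hV : enorm NV) (hW : enorm NW).

Lemma condexp_map (T : V -> W) (c : R) Z E : (0 <= c)%R ->
  linear_on [set v | NV v < +oo] T ->
  (forall v, NV v < +oo -> NW (T v) <= c%:E * NV v) ->
  is_condexp P NV G Z E -> is_condexp P NW G (T \o Z) (T \o E).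
Proof.
move=> c0 lT hT h; have sZ := condexp_sm hG h; have sE := condexp_smr hG h.
move: h => [sEG Ey hb].
have sTE : strongly_measurable P NW G (T \o E) by exact: (sm_map hV hW c0 lT hT sEG).
have sTE' : strongly_measurable P NW d.-measurable (T \o E) by exact: sm_subset sTE.
split => //.
- rewrite -Lpnorm1E// (@le_lt_trans _ _ (c%:E * Lpnorm P NV 1 E))//.
    apply: Lpnorm_leZ => //; apply: filterS (sm_lty hV sE) => w Ew.
    exact: hT.
  by rewrite Lpnorm1E// lte_mul_pinfty//; apply: integral_ge0 => w _; exact: (enorm_ge0 hV).
- move=> A GA; have [v hZ hE] := hb _ GA; exists (T v).
    apply: (is_bochner_map hP hV hW (Gd GA) lT c0 hT _ hZ).
    exact: (sm_map hV hW c0 lT hT sZ).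
  exact: (is_bochner_map hP hV hW (Gd GA) lT c0 hT _ hE).
Qed.

End map.

End condexp_existence.

(** * Pulling measurable factors out of a conditional expectation *)

Section condexp_properties.
Context {R : realType} {d : measure_display} {Omega : measurableType d}.
Variable P : probability Omega R.
Hypothesis hP : complete_sub P d.-measurable.
Local Open Scope ereal_scope.

Variable G : set (set Omega).
Hypothesis hG : complete_sub P G.

Let Gd : G `<=` d.-measurable. Proof. exact: (complete_sub_measurable hG). Qed.

Lemma condexp_norm_le (V : lmodType R) (N M : V -> \bar R) (c : R) Z W :
  enorm N -> enorm M -> (0 <= c)%R -> (forall v, M v <= c%:E * N v) ->
  is_condexp P N G Z W -> is_condexp P M G Z W.
Proof.
by move=> hN hM c0 h; apply: (condexp_map hP hG hN hM (T := id) c0) => // v _.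
Qed.

Section pull_out.
Variables (U V W : lmodType R).
Variables (NU : U -> \bar R) (NV : V -> \bar R) (NW : W -> \bar R).
Variable B : U -> V -> W.
Hypotheses (hU : enorm NU) (hV : enorm NV) (hW : enorm NW).
Hypothesis hB : pairing NU NV NW B.

Lemma condexp_pair_simple g Z E : simple_in NU G g -> is_condexp P NV G Z E ->
  is_condexp P NW G (fun w => B (simple_fun g w) (Z w)) (fun w => B (simple_fun g w) (E w)).
Proof.
move=> + h; have Zy := sm_lty hV (condexp_sm hG h).
have Ey := sm_lty hV (condexp_smr hG h).
elim: g => [_|b g ih /simple_in_cons[Gb bty hg]].
  have W0 : NW 0%R < +oo by rewrite (enorm0 hW) ltry.
  have B0 v : NV v < +oo -> NW (0 - B 0 v)%R = 0.
    move=> vy; rewrite (linear_on0 hU (pairing_linl hB vy)).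
    by rewrite subrr (enorm0 hW).
  apply: (condexp_ae hP hW hG _ _ (condexp_cst hG hW W0)).
  - apply: filterS Zy => w wy; rewrite simple_fun_nil; exact: B0.
  - apply: filterS Ey => w wy; rewrite simple_fun_nil; exact: B0.
have hb : is_condexp P NW G (B b.2 \o Z) (B b.2 \o E).
  apply: (condexp_map hP hG hV hW (c := fine (NU b.2)) _ (pairing_linr hB bty) _ h).
    by rewrite fine_ge0// (enorm_ge0 hU).
  by move=> v vy; rewrite (fineK (enorm_fin_num hU bty)); exact: (pairing_le hB).
have h2 := condexpD hP hW hG (condexp_indic hP hW hG Gb hb) (ih hg).
have Bc w v : NV v < +oo ->
    NW ((\1_(b.1) w : R) *: B b.2 v + B (simple_fun g w) v - B (simple_fun (b :: g) w) v)%R = 0.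
  move=> vy; rewrite simple_fun_cons (pairing_linl hB vy)//.
    by rewrite subrr (enorm0 hW).
  exact: simple_fun_lty hg.
apply: (condexp_ae hP hW hG _ _ h2).
- by apply: filterS Zy => w; exact: Bc.
- by apply: filterS Ey => w; exact: Bc.
Qed.

Lemma pair_simple_cvg (g : nat -> @simple_rep R _ Omega U) (u : Omega -> U) (v : Omega -> V) :
  (forall n, simple_in NU d.-measurable (g n)) ->
  strongly_measurable P NU d.-measurable u -> strongly_measurable P NV d.-measurable v ->
  ae_approx P NU g u ->
  (forall n w, NU (u w - simple_fun (g n) w)%R <= 3%:E * NU (u w)) ->
  \int[P]_w (NU (u w) * NV (v w)) < +oo ->
  \int[P]_w NW (B (simple_fun (g n) w) (v w) - B (u w) (v w))%R @[n --> \oo] --> 0.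
Proof.
move=> hg su sv gu gle uvy.
have sg n := sm_simple P hU (hg n).
have mu := sm_measurable hU hP su; have mv := sm_measurable hV hP sv.
have mug n : measurable_fun setT (fun w => NU (u w - simple_fun (g n) w)%R).
  by apply: (sm_measurable hU hP); exact: smB.
have sB f : strongly_measurable P NU d.-measurable f ->
    strongly_measurable P NW d.-measurable (fun w => B (f w) (v w)).
  by move=> sf; apply: sm_pair sf sv => //; exact: (complete_subI hP).
have h0 n w : 0 <= NU (u w - simple_fun (g n) w)%R * NV (v w).
  by rewrite mule_ge0 ?(enorm_ge0 hU) ?(enorm_ge0 hV).
have uv0 w : 0 <= NU (u w) * NV (v w).
  by rewrite mule_ge0 ?(enorm_ge0 hU) ?(enorm_ge0 hV).
apply: (@squeeze_cvge0 _ _ _ _ _ (fun n => \int[P]_w (NU (u w - simple_fun (g n) w)%R * NV (v w)))).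
- by move=> n; apply: integral_ge0 => w _; exact: (enorm_ge0 hW).
- apply: nearW => n; apply: ae_ge0_le_integral => //.
  + by move=> w _; exact: (enorm_ge0 hW).
  + by apply: (sm_measurable hW hP); apply: smB => //; exact: sB.
  + exact: emeasurable_funM.
  apply: filterS2 (sm_lty hU su) (sm_lty hV sv) => w uy vy _.
  have gy := simple_fun_lty w hU (hg n).
  rewrite (le_trans (pairingB_le hU hV hW hB _ _ _ _))//.
  by rewrite subrr (enorm0 hV) mule0 adde0 (enorm_subC hU).
- under eq_fun do under eq_integral do rewrite -(gee0_abs (h0 _ _)).
  under eq_fun do rewrite -(@Lnorm1 _ _ _ P (fun w => NU (u w - simple_fun (g _) w)%R * NV (v w))).
  apply: (dominated_Lnorm_cvg0 (k := fun w => 3%:E * (NU (u w) * NV (v w)))) => //.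
  + by move=> n; exact: emeasurable_funM.
  + by apply: measurable_funeM; exact: emeasurable_funM.
  + by move=> w; rewrite mule_ge0.
  + by apply: aeW => w n; rewrite muleA lee_wpmul2r// (enorm_ge0 hV).
  + rewrite Lnorm1; under eq_integral do rewrite gee0_abs ?mule_ge0 ?(enorm_ge0 hU) ?(enorm_ge0 hV)//.
    rewrite ge0_integralZl_EFin//; last exact: emeasurable_funM.
    by rewrite lte_mul_pinfty// integral_ge0.
  + apply: filterS2 gu (sm_lty hV sv) => w gw vy.
    by apply: cvge0Zr => //; exact: enorm_fin_num.
Qed.

(** The factor [u] may be unbounded: only the products of the norms need be integrable. Its simple
    approximants satisfy an error bound of [3 * NU (u w)], so dominated convergence applies to the
    products. This covers a factor in L^m against one in L^oo, in either order. *)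
Lemma condexp_pull_out (u : Omega -> U) Z E : ecomplete NW ->
  strongly_measurable P NU G u -> is_condexp P NV G Z E ->
  \int[P]_w (NU (u w) * NV (Z w)) < +oo ->
  \int[P]_w (NU (u w) * NV (E w)) < +oo ->
  is_condexp P NW G (fun w => B (u w) (Z w)) (fun w => B (u w) (E w)).
Proof.
move=> cW suG h uZy uEy.
have sZ := condexp_sm hG h; have sE := condexp_smr hG h; have sEG := condexp_smG h.
have su := sm_subset Gd suG.
have [g hg [gu gle]] := sm_dominated_approx hU hG suG.
have hgd n : simple_in NU d.-measurable (g n) by move=> i /(hg n i)[/Gd].
have By v : strongly_measurable P NV d.-measurable v ->
    \int[P]_w (NU (u w) * NV (v w)) < +oo -> \int[P]_w NW (B (u w) (v w)) < +oo.
  move=> sv; apply: le_lt_trans; apply: ae_ge0_le_integral => //.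
  - by move=> w _; exact: (enorm_ge0 hW).
  - apply: (sm_measurable hW hP); apply: sm_pair su sv => //; exact: (complete_subI hP).
  - by move=> w _; rewrite mule_ge0 ?(enorm_ge0 hU) ?(enorm_ge0 hV).
  - apply: emeasurable_funM; [exact: (sm_measurable hU hP)|exact: (sm_measurable hV hP)].
  apply: filterS2 (sm_lty hU su) (sm_lty hV sv) => w uy vy _.
  exact: (pairing_le hB).
apply: (condexp_lim hP hW hG cW (fun n => condexp_pair_simple (hg n) h)).
- exact: (sm_pair hU hV hW hB (complete_subI hP) su sZ).
- exact: (By _ sZ uZy).
- exact: (sm_pair hU hV hW hB (complete_subI hG) suG sEG).
- exact: (By _ sE uEy).
- exact: pair_simple_cvg.
- exact: pair_simple_cvg.
Qed.

End pull_out.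

(** In R^G Y_s the factor to be pulled out is the right one, so the pairing is read backwards. *)
Lemma pairing_flip (U V W : lmodType R) (NU : U -> \bar R) (NV : V -> \bar R)
    (NW : W -> \bar R) (B : U -> V -> W) :
  pairing NU NV NW B -> pairing NV NU NW (fun v u => B u v).
Proof. by case=> h1 h2 h3; split => // v u vy uy; rewrite muleC; exact: h1. Qed.

End condexp_properties.

(** * Contraction of conditional expectation in L^m *)

Section Lp_contraction.
Context {R : realType} {d : measure_display} {Omega : measurableType d}.
Variable P : probability Omega R.
Hypothesis hP : complete_sub P d.-measurable.
Local Open Scope ereal_scope.

Variable G : set (set Omega).
Hypothesis hG : complete_sub P G.

Let Gd : G `<=` d.-measurable. Proof. exact: (complete_sub_measurable hG). Qed.

Section comparison.
Variables h k : Omega -> \bar R.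
Hypotheses (h0 : forall w, 0 <= h w) (k0 : forall w, 0 <= k w).
Hypotheses (mh' : measurable_fun setT h) (mk : measurable_fun setT k).
Hypothesis hk : forall A, G A -> \int[P]_(w in A) h w <= \int[P]_(w in A) k w.
Hypothesis hy : \int[P]_w h w < +oo.

(** A bounded weight is a rescaled staircase, that is a sum of indicators of sets of [G], up to one
    step. Rounding down is harmless on the side of [k]; on the side of [h] it costs one step times
    the integral of [h], which is finite. *)
Lemma le_integral_weight (phi : Omega -> R) (K : nat) : gmeas G (EFin \o phi) ->
  (forall w, (0 <= phi w <= K%:R)%R) ->
  \int[P]_w ((phi w)%:E * h w) <= \int[P]_w ((phi w)%:E * k w).
Proof.
move=> mphi phi0K.
have phi0 w : (0 <= phi w)%R by have /andP[] := phi0K w.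
have phiK w : (phi w <= K%:R)%R by have /andP[] := phi0K w.
have mphi' : measurable_fun setT (EFin \o phi) by exact: (gmeas_measurable hG mphi).
pose E (J i : nat) := [set w | (i.+1%:R <= J%:R * phi w)%R].
have GE J i : G (E J i).
  have -> : E J i = (EFin \o phi) @^-1` [set x | (i.+1%:R)%:E <= J%:R%:E * x].
    by apply/seteqP; split => w; rewrite /E/= -EFinM lee_fin.
  apply: (gmeas_preimage hG mphi); rewrite -[X in measurable X]setTI.
  by apply: measurable_lee => //; exact: measurable_funeM.
(* With step 1/(J+1) and weight at most [K], the rescaled weight reaches at most [J.+1 * K]; this
   many stairs are needed for the lower bound. *)
pose st (J : nat) w := (J.+1%:R^-1 * staircase (J.+1 * K) (J.+1%:R * phi w))%R.
have st0 J w : (0 <= st J w)%R by rewrite mulr_ge0 ?invr_ge0// staircase_ge0.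
have st_le J w : (st J w <= phi w)%R.
  rewrite /st -(@mulKf R J.+1%:R _ (phi w)) ?pnatr_eq0// ler_wpM2l ?invr_ge0//.
  by rewrite mulKf ?pnatr_eq0// staircase_le// mulr_ge0.
have st_ge J w : (phi w <= st J w + J.+1%:R^-1)%R.
  rewrite /st -{1}(@mulKf R J.+1%:R _ (phi w)) ?pnatr_eq0// -[X in (_ <= _ + X)%R]mulr1 -mulrDr.
  by rewrite ler_wpM2l ?invr_ge0// staircase_ge// natrM ler_wpM2l.
have stE J w : (st J w)%:E = (J.+1%:R^-1)%:E * \sum_(i < J.+1 * K) (\1_(E J.+1 i) w)%:E.
  rewrite /st EFinM /staircase -sumEFin; congr (_ * _).
  by apply: eq_bigr => i _; rewrite indic_pred.
have mind J i : measurable_fun setT (fun w => (\1_(E J i) w)%:E : \bar R).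
  by apply: measurableT_comp => //; exact: measurable_indic (Gd (GE _ _)).
have mst J : measurable_fun setT (fun w => (st J w)%:E).
  under eq_fun do rewrite stE.
  by apply: measurable_funeM; apply: emeasurable_sum => i; exact: mind.
have int_st J (f : Omega -> \bar R) : (forall w, 0 <= f w) -> measurable_fun setT f ->
    \int[P]_w ((st J w)%:E * f w) =
    (J.+1%:R^-1)%:E * \sum_(i < J.+1 * K) \int[P]_(w in E J.+1 i) f w.
  move=> f0 mf.
  under eq_integral do rewrite stE -muleA ge0_sume_distrl//.
  rewrite ge0_integralZl_EFin//; last first.
  - apply: emeasurable_sum => i; exact: emeasurable_funM.
  - by move=> w _; apply: sume_ge0 => i _; rewrite mule_ge0// lee_fin.
  congr (_ * _); rewrite ge0_integral_sum//; last 2 first.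
  - by move=> i; exact: emeasurable_funM.
  - by move=> i w _; rewrite mule_ge0// lee_fin.
  apply: eq_bigr => i _; rewrite [RHS]integral_mkcond; apply: eq_integral => w _.
  by rewrite patchE indicE; case: (_ \in _); rewrite ?mul1e ?mul0e.
have key J : \int[P]_w ((phi w)%:E * h w) <=
    \int[P]_w ((phi w)%:E * k w) + (J.+1%:R^-1)%:E * \int[P]_w h w.
  apply: (@le_trans _ _ (\int[P]_w ((st J w)%:E * h w) + (J.+1%:R^-1)%:E * \int[P]_w h w)).
    rewrite -ge0_integralZl_EFin// -ge0_integralD//; last 4 first.
    - by move=> w _; rewrite mule_ge0// lee_fin.
    - exact: emeasurable_funM.
    - by move=> w _; rewrite mule_ge0// lee_fin invr_ge0.
    - exact: measurable_funeM.
    apply: ge0_le_integral => //.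
    - by move=> w _; rewrite mule_ge0// lee_fin.
    - exact: emeasurable_funM.
    - by apply: emeasurable_funD; [exact: emeasurable_funM|exact: measurable_funeM].
    - move=> w _; rewrite -ge0_muleDl ?lee_fin ?invr_ge0// lee_wpmul2r//.
      by rewrite -EFinD lee_fin.
  rewrite leeD2r// (@le_trans _ _ (\int[P]_w ((st J w)%:E * k w)))//.
    rewrite !int_st// lee_wpmul2l ?lee_fin ?invr_ge0//.
    by apply: lee_sum => i _; exact: hk.
  apply: ge0_le_integral => //.
  - by move=> w _; rewrite mule_ge0// lee_fin.
  - exact: emeasurable_funM.
  - exact: emeasurable_funM.
  - by move=> w _; rewrite lee_wpmul2r// lee_fin.
have hfin : \int[P]_w h w \is a fin_num by rewrite ge0_fin_numE// integral_ge0.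
have inv0 : (n.+1%:R^-1 : R)%:E * \int[P]_w h w @[n --> \oo] --> 0.
  apply: cvge0Zr => //; apply: cvg_EFin; [exact: nearW|exact: cvg_harmonic].
apply/lee_addgt0Pr => e e0.
have inv0' n : 0 <= (n.+1%:R^-1 : R)%:E * \int[P]_w h w.
  by rewrite mule_ge0 ?lee_fin ?invr_ge0// integral_ge0.
move/cvge0P : inv0 => /(_ inv0' _ e0)[n _ /(_ n (leqnn n)) hn].
by rewrite (le_trans (key n))// leeD2l.
Qed.

(* Testing against the weight [min(h, n) ^ (m - 1)] and applying Young's
   inequality absorbs half of the weight into the left-hand side. *)
Lemma Lnorm_le_set_integrals (m : R) : gmeas G h -> (1 < m)%R -> 'N[P]_m%:E[h] <= 'N[P]_m%:E[k].
Proof.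
move=> mh m1; have m0 : (0 < m)%R by exact: lt_trans m1.
have mN0 : m != 0%R by rewrite gt_eqF.
have m10 : (0 < m - 1)%R by rewrite subr_gt0.
have [->|ky] := eqVneq 'N[P]_m%:E[k] +oo; first exact: leey.
have kE : \int[P]_w `|k w| `^ m = \int[P]_w (k w `^ m).
  by apply: eq_integral => w _; rewrite gee0_abs.
have Ky : \int[P]_w (k w `^ m) < +oo.
  have : 'N[P]_m%:E[k] < +oo by rewrite ltey.
  by rewrite unlock kE => /lty_poweRy; apply; rewrite invr_eq0.
have K0 : 0 <= \int[P]_w (k w `^ m) by apply: integral_ge0 => w _; exact: poweR_ge0.
have Kfin : \int[P]_w (k w `^ m) \is a fin_num by rewrite ge0_fin_numE.
(* Truncation makes the moment [a n] finite, which the absorption requires; monotone convergence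
   removes it at the end. *)
pose hn (n : nat) w := mine (h w) n%:R%:E.
have hn_fin n w : hn n w \is a fin_num.
  by rewrite /hn ge0_fin_numE ?le_min ?h0 ?lee_fin ?ler0n// gt_min ltry orbT.
pose x n w := fine (hn n w).
have xE n w : (x n w)%:E = hn n w by rewrite fineK.
have x0 n w : (0 <= x n w)%R by rewrite fine_ge0// /hn le_min h0 lee_fin ler0n.
have xn n w : (x n w <= n%:R)%R by rewrite -lee_fin xE /hn ge_min lexx orbT.
have xh n w : (x n w)%:E <= h w by rewrite xE /hn ge_min lexx.
have mx n : gmeas G (EFin \o x n).
  rewrite (_ : EFin \o x n = hn n); last by apply/funext => w /=; rewrite xE.
  by apply: (@measurable_mine _ (g_sigma_algebraType G)).
have mxp n (r : R) : gmeas G (fun w => (x n w `^ r)%:E).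
  rewrite (_ : (fun _ => _) = (fun y : \bar R => y `^ r) \o (EFin \o x n))//.
  apply: (@measurableT_comp _ _ _ (g_sigma_algebraType G)) => //.
  - exact: measurable_poweR.
  - exact: mx.
have mxp' : forall (i : nat) (r : R), measurable_fun setT (fun w => (x i w `^ r)%:E).
  by move=> i r; exact: (gmeas_measurable hG (mxp i r)).
have mkm : measurable_fun setT (fun w => k w `^ m).
  exact: (measurableT_comp (measurable_poweR m)).
pose a n := \int[P]_w (x n w `^ m)%:E.
have a0 n : 0 <= a n by apply: integral_ge0 => w _; rewrite lee_fin powR_ge0.
have ay n : a n < +oo.
  apply: (@le_lt_trans _ _ (\int[P]_w (cst (n%:R `^ m)%:E w))).
    apply: ge0_le_integral => //.
    - by move=> w _; rewrite lee_fin powR_ge0.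
    - by move=> w _; rewrite lee_fin ge0_ler_powR ?nnegrE ?(ltW m0).
  by rewrite integral_cst// [X in _ * X](probability_setT P) mule1 ltry.
have aK n : a n <= \int[P]_w (k w `^ m).
  (* The exponent conjugate to m: it turns the power m - 1 of the weight into the power m, since (m
     - 1) q = m. *)
  have [q qm] : exists q : R, q = (m / (m - 1))%R by exists (m / (m - 1))%R.
  have q0 : (0 < q)%R by rewrite qm divr_gt0.
  have qE : (q^-1 + m^-1 = 1)%R by rewrite qm; field; rewrite mN0 gt_eqF.
  have h1 : a n <= \int[P]_w ((x n w `^ (m - 1))%:E * h w).
    apply: ge0_le_integral => //.
    - by move=> w _; rewrite lee_fin powR_ge0.
    - by apply: emeasurable_funM => //; exact: mxp'.
    - move=> w _; rewrite -(mulr_powRB1 (x0 n w) m0) mulrC EFinM.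
      by rewrite lee_wpmul2l// lee_fin powR_ge0.
  have [K hK] : exists K : nat, (n%:R `^ (m - 1) <= K%:R :> R)%R.
    by exists (Num.bound (n%:R `^ (m - 1) : R)); rewrite ltW// archi_boundP// powR_ge0.
  have h2 : \int[P]_w ((x n w `^ (m - 1))%:E * h w) <= \int[P]_w ((x n w `^ (m - 1))%:E * k w).
    apply: (le_integral_weight (K := K) (mxp n _)) => w; rewrite powR_ge0/= (le_trans _ hK)//.
    by rewrite ge0_ler_powR ?nnegrE ?(ltW m10).
  have h3 : \int[P]_w ((x n w `^ (m - 1))%:E * k w) <=
      (q^-1)%:E * a n + (m^-1)%:E * \int[P]_w (k w `^ m).
    have -> : (q^-1)%:E * a n = \int[P]_w ((q^-1)%:E * (x n w `^ m)%:E).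
      rewrite ge0_integralZl_EFin ?invr_ge0 ?(ltW q0)//.
      by move=> w _; rewrite lee_fin powR_ge0.
    have -> : (m^-1)%:E * \int[P]_w (k w `^ m) = \int[P]_w ((m^-1)%:E * k w `^ m).
      rewrite ge0_integralZl_EFin ?invr_ge0 ?(ltW m0)//.
      by move=> w _; exact: poweR_ge0.
    rewrite -ge0_integralD//; last 4 first.
    - by move=> w _; rewrite mule_ge0 ?lee_fin ?invr_ge0 ?powR_ge0 ?(ltW q0).
    - exact: measurable_funeM.
    - by move=> w _; rewrite mule_ge0 ?lee_fin ?invr_ge0 ?poweR_ge0 ?(ltW m0).
    - exact: measurable_funeM.
    apply: ge0_le_integral => //.
    - by move=> w _; rewrite mule_ge0// lee_fin powR_ge0.
    - by apply: emeasurable_funM => //; exact: mxp'.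
    - by apply: emeasurable_funD; exact: measurable_funeM.
    move=> w _; have [kwy|kwy] := eqVneq (k w) +oo.
      rewrite kwy poweRyr// [X in _ + X]gt0_muley ?lte_fin ?invr_gt0//.
      by rewrite addey ?leey// gt_eqF// (lt_le_trans ltNy0)// mule_ge0 ?lee_fin ?invr_ge0 ?powR_ge0 ?(ltW q0).
    have kwfin : k w \is a fin_num by rewrite ge0_fin_numE// ltey.
    rewrite -(fineK kwfin) poweR_EFin -!EFinM -EFinD lee_fin.
    have := conjugate_powR (powR_ge0 (x n w) (m - 1)) (fine_ge0 (k0 w)) q0 m0 qE.
    rewrite -powRrM (_ : (m - 1) * q = m)%R; last by rewrite qm mulrCA divff ?mulr1// gt_eqF.
    by rewrite ![(_^-1 * _)%R]mulrC.
  have afin : a n \is a fin_num by rewrite ge0_fin_numE.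
  have := le_trans h1 (le_trans h2 h3).
  rewrite -(fineK afin) -(fineK Kfin) -!EFinM -EFinD !lee_fin => h4.
  (* Subtracting the finite term (1 - 1/m) a leaves a/m on the left, against 1/m times the integral
     of k^m. *)
  have qm1 : (q^-1 = 1 - m^-1)%R by lra.
  rewrite -subr_ge0 -(pmulr_rge0 _ (_ : 0 < m^-1)%R) ?invr_gt0// mulrBr subr_ge0.
  by move: h4; rewrite qm1 mulrBl mul1r; lra.
have xnd w : nondecreasing_seq (fun n => (x n w `^ m)%:E).
  move=> i j ij; rewrite lee_fin ge0_ler_powR ?nnegrE ?(ltW m0)//.
  rewrite -lee_fin !xE /hn le_min ge_min lexx/= ge_min; apply/orP; right.
  by rewrite lee_fin ler_nat.
have aH : a n @[n --> \oo] --> \int[P]_w (limn (fun n => (x n w `^ m)%:E)).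
  apply: (cvg_monotone_convergence measurableT (g' := fun n w => (x n w `^ m)%:E)).
  - by move=> n; exact: mxp'.
  - by move=> n w _; rewrite lee_fin powR_ge0.
  - by move=> w _; exact: xnd.
have hlty : {ae P, forall w, h w < +oo}.
  apply: (Lnorm_lty_ae (p := 1) (lexx 1) mh' h0).
  by rewrite Lnorm1; under eq_integral do rewrite gee0_abs//.
have hE : \int[P]_w `|h w| `^ m = \int[P]_w (limn (fun n => (x n w `^ m)%:E)).
  apply: ae_eq_integral => //.
  - exact: measurable_abse_poweR.
  - apply: (gmeas_measurable hG); apply: (gmeas_lim hG (h_ := fun n w => (x n w `^ m)%:E)) => //.
    apply: aeW => w; exact: ereal_nondecreasing_is_cvgn (xnd w).
  - apply: filterS hlty => w hwy _; apply/esym/cvg_lim => //.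
    have hwfin : h w \is a fin_num by rewrite ge0_fin_numE.
    rewrite gee0_abs//; apply: cvg_near_cst.
    have [n hn'] : exists n : nat, (fine (h w) <= n%:R)%R.
      by exists (Num.bound (fine (h w))); rewrite ltW// archi_boundP// fine_ge0.
    exists n => // i /= ni; rewrite -(fineK hwfin) poweR_EFin; congr (_ `^ m)%:E.
    apply: EFin_inj; rewrite xE fineK// /hn min_l//.
    by rewrite -(fineK hwfin) lee_fin (le_trans hn')// ler_nat.
rewrite unlock; apply: gt0_ler_poweR.
- by rewrite invr_ge0 ltW.
- by rewrite in_itv/= leey andbT integral_ge0// => w _; exact: poweR_ge0.
- by rewrite in_itv/= leey andbT integral_ge0// => w _; exact: poweR_ge0.
rewrite kE hE; apply: (cvge_le _ aH).
exact: nearW.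
Qed.

End comparison.

(** The comparison of the norms on the sets of [G] plays the role of Jensen's inequality; 1 < m is
    what the weight with exponent m - 1 asks for. *)
Lemma condexp_Lpnorm_le (V : lmodType R) (N : V -> \bar R) (m : R) Z W : enorm N ->
  (1 < m)%R -> is_condexp P N G Z W -> Lpnorm P N m%:E W <= Lpnorm P N m%:E Z.
Proof.
move=> hN m1 h; have sZ := condexp_sm hG h; have sW := condexp_smG h.
apply: Lnorm_le_set_integrals => //.
- by move=> w; exact: (enorm_ge0 hN).
- by move=> w; exact: (enorm_ge0 hN).
- exact: (sm_measurable hN hG sW).
- exact: (sm_measurable hN hP sZ).
- by move=> A GA; exact: (condexp_integral_le hP hN hG h GA).
- by case: h.
- exact: (sm_gmeas hN hG sW).
Qed.

End Lp_contraction.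

(** * Continuity of conditional expectations along a filtration *)

Section real_line.
Context {R : realType}.
Local Open Scope ereal_scope.

(** The real line as one more extended normed space, so that the vector-valued uniqueness and L^1
    limit results apply to conditional probabilities. *)
Definition absnorm (x : R^o) : \bar R := `|x|%:E.

Lemma absnorm_enorm : enorm absnorm.
Proof.
split; first by move=> v; rewrite lee_fin.
- by move=> u v; rewrite -EFinD lee_fin ler_normD.
- by move=> a v; rewrite /absnorm -EFinM normrM.
Qed.

Lemma absnorm_complete : ecomplete absnorm.
Proof.
move=> u cu; have /cvg_ex[/= x ux] : cvgn (u : nat -> R^o).
  apply/cauchy_cvgP/cauchy_exP => e e0.
  have [n1 hn1] := cu _ (divr_gt0 e0 (ltr0Sn R 1)).
  exists (u n1); exists n1 => // n /= n1n; rewrite -ball_normE/=.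
  rewrite -lte_fin (le_lt_trans (hn1 _ _ (leqnn _) n1n))//.
  by rewrite lte_fin ltr_pdivrMr// ltr_pMr// ltr1n.
exists x; apply/cvge0P; first by move=> n; rewrite lee_fin.
move=> eps eps0; move/cvgrPdist_le : ux => /(_ _ eps0); apply: filterS => n.
by rewrite distrC -lee_fin.
Qed.

End real_line.

(** An inequality of Young type, which takes the place of Cauchy-Schwarz in passing from L^2 to L^1
    distances. *)
Lemma le_sqr_over (R : realType) (x a : R) : 0 < a -> x <= a^-1 * x ^+ 2 + a.
Proof.
move=> a0; rewrite -subr_ge0.
have -> : a^-1 * x ^+ 2 + a - x = a^-1 * ((x - a / 2) ^+ 2 + a ^+ 2 * (3 / 4)).
  by field; rewrite gt_eqF.
by rewrite mulr_ge0 ?invr_ge0 ?(ltW a0)// addr_ge0 ?sqr_ge0// mulr_ge0 ?sqr_ge0.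
Qed.

Section condprob_theory.
Context {R : realType} {d : measure_display} {Omega : measurableType d}.
Variable P : probability Omega R.
Hypothesis hP : complete_sub P d.-measurable.
Local Open Scope ereal_scope.
Variable B : set Omega.
Hypothesis mB : measurable B.

Let hN := @absnorm_enorm R.

Lemma condprob_unique G c c' : complete_sub P G -> is_condprob P G B c ->
  is_condprob P G B c' -> {ae P, forall w, c w = c' w}.
Proof.
move=> hG hc hc'; have one : absnorm (1%R : R^o) < +oo by rewrite ltry.
have := condexp_unique hP hN hG (condexp_condprob hG hN mB hc one)
  (condexp_condprob hG hN mB hc' one).
apply: filterS => w [] /normr0_eq0/eqP; rewrite -scalerBl scaler_eq0 oner_eq0 orbF.
by rewrite subr_eq0 => /eqP.
Qed.

Let mc G c : complete_sub P G -> is_condprob P G B c -> measurable_fun setT c.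
Proof.
by move=> hG [/(gmeas_measurable hG) h _ _]; exact/measurable_EFinP.
Qed.

Let phi (c : Omega -> R) : \bar R := \int[P]_w (c w ^+ 2)%:E.

Let c01 G c w : is_condprob P G B c -> (0 <= c w <= 1)%R.
Proof. by case. Qed.

(* Pythagoras: c is the orthogonal projection of c'. *)
Lemma condprob_sqr_dist G G' c c' : complete_sub P G -> complete_sub P G' ->
  G `<=` G' -> is_condprob P G B c -> is_condprob P G' B c' ->
  \int[P]_w ((c' w - c w) ^+ 2)%:E + \int[P]_w (c w ^+ 2)%:E = \int[P]_w (c' w ^+ 2)%:E.
Proof.
move=> hG hG' GG' hc hc'.
have c0 w : (0 <= c w)%R by have /andP[] := c01 w hc.
have c1 w : (c w <= 1)%R by have /andP[] := c01 w hc.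
have c'0 w : (0 <= c' w)%R by have /andP[] := c01 w hc'.
have c'1 w : (c' w <= 1)%R by have /andP[] := c01 w hc'.
have [m m'] := (mc hG hc, mc hG' hc').
have mE : measurable_fun setT (fun w => (c w)%:E) by exact/measurable_EFinP.
have mE' : measurable_fun setT (fun w => (c' w)%:E) by exact/measurable_EFinP.
have eqA A : G A -> \int[P]_(w in A) (c w)%:E = \int[P]_(w in A) (c' w)%:E.
  move=> GA; case: hc => _ _ ->//; case: hc' => _ _ ->//; exact: GG'.
have leA A : G A -> \int[P]_(w in A) (c w)%:E <= \int[P]_(w in A) (c' w)%:E.
  by move=> /eqA ->.
have geA A : G A -> \int[P]_(w in A) (c' w)%:E <= \int[P]_(w in A) (c w)%:E.
  by move=> /eqA ->.
have bounded (f : Omega -> R) : (forall w, (0 <= f w <= 1)%R) -> measurable_fun setT f ->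
    \int[P]_w (f w)%:E < +oo.
  move=> f01 mf; apply: (@le_lt_trans _ _ (\int[P]_w (cst 1 w))); last first.
    by rewrite integral_cst// [X in _ * X](probability_setT P) mule1 ltry.
  apply: ge0_le_integral => //.
  - by move=> w _; rewrite lee_fin; have /andP[] := f01 w.
  - exact/measurable_EFinP.
  - by move=> w _; rewrite lee_fin; have /andP[] := f01 w.
(* Orthogonality of c' - c to c. The two functions have equal integrals over the sets of [G], so
   testing with the [G]-measurable weight [c] gives both inequalities. *)
have cc' : \int[P]_w (c w * c' w)%:E = \int[P]_w (c w ^+ 2)%:E.
  have [mcG _ _] := hc.
  have c0K w : (0 <= c w <= 1%:R)%R by rewrite c0 c1.
  have [cE0 cE0'] : (forall w, 0 <= (c w)%:E) /\ (forall w, 0 <= (c' w)%:E).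
    by split => w; rewrite lee_fin.
  have w1 := @le_integral_weight _ _ _ P G hG _ _ cE0 cE0' mE mE'
      leA (bounded _ (fun w => c01 w hc) m) c 1 mcG c0K.
  have w2 := @le_integral_weight _ _ _ P G hG _ _ cE0' cE0 mE' mE
      geA (bounded _ (fun w => c01 w hc') m') c 1 mcG c0K.
  under eq_integral do rewrite EFinM; under [RHS]eq_integral do rewrite expr2 EFinM.
  by apply/eqP; rewrite eq_le w1 w2.
have sqy (f : Omega -> R) : (forall w, (0 <= f w <= 1)%R) -> measurable_fun setT f ->
    \int[P]_w (f w ^+ 2)%:E \is a fin_num.
  move=> f01 mf; rewrite ge0_fin_numE; last first.
    by apply: integral_ge0 => w _; rewrite lee_fin sqr_ge0.
  apply: bounded; last exact: measurable_funX.
  by move=> w; have /andP[f0 f1] := f01 w; rewrite sqr_ge0 expr_le1.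
have fc := sqy _ (fun w => c01 w hc) m; have fc' := sqy _ (fun w => c01 w hc') m'.
have mcc' : measurable_fun setT (fun w => (c w * c' w)%:E).
  by apply/measurable_EFinP; exact: measurable_funM.
have mdd : measurable_fun setT (fun w => ((c' w - c w) ^+ 2)%:E).
  by apply/measurable_EFinP; apply: measurable_funX; exact: measurable_funB.
have msq (f : Omega -> R) : measurable_fun setT f -> measurable_fun setT (fun w => (f w ^+ 2)%:E).
  by move=> mf; apply/measurable_EFinP; exact: measurable_funX.
have cc0 w : 0 <= (c w * c' w)%:E by rewrite lee_fin mulr_ge0.
have h : \int[P]_w ((c' w - c w) ^+ 2)%:E + (\int[P]_w (c w * c' w)%:E + \int[P]_w (c w * c' w)%:E) =
    \int[P]_w (c' w ^+ 2)%:E + \int[P]_w (c w ^+ 2)%:E.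
  rewrite -ge0_integralD// -ge0_integralD//; last 3 first.
  - by move=> w _; rewrite lee_fin sqr_ge0.
  - by move=> w _; rewrite adde_ge0.
  - exact: emeasurable_funD.
  rewrite -ge0_integralD//; last 4 first.
  - by move=> w _; rewrite lee_fin sqr_ge0.
  - exact: msq.
  - by move=> w _; rewrite lee_fin sqr_ge0.
  - exact: msq.
  by apply: eq_integral => w _; rewrite -!EFinD; congr _%:E; ring.
move: h; rewrite cc'; rewrite -(fineK fc) -(fineK fc').
have I0 : 0 <= \int[P]_w ((c' w - c w) ^+ 2)%:E.
  by apply: integral_ge0 => w _; rewrite lee_fin sqr_ge0.
by case: (\int[P]_w _) I0 => // r _ []; rewrite -EFinD => h; congr _%:E; lra.
Qed.

Lemma condprob_integral_lty G c A : complete_sub P G -> is_condprob P G B c ->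
  measurable A -> \int[P]_(w in A) (c w)%:E <= 1.
Proof.
move=> hG hc mA; apply: (@le_trans _ _ (\int[P]_(w in A) (cst 1 w))).
  apply: ge0_le_integral => //.
  - by move=> w _; rewrite lee_fin; have /andP[] := c01 w hc.
  - by apply/measurable_EFinP; apply: measurable_funTS; exact: mc hc.
  - by move=> w _; rewrite lee_fin; have /andP[] := c01 w hc.
by rewrite integral_cst// mul1e probability_le1.
Qed.

Lemma condprob_phi_fin G c : complete_sub P G -> is_condprob P G B c ->
  0 <= \int[P]_w (c w ^+ 2)%:E <= 1.
Proof.
move=> hG hc; rewrite integral_ge0/=; last by move=> w _; rewrite lee_fin sqr_ge0.
apply: le_trans (condprob_integral_lty hG hc measurableT).
apply: ge0_le_integral => //.
- by move=> w _; rewrite lee_fin sqr_ge0.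
- by apply/measurable_EFinP; apply: measurable_funX; exact: mc hc.
- by apply/measurable_EFinP; exact: mc hc.
- move=> w _; have /andP[c0 c1] := c01 w hc.
  by rewrite lee_fin expr2 ler_piMl.
Qed.

Lemma condprob_phi_le G G' c c' : complete_sub P G -> complete_sub P G' ->
  G `<=` G' -> is_condprob P G B c -> is_condprob P G' B c' ->
  \int[P]_w (c w ^+ 2)%:E <= \int[P]_w (c' w ^+ 2)%:E.
Proof.
move=> hG hG' GG' hc hc'; rewrite -(condprob_sqr_dist hG hG' GG' hc hc') leeDr//.
by apply: integral_ge0 => w _; rewrite lee_fin sqr_ge0.
Qed.

(** By Pythagoras the hypothesis bounds the squared L^2 distance by eta^2; [le_sqr_over] with weight
    eta then integrates to eta + eta. *)
Lemma condprob_dist_le G G' c c' (eta : R) : (0 < eta)%R ->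
  complete_sub P G -> complete_sub P G' ->
  G `<=` G' -> is_condprob P G B c -> is_condprob P G' B c' ->
  \int[P]_w (c' w ^+ 2)%:E <= \int[P]_w (c w ^+ 2)%:E + (eta ^+ 2)%:E ->
  \int[P]_w `|c' w - c w|%:E <= (2 * eta)%:E.
Proof.
move=> eta0 hG hG' GG' hc hc'; rewrite -(condprob_sqr_dist hG hG' GG' hc hc') addeC leeD2lE; last first.
  have /andP[h0 h1] := condprob_phi_fin hG hc.
  by rewrite ge0_fin_numE// (le_lt_trans h1)// ltry.
move=> hd; have [m m'] := (mc hG hc, mc hG' hc').
have md : measurable_fun setT (fun w => c' w - c w)%R by exact: measurable_funB.
apply: (@le_trans _ _ (\int[P]_w ((eta^-1)%:E * ((c' w - c w) ^+ 2)%:E + cst eta%:E w))).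
  apply: ge0_le_integral => //.
  - by apply/measurable_EFinP; exact: measurableT_comp.
  - apply: emeasurable_funD => //; apply: measurable_funeM; apply/measurable_EFinP.
    exact: measurable_funX.
  - move=> w _; rewrite -EFinM -EFinD lee_fin -real_normK ?num_real//.
    exact: le_sqr_over.
rewrite ge0_integralD//; last 3 first.
- by move=> w _; rewrite mule_ge0 ?lee_fin ?invr_ge0 ?sqr_ge0 ?(ltW eta0).
- apply: measurable_funeM; apply/measurable_EFinP; exact: measurable_funX.
- by move=> w _; rewrite lee_fin ltW.
rewrite integral_cst// [X in _ * X](probability_setT P) mule1 ge0_integralZl_EFin//; last 3 first.
- by move=> w _; rewrite lee_fin sqr_ge0.
- apply/measurable_EFinP; exact: measurable_funX.
- by rewrite invr_ge0 ltW.
rewrite mulr2n mulrDl mul1r EFinD leeD2r//.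
rewrite (le_trans (lee_wpmul2l _ hd)) ?lee_fin ?invr_ge0 ?(ltW eta0)//.
by rewrite expr2 mulKf// gt_eqF.
Qed.

Section sequence.
Variables (G_ : nat -> set (set Omega)) (c_ : nat -> Omega -> R).
Hypothesis hG_ : forall n, complete_sub P (G_ n).
Hypothesis hc_ : forall n, is_condprob P (G_ n) B (c_ n).
Hypothesis nested : forall n k, G_ n `<=` G_ k \/ G_ k `<=` G_ n.
Hypothesis cvg_phi : cvgn (fun n => fine (\int[P]_w (c_ n w ^+ 2)%:E)).

(** By Pythagoras, convergence of the squared norms makes the sequence Cauchy in L^1, and sparse
    indices [k n] make it rapidly so. The hypothesis [nested] allows either order, so that one
    statement serves decreasing and increasing sequences; [k] need not be monotone. *)
Lemma condprob_seq_lim : exists (k : nat -> nat) (c : Omega -> R),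
  [/\ forall n, (n <= k n)%N, forall w, (0 <= c w <= 1)%R, measurable_fun setT c,
    {ae P, forall w, (c_ (k n) w)%:E @[n --> \oo] --> (c w)%:E}
  & \int[P]_w `|c w - c_ (k n) w|%:E @[n --> \oo] --> 0].
Proof.
have /cvg_ex[/= L hL] := cvg_phi.
pose f n := fine (\int[P]_w (c_ n w ^+ 2)%:E).
have fE n : (f n)%:E = \int[P]_w (c_ n w ^+ 2)%:E.
  have /andP[h0 h1] := condprob_phi_fin (hG_ n) (hc_ n).
  by rewrite fineK// ge0_fin_numE// (le_lt_trans h1)// ltry.
pose e n := dyadic R n.
have e0 n : (0 < e n)%R by exact: dyadic_gt0.
(* Half of e(n)^2 on both sides gives consecutive squared norms within e(n)^2, hence consecutive L^1
   distances of at most 2 e(n). *)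
have /choice[k hk] : forall n, exists k, (n <= k)%N /\ (`|L - f k| <= e n ^+ 2 / 2)%R.
  move=> n; have e20 : (0 < e n ^+ 2 / 2)%R by rewrite divr_gt0// exprn_gt0.
  move/cvgrPdist_le : hL => /(_ _ e20)[n0 _ hn0]; exists (maxn n n0).
  by rewrite leq_maxl; split => //; apply: hn0 => /=; rewrite leq_maxr.
have fd n : (`|f (k n.+1) - f (k n)| <= e n ^+ 2)%R.
  have [_ h1] := hk n; have [_ h2] := hk n.+1.
  have en : (e n.+1 ^+ 2 <= e n ^+ 2)%R.
    by rewrite ler_sqr ?nnegrE ?(ltW (e0 _))//; exact: dyadicS_le.
  rewrite -(subrKA L) (le_trans (ler_normD _ _))// distrC.
  by rewrite (splitr (e n ^+ 2)) lerD// (le_trans h2)// ler_wpM2r// invr_ge0.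
pose S n : Omega -> R^o := c_ (k n).
have sS n : strongly_measurable P (@absnorm R) d.-measurable (S n).
  have one : absnorm (1%R : R^o) < +oo by rewrite ltry.
  have := condexp_smr (hG_ (k n)) (condexp_condprob (hG_ (k n)) hN mB (hc_ (k n)) one).
  by congr strongly_measurable; apply/funext => w; rewrite /S [LHS]mulr1.
have [c [cae c1]] : exists c, {ae P, forall w, absnorm (c w - S n w)%R @[n --> \oo] --> 0} /\
    \int[P]_w absnorm (c w - S n w)%R @[n --> \oo] --> 0.
  apply: (rapid_cauchy_lim hP hN (@absnorm_complete R) (c := 2) sS) => // n.
  have := fd n; rewrite ler_norml => /andP[l1 l2].
  have [GG|GG] := nested (k n) (k n.+1).
    apply: (condprob_dist_le (e0 n) (hG_ _) (hG_ _) GG (hc_ _) (hc_ _)).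
    by rewrite -!fE -EFinD lee_fin -lerBlDl.
  under eq_integral do rewrite /absnorm distrC.
  apply: (condprob_dist_le (e0 n) (hG_ _) (hG_ _) GG (hc_ _) (hc_ _)).
  by rewrite -!fE -EFinD lee_fin; move: l1; rewrite lerNl opprB lerBlDl.
(* Clipping to [0, 1] does not increase the distance to functions with values in [0, 1], so the
   limit may be taken with these bounds everywhere, as [is_condprob] demands. *)
pose c' w : R := Num.max 0%R (Num.min 1%R (c w)).
have c'01 w : (0 <= c' w <= 1)%R.
  by rewrite /c' le_max lexx/= ge_max ler01/= ge_min lexx.
have clip w (y : R) : (0 <= y <= 1)%R -> (`|c' w - y| <= `|c w - y|)%R.
  move=> /andP[y0 y1]; rewrite /c'; have [c1'|c1'] := leP 1%R (c w).
    rewrite max_r//; rewrite !ger0_norm ?subr_ge0//; first by rewrite lerD2r.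
    by rewrite (le_trans y1).
  have [c0|c0] := leP 0%R (c w); first by [].
  rewrite sub0r normrN ger0_norm// ltr0_norm ?subr_lt0 ?(lt_le_trans c0)//.
  by rewrite opprB lerDl oppr_ge0 ltW.
have aecE (g : Omega -> R) : (forall w n, `|g w - c_ (k n) w| <= `|c w - c_ (k n) w|)%R ->
    {ae P, forall w, (c_ (k n) w)%:E @[n --> \oo] --> (g w)%:E}.
  move=> hg; apply: filterS cae => w hw; apply: cvg_EFin; first exact: nearW.
  apply/cvgrPdist_le => eps eps0.
  have /cvge0P := hw => /(_ (fun=> enorm_ge0 hN _) _ eps0); apply: filterS => n.
  by rewrite lee_fin; apply: le_trans; exact: hg.
have mck n : measurable_fun setT (fun w => (c_ (k n) w)%:E).
  by apply/measurable_EFinP; exact: mc (hc_ _).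
have mlim (g : Omega -> R) : {ae P, forall w, (c_ (k n) w)%:E @[n --> \oo] --> (g w)%:E} ->
    measurable_fun setT g.
  move=> hg; apply/measurable_EFinP; apply: (gmeas_measurable hP).
  apply: (gmeas_lim hP (h_ := fun n w => (c_ (k n) w)%:E)) => // n.
  exact: gmeas_all.
have aec' := aecE c' (fun w n => clip w _ (c01 w (hc_ (k n)))).
have mc' := mlim _ aec'; have mc0 : measurable_fun setT c by exact/mlim/aecE.
exists k, c'; split => //; first by move=> n; case: (hk n).
apply: (@squeeze_cvge0 _ _ _ _ _ (fun n => \int[P]_w absnorm (c w - S n w)%R)) => //.
  by move=> n; apply: integral_ge0 => w _; rewrite lee_fin.
apply: nearW => n; apply: ge0_le_integral => //.
- apply/measurable_EFinP; apply: measurableT_comp => //; apply: measurable_funB => //.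
  exact: mc (hc_ _).
- apply/measurable_EFinP; apply: measurableT_comp => //; apply: measurable_funB => //.
  exact: mc (hc_ _).
- by move=> w _; rewrite lee_fin; exact: (clip w _ (c01 w (hc_ _))).
Qed.

End sequence.

End condprob_theory.

Section condprob_limits.
Context {R : realType} {d : measure_display} {Omega : measurableType d}.
Variable P : probability Omega R.
Hypothesis hP : complete_sub P d.-measurable.
Local Open Scope ereal_scope.
Variable B : set Omega.
Hypothesis mB : measurable B.

Lemma integral_leD_dist (A : set Omega) (f g : Omega -> R) : measurable A ->
  measurable_fun setT f -> measurable_fun setT g ->
  (forall w, (0 <= f w)%R) -> (forall w, (0 <= g w)%R) ->
  \int[P]_(w in A) (f w)%:E <= \int[P]_(w in A) (g w)%:E + \int[P]_w `|f w - g w|%:E.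
Proof.
move=> mA mf mg f0 g0.
have md : measurable_fun setT (fun w => `|f w - g w|%:E).
  by apply/measurable_EFinP; apply: measurableT_comp => //; exact: measurable_funB.
apply: (@le_trans _ _ (\int[P]_(w in A) ((g w)%:E + `|f w - g w|%:E))).
  apply: ge0_le_integral => //.
  - by move=> w _; rewrite lee_fin.
  - by apply/measurable_EFinP; exact: measurable_funTS.
  - apply: emeasurable_funD; first by apply/measurable_EFinP; exact: measurable_funTS.
    exact: measurable_funTS.
  - by move=> w _; rewrite -EFinD lee_fin -lerBlDl ler_norm.
rewrite ge0_integralD//; last 3 first.
- by move=> w _; rewrite lee_fin.
- by apply/measurable_EFinP; exact: measurable_funTS.
- exact: measurable_funTS.
by rewrite leeD2l// ge0_subset_integral.
Qed.

Lemma measure_setDI_split D : measurable D -> P B = P (D `&` B) + P (~` D `&` B).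
Proof.
move=> mD; rewrite -measureU; first by rewrite -setIUl setUv setTI.
- exact: measurableI.
- by apply: measurableI => //; exact: measurableC.
- by rewrite setIACA setICr set0I.
Qed.

Section limit.
Variables (G_ : nat -> set (set Omega)) (Ginf : set (set Omega)).
Variables (c_ : nat -> Omega -> R) (c : Omega -> R).
Hypothesis hG_ : forall n, complete_sub P (G_ n).
Hypothesis hGinf : complete_sub P Ginf.
Hypothesis hc_ : forall n, is_condprob P (G_ n) B (c_ n).
Hypothesis hc : is_condprob P Ginf B c.

Let mc G k : complete_sub P G -> is_condprob P G B k -> measurable_fun setT k.
Proof.
by move=> hG [/(gmeas_measurable hG) h _ _]; exact/measurable_EFinP.
Qed.

Let fin_phi G k : complete_sub P G -> is_condprob P G B k ->
  \int[P]_w (k w ^+ 2)%:E \is a fin_num.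
Proof.
move=> hG hk; have /andP[h0 h1] := condprob_phi_fin hG hk.
by rewrite ge0_fin_numE// (le_lt_trans h1)// ltry.
Qed.

Let integral_lim (k : nat -> nat) (c' : Omega -> R) (A : set Omega) :
  (forall w, (0 <= c' w <= 1)%R) -> measurable_fun setT c' ->
  \int[P]_w `|c' w - c_ (k n) w|%:E @[n --> \oo] --> 0 -> measurable A ->
  (\forall n \near \oo, G_ (k n) A) -> \int[P]_(w in A) (c' w)%:E = P (A `&` B).
Proof.
move=> c'01 mc' cv mA GA.
have c'0 w : (0 <= c' w)%R by have /andP[] := c'01 w.
have c_0 n w : (0 <= c_ n w)%R by have [_ /(_ w)/andP[]] := hc_ n.
have dist0 n : 0 <= \int[P]_w `|c' w - c_ (k n) w|%:E.
  by apply: integral_ge0 => w _; rewrite lee_fin.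
move/cvge0P : cv => /(_ dist0) cv.
have ex (eps : R) : (0 < eps)%R -> exists n, G_ (k n) A /\
    \int[P]_w `|c' w - c_ (k n) w|%:E <= eps%:E.
  move=> /cv h; have [n0 _ hn0] := filterI GA h; exists n0.
  exact: (hn0 n0 (leqnn n0)).
apply/eqP; rewrite eq_le; apply/andP; split; apply/lee_addgt0Pr => eps /ex[n [GnA le]].
- have [_ _ <-//] := hc_ (k n).
  apply: le_trans (integral_leD_dist mA mc' (mc (hG_ _) (hc_ (k n))) c'0 (c_0 _)) _.
  exact: leeD2l.
- have [_ _ <-//] := hc_ (k n).
  apply: le_trans (integral_leD_dist mA (mc (hG_ _) (hc_ (k n))) mc' (c_0 _) c'0) _.
  by apply: leeD2l; under eq_integral do rewrite distrC.
Qed.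

(** [c] and [c'] agree almost surely by uniqueness, and the difference of two functions with values
    in [0, 1] has square at most its absolute value. L^1 convergence to [c'] thus bounds squared
    distances to [c]. *)
Let dist_phi (k : nat -> nat) (c' : Omega -> R) : is_condprob P Ginf B c' ->
  \int[P]_w `|c' w - c_ (k n) w|%:E @[n --> \oo] --> 0 ->
  forall eps : R, (0 < eps)%R ->
    exists n, \int[P]_w ((c w - c_ (k n) w) ^+ 2)%:E <= eps%:E.
Proof.
move=> hc' cv eps eps0.
have dist0 n : 0 <= \int[P]_w `|c' w - c_ (k n) w|%:E.
  by apply: integral_ge0 => w _; rewrite lee_fin.
move/cvge0P : cv => /(_ dist0 _ eps0)[n _ /(_ n (leqnn n)) hn]; exists n.
have [m [m' mn]] := (mc hGinf hc, (mc hGinf hc', mc (hG_ _) (hc_ (k n)))).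
apply: le_trans hn.
have -> : \int[P]_w ((c w - c_ (k n) w) ^+ 2)%:E = \int[P]_w ((c' w - c_ (k n) w) ^+ 2)%:E.
  apply: ge0_ae_eq_integral => //.
  - by apply/measurable_EFinP; apply: measurable_funX; exact: measurable_funB.
  - by apply/measurable_EFinP; apply: measurable_funX; exact: measurable_funB.
  - by move=> w _; rewrite lee_fin sqr_ge0.
  - by move=> w _; rewrite lee_fin sqr_ge0.
  - by apply: filterS (condprob_unique hP mB hGinf hc hc') => w ->.
apply: ge0_le_integral => //.
- by move=> w _; rewrite lee_fin sqr_ge0.
- by apply/measurable_EFinP; apply: measurable_funX; exact: measurable_funB.
- by apply/measurable_EFinP; apply: measurableT_comp => //; exact: measurable_funB.
move=> w _; rewrite lee_fin -real_normK ?num_real// expr2 ler_piMl//.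
have [_ /(_ w)/andP[a0 a1] _] := hc'; have [_ /(_ w)/andP[b0 b1] _] := hc_ (k n).
by rewrite ler_norml; lra.
Qed.

(** The limit along a subsequence is measurable for every [G_ j], thus for [Ginf], and it keeps the
    integrals over the sets of [Ginf]: it is a version of P(B | Ginf). One index [n] is enough,
    since the squared norm is monotone in the sigma-algebra. *)
Lemma condprob_phi_decreasing :
  (forall n k, (n <= k)%N -> G_ k `<=` G_ n) -> (forall n, Ginf `<=` G_ n) ->
  (forall A, (forall n, G_ n A) -> Ginf A) ->
  forall eps : R, (0 < eps)%R -> exists n,
    \int[P]_w (c_ n w ^+ 2)%:E <= \int[P]_w (c w ^+ 2)%:E + eps%:E.
Proof.
move=> dec sub sup eps eps0.
have nested n k : G_ n `<=` G_ k \/ G_ k `<=` G_ n.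
  by have [/ltnW nk|kn] := ltnP n k; [right|left]; exact: dec.
have cvg_phi : cvgn (fun n => fine (\int[P]_w (c_ n w ^+ 2)%:E)).
  apply: nonincreasing_is_cvgn.
    move=> n k nk; rewrite fine_le ?(fin_phi (hG_ _) (hc_ _))//.
    exact: (condprob_phi_le (hG_ k) (hG_ n) (dec _ _ nk)).
  exists 0%R => _ [n _ <-]; rewrite fine_ge0//.
  by have /andP[] := condprob_phi_fin (hG_ n) (hc_ n).
have [k [c' [kn c'01 mc' aec' cv]]] := condprob_seq_lim hP mB hG_ hc_ nested cvg_phi.
have hc' : is_condprob P Ginf B c'.
  split => // [|A GA]; last first.
    apply: (integral_lim c'01 mc' cv); first exact: (complete_sub_measurable hGinf).
    by apply: nearW => n; exact: sub.
  have gj j : gmeas (G_ j) (EFin \o c').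
    (* The shift by [j] ensures k(n + j) >= j, so that every term of the shifted sequence is already
       [G_ j]-measurable. *)
    apply: (gmeas_lim (hG_ j) (h_ := fun n w => (c_ (k (n + j)%N) w)%:E)).
      move=> n A' mA' mA; rewrite setTI (complete_subE (hG_ j)).
      have [gk _ _] := hc_ (k (n + j)%N).
      apply: (dec j (k (n + j)%N)); first by rewrite (leq_trans _ (kn _))// leq_addl.
      exact: (gmeas_preimage (hG_ _) gk).
    apply: filterS aec' => w hw.
    by rewrite (cvg_shiftn j (fun n => (c_ (k n) w)%:E)).
  move=> _ A mA; rewrite setTI (complete_subE hGinf); apply: sup => n.
  exact: (gmeas_preimage (hG_ n) (gj n)).
have [n hn] := dist_phi hc' cv eps0; exists (k n).
rewrite -(condprob_sqr_dist hGinf (hG_ (k n)) (sub _) hc (hc_ _)) addeC leeD2l//.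
apply: le_trans hn; rewrite le_eqVlt; apply/orP; left; apply/eqP.
by apply: eq_integral => w _; rewrite -[in RHS]sqrrN opprB.
Qed.

(** Levy's upward theorem, in terms of squared norms. The limit has the right integral over each set
    of the union, from some index on; the union is stable under intersection, and Dynkin's theorem
    carries this to the sigma-algebra that it generates. *)
Lemma condprob_phi_increasing :
  (forall n k, (n <= k)%N -> G_ n `<=` G_ k) -> Ginf = <<s \bigcup_n G_ n >> ->
  forall eps : R, (0 < eps)%R -> exists n,
    \int[P]_w (c w ^+ 2)%:E <= \int[P]_w (c_ n w ^+ 2)%:E + eps%:E.
Proof.
move=> inc GE eps eps0.
have sub n : G_ n `<=` Ginf by move=> A GA; rewrite GE; apply: sub_sigma_algebra; exists n.
have nested n k : G_ n `<=` G_ k \/ G_ k `<=` G_ n.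
  by have [/ltnW nk|kn] := ltnP n k; [left|right]; exact: inc.
have cvg_phi : cvgn (fun n => fine (\int[P]_w (c_ n w ^+ 2)%:E)).
  apply: nondecreasing_is_cvgn.
    move=> n k nk; rewrite fine_le ?(fin_phi (hG_ _) (hc_ _))//.
    exact: (condprob_phi_le (hG_ n) (hG_ k) (inc _ _ nk)).
  exists 1%R => _ [n _ <-]; rewrite -lee_fin fineK ?(fin_phi (hG_ _) (hc_ _))//.
  by have /andP[] := condprob_phi_fin (hG_ n) (hc_ n).
have [k [c' [kn c'01 mc' aec' cv]]] := condprob_seq_lim hP mB hG_ hc_ nested cvg_phi.
have c'0 w : (0 <= c' w)%R by have /andP[] := c'01 w.
have mE' D : measurable_fun D (fun w => (c' w)%:E).
  by apply/measurable_EFinP; exact: measurable_funTS.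
have GinfP : Ginf `<=` d.-measurable by exact: (complete_sub_measurable hGinf).
have gen A : (\bigcup_n G_ n) A -> \int[P]_(w in A) (c' w)%:E = P (A `&` B).
  move=> [j _ GA]; apply: (integral_lim c'01 mc' cv).
    exact: (complete_sub_measurable (hG_ j)).
  exists j => // n /= jn; apply: (inc j) => //; exact: leq_trans (kn n).
have hc' : is_condprob P Ginf B c'.
  split => // [|A].
    apply: (gmeas_lim hGinf (h_ := fun n w => (c_ (k n) w)%:E)) => // n.
    have [gk _ _] := hc_ (k n); move=> _ A mA; rewrite setTI (complete_subE hGinf).
    by apply: (sub (k n)); exact: (gmeas_preimage (hG_ _) gk).
  rewrite GE; apply: (@dynkin_induction _ (g_sigma_algebraType (\bigcup_n G_ n)) (\bigcup_n G_ n)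
    (fun A => \int[P]_(w in A) (c' w)%:E = P (A `&` B))) => //.
  - move=> A1 A2 [n _ GA1] [j _ GA2]; exists (maxn n j) => //.
    apply: (complete_subI (hG_ _)).
      by apply: inc GA1; rewrite leq_maxl.
    by apply: inc GA2; rewrite leq_maxr.
  - by apply: gen; exists 0%N => //; exact: (complete_subT (hG_ _)).
  - move=> D mD h; have {}mD : d.-measurable D by apply: GinfP; rewrite GE.
    have eT : \int[P]_w (c' w)%:E = P (setT `&` B).
      by apply: gen; exists 0%N => //; exact: (complete_subT (hG_ _)).
    move: eT; rewrite (integral_split P measurableT mD (mE' _))//.
    rewrite !setTI setTD h (measure_setDI_split mD) addeC [RHS]addeC.
    have f : P (D `&` B) \is a fin_num by rewrite fin_num_measure//; exact: measurableI.
    by move/(congr1 (fun x => x - P (D `&` B))); rewrite !addeK.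
  - move=> A_ mA tA h.
    have {}mA n : d.-measurable (A_ n) by apply: GinfP; rewrite GE; exact: mA.
    rewrite ge0_integral_bigcup//; last by move=> w _; rewrite lee_fin.
    rewrite setI_bigcupl measure_semi_bigcup//.
    + by apply: eq_eseriesr => n _; exact: h.
    + by move=> n; exact: measurableI.
    + exact: trivIset_setIr.
    + by apply: bigcup_measurable => n _; exact: measurableI.
have [n hn] := dist_phi hc' cv eps0; exists (k n).
rewrite -(condprob_sqr_dist (hG_ (k n)) hGinf (sub _) (hc_ _) hc) addeC leeD2l//.
Qed.

End limit.

End condprob_limits.

Section filtration.
Context {R : realType} {d : measure_display} {Omega : measurableType d}.
Variables (P : probability Omega R) (T : R) (F : R -> set (set Omega)).
Hypotheses (T0 : 0 < T) (hF : usual_filtration P T F).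

Lemma usual_complete t : 0 <= t <= T -> complete_sub P (F t).
Proof.
case: hF => F1 F2 _ F4 tT; have [F1t Fd] := F1 t tT; split => // N /F4.
by apply: F2 => //; case/andP: tT.
Qed.

Lemma usual_complete_all : complete_sub P d.-measurable.
Proof. by apply: (complete_sub_all (usual_complete (t := 0) _)); rewrite lexx ltW. Qed.

Let hP := usual_complete_all.

Lemma usual_le s t : 0 <= s -> s <= t -> t <= T -> F s `<=` F t.
Proof. by case: hF => _ + _ _; exact. Qed.

Lemma exists_natSinv_lt (x : R) : 0 < x -> exists n, n.+1%:R^-1 < x.
Proof.
move=> x0; have [n _ hn] := near_infty_natSinv_lt (PosNum x0).
by exists n; exact: hn n (leqnn n).
Qed.

Lemma natSinv_le n k : (n <= k)%N -> k.+1%:R^-1 <= n.+1%:R^-1 :> R.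
Proof. by move=> nk; rewrite lef_pV2 ?posrE ?ltr0n// ler_nat. Qed.

Variable B : set Omega.
Hypothesis mB : measurable B.
Local Open Scope ereal_scope.

Let condprobs : exists c : R -> Omega -> R,
  forall s, (0 <= s <= T)%R -> is_condprob P (F s) B (c s).
Proof.
have /choice[c hc] : forall s : R, exists c, (0 <= s <= T)%R -> is_condprob P (F s) B c.
  move=> s; have [sT|sT] := boolP (0 <= s <= T)%R; last by exists (fun=> 0%R).
  by have [c hc] := condprob_exists (usual_complete sT) mB; exists c.
by exists c.
Qed.

Let dist0 (G : set (set Omega)) c c' : complete_sub P G -> is_condprob P G B c ->
  is_condprob P G B c' -> \int[P]_w `|c w - c' w|%:E = 0.
Proof.
move=> hG hc hc'; have e0 : {ae P, forall w, setT w -> `|c w - c' w|%:E = 0}.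
  by apply: filterS (condprob_unique hP mB hG hc hc') => w -> _; rewrite subrr normr0.
have m (k : Omega -> R) : is_condprob P G B k -> measurable_fun setT k.
  by move=> [/(gmeas_measurable hG) h _ _]; exact/measurable_EFinP.
under eq_integral do rewrite -[_%:E]gee0_abs ?lee_fin//.
apply/ae_eq_integral_abs => //.
apply/measurable_EFinP; apply: measurableT_comp => //; apply: measurable_funB; exact: m.
Qed.

(** Right-continuity identifies F_t with the intersection along times [s_ n] decreasing to t.
    Between t and [s_ n] the squared norm of P(B | F_s) is squeezed, so closeness at a single [n]
    controls every s in between. *)
Lemma condprob_right_cvg t (eps : R) : (0 <= t <= T)%R -> (0 < eps)%R ->
  exists2 del : R, (0 < del)%R & forall s, (t <= s <= T)%R -> (s < t + del)%R ->
    forall c c', is_condprob P (F s) B c -> is_condprob P (F t) B c' ->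
      \int[P]_w `|c w - c' w|%:E <= eps%:E.
Proof.
move=> tT eps0; have [t0 tT'] := andP tT.
(* Right-continuity is assumed on [0, T[ only; at T the sole admissible s is T itself. *)
have [tET|tneT] := eqVneq t T.
  exists 1%R => // s /andP[ts sT] _ c c' hc hc'.
  have sE : s = t by apply/le_anti; rewrite ts tET sT.
  rewrite sE in hc.
  by rewrite (dist0 (usual_complete tT) hc hc') lee_fin ltW.
have tT0 : (0 < T - t)%R by rewrite subr_gt0 lt_neqAle tneT.
pose s_ n := (t + (T - t) * n.+1%:R^-1)%R.
have s_gt n : (t < s_ n)%R by rewrite ltrDl mulr_gt0// invr_gt0.
have s_le n : (s_ n <= T)%R.
  by rewrite /s_ -lerBrDl ler_piMr ?(ltW tT0)// invf_le1// ler1n.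
have sI n : (0 <= s_ n <= T)%R by rewrite s_le (le_trans t0)// ltW.
have [cc hcc] := condprobs.
(* A gap eta^2 between squared norms gives an L^1 distance of 2 eta; here eta is eps / 2. *)
have e20 : (0 < (eps / 2) ^+ 2)%R by rewrite exprn_gt0// divr_gt0.
have dec n k : (n <= k)%N -> F (s_ k) `<=` F (s_ n).
  move=> nk; apply: usual_le => //; first by case/andP: (sI k).
  by rewrite lerD2l ler_wpM2l ?(ltW tT0)// natSinv_le.
have sub n : F t `<=` F (s_ n) by exact: usual_le (ltW (s_gt n)) _.
have sup A : (forall n, F (s_ n) A) -> F t A.
  move=> FA; have [_ _ hR _] := hF; rewrite (hR t); last by rewrite in_itv/= t0 -subr_gt0.
  move=> s /=; rewrite in_itv/= => /andP[ts sT].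
  have st0 : (0 < s - t)%R by rewrite subr_gt0.
  have [n hn] := exists_natSinv_lt (divr_gt0 st0 tT0).
  apply: (usual_le _ _ _ (FA n)) => //; first by case/andP: (sI n).
  by rewrite -lerBrDl -ler_pdivlMl// mulrC ltW.
have [n hn] := condprob_phi_decreasing hP mB (fun n => usual_complete (sI n))
  (usual_complete tT) (fun n => hcc _ (sI n)) (hcc _ tT) dec sub sup e20.
exists (s_ n - t)%R; first by rewrite subr_gt0.
move=> s /andP[ts sT] sn c c' hc hc'; rewrite addrC subrK in sn.
have sI' : (0 <= s <= T)%R by rewrite sT (le_trans t0).
rewrite (_ : eps = 2 * (eps / 2))%R; last by rewrite mulrC divfK// pnatr_eq0.
have ht := usual_complete tT; have hs := usual_complete sI'; have hn' := usual_complete (sI n).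
have Fts := usual_le t0 ts sT.
apply: (condprob_dist_le _ ht hs Fts hc' hc); first by rewrite divr_gt0.
apply: le_trans (condprob_phi_le hs hn' _ hc (hcc _ (sI n))) _.
  apply: usual_le (ltW sn) _ => //; exact: le_trans ts.
apply: (le_trans hn); rewrite leeD2r//.
exact: (condprob_phi_le ht ht (@subset_refl _ _) (hcc _ tT) hc').
Qed.

(** The mirror image: the sigma-algebras at times increasing to t have the same union as those at
    all earlier times, and left-continuity says that this union generates F_t. *)
Lemma condprob_left_cvg t (eps : R) : left_continuous_filtration T F ->
  (0 <= t <= T)%R -> (0 < eps)%R ->
  exists2 del : R, (0 < del)%R & forall s, (0 <= s <= t)%R -> (t - del < s)%R ->
    forall c c', is_condprob P (F s) B c -> is_condprob P (F t) B c' ->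
      \int[P]_w `|c w - c' w|%:E <= eps%:E.
Proof.
move=> hL tT eps0; have [t0 tT'] := andP tT.
have [tE0|tne0] := eqVneq t 0%R.
  exists 1%R => // s /andP[s0 st] _ c c' hc hc'.
  have sE : s = t by apply/le_anti; rewrite st tE0 s0.
  rewrite sE in hc.
  by rewrite (dist0 (usual_complete tT) hc hc') lee_fin ltW.
have tgt0 : (0 < t)%R by rewrite lt_neqAle eq_sym tne0.
pose s_ n := (t - t * n.+1%:R^-1)%R.
have s_lt n : (s_ n < t)%R by rewrite ltrBlDr ltrDl mulr_gt0// invr_gt0.
have s_ge n : (0 <= s_ n)%R.
  by rewrite subr_ge0 ler_piMr// invf_le1// ler1n.
have sI n : (0 <= s_ n <= T)%R by rewrite s_ge (le_trans (ltW (s_lt n))).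
have [cc hcc] := condprobs.
have e20 : (0 < (eps / 2) ^+ 2)%R by rewrite exprn_gt0// divr_gt0.
have inc n k : (n <= k)%N -> F (s_ n) `<=` F (s_ k).
  move=> nk; apply: usual_le => //; last by case/andP: (sI k).
  by rewrite lerD2l lerN2 ler_wpM2l// natSinv_le.
have gen : F t = <<s \bigcup_n F (s_ n) >>.
  rewrite hL; last by rewrite in_itv/= tgt0.
  congr <<s _ >>; apply/seteqP; split => A.
    move=> [s /=]; rewrite in_itv/= => /andP[s0 st] FA.
    have st0 : (0 < t - s)%R by rewrite subr_gt0.
    have [n hn] := exists_natSinv_lt (divr_gt0 st0 tgt0).
    exists n => //; apply: (usual_le _ _ _ FA) => //; last by case/andP: (sI n).
    by rewrite lerBrDr -lerBrDl -ler_pdivlMl// mulrC ltW.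
  by move=> [n _ FA]; exists (s_ n) => //=; rewrite in_itv/= s_ge s_lt.
have [n hn] := condprob_phi_increasing hP mB (fun n => usual_complete (sI n))
  (usual_complete tT) (fun n => hcc _ (sI n)) (hcc _ tT) inc gen e20.
exists (t - s_ n)%R; first by rewrite subr_gt0.
move=> s /andP[s0 st] sn c c' hc hc'; rewrite opprB addrC subrK in sn.
have sI' : (0 <= s <= T)%R by rewrite s0 (le_trans st).
rewrite (_ : eps = 2 * (eps / 2))%R; last by rewrite mulrC divfK// pnatr_eq0.
have ht := usual_complete tT; have hs := usual_complete sI'; have hn' := usual_complete (sI n).
have Fst := usual_le s0 st tT'.
under eq_integral do rewrite distrC.
apply: (condprob_dist_le _ hs ht Fst hc hc'); first by rewrite divr_gt0.
apply: le_trans (condprob_phi_le ht ht (@subset_refl _ _) hc' (hcc _ tT)) _.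
apply: (le_trans hn); rewrite leeD2r//.
apply: (condprob_phi_le hn' hs _ (hcc _ (sI n)) hc).
by apply: usual_le (ltW sn) _ => //; case/andP: sI'.
Qed.

End filtration.

Section condexp_filtration.
Context {R : realType} {d : measure_display} {Omega : measurableType d}.
Variable P : probability Omega R.
Hypothesis hP : complete_sub P d.-measurable.
Local Open Scope ereal_scope.

(** For values in [0, 1] the m-th power is at most the function itself, so L^1 convergence of
    conditional probabilities upgrades to L^m. *)
Lemma Lnorm_le_power (h : Omega -> \bar R) (m : R) : (1 <= m)%R ->
  measurable_fun setT h -> (forall w, 0 <= h w <= 1) ->
  'N[P]_m%:E[h] <= (\int[P]_w h w) `^ m^-1.
Proof.
move=> m1 mh h01; have m0 : (0 < m)%R by rewrite (lt_le_trans ltr01).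
have h0 w : 0 <= h w by have /andP[] := h01 w.
rewrite unlock; apply: gt0_ler_poweR; rewrite ?invr_ge0 ?(ltW m0)//.
- by rewrite in_itv/= leey andbT; apply: integral_ge0 => w _; exact: poweR_ge0.
- by rewrite in_itv/= leey andbT; exact: integral_ge0.
apply: ge0_le_integral => //.
- by move=> w _; exact: poweR_ge0.
- exact: measurable_abse_poweR.
move=> w _; have /andP[hw0 hw1] := h01 w; rewrite gee0_abs//.
have hf : h w \is a fin_num by rewrite ge0_fin_numE// (le_lt_trans hw1)// ltry.
move: hw0 hw1; rewrite -(fineK hf) poweR_EFin !lee_fin => x0 x1.
have [->|xn0] := eqVneq (fine (h w)) 0%R; first by rewrite powR0// gt_eqF.
have {}x0 : (0 < fine (h w))%R by rewrite lt_neqAle eq_sym xn0.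
by rewrite -[leRHS](powRr1 (ltW x0)) ger_powR// x0.
Qed.

Variables (V : lmodType R) (N : V -> \bar R).
Hypothesis hN : enorm N.
Variable m : R.
Hypothesis m1 : (1 < m)%R.
Variables (I : Type) (Fil : set_system I) (G : I -> set (set Omega)) (G0 : set (set Omega)).
Hypothesis FFil : Filter Fil.
Hypothesis hG : \forall i \near Fil, complete_sub P (G i).
Hypothesis hG0 : complete_sub P G0.
Hypothesis scal : forall B, measurable B -> forall eps : R, (0 < eps)%R ->
  \forall i \near Fil, forall c c', is_condprob P (G i) B c -> is_condprob P G0 B c' ->
    \int[P]_w `|c w - c' w|%:E <= eps%:E.

Let m1' : 1 <= m%:E. Proof. by rewrite lee_fin ltW. Qed.

(** By linearity the claim reduces to the scalar convergence [scal] for each set of the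
    representation. All versions are quantified over, so no joint choice of versions in the index is
    needed. *)
Let condexp_simple_cvg (g : @simple_rep R _ Omega V) : simple_in N d.-measurable g ->
  forall eps : R, (0 < eps)%R -> \forall i \near Fil, forall W W',
    is_condexp P N (G i) (simple_fun g) W -> is_condexp P N G0 (simple_fun g) W' ->
    Lpnorm P N m%:E (fun w => W w - W' w)%R <= eps%:E.
Proof.
elim: g => [|[B v] g ih] sg eps eps0.
  apply: filterS hG => i hGi W W' hW hW'.
  have hsg G' : complete_sub P G' -> is_condexp P N G' (simple_fun [::]) (fun=> 0%R).
    move=> hG'; rewrite (_ : simple_fun [::] = fun=> 0%R); last first.
      by apply/funext => w; rewrite simple_fun_nil.
    by apply: condexp_cst => //; rewrite (enorm0 hN) ltry.
  rewrite (@eq_Lpnorm_ae _ _ _ _ hP _ _ hN _ m1' _ (fun=> 0%R)).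
  - by rewrite Lpnorm0// lee_fin ltW.
  - exact: (smB hN (condexp_smr hGi hW) (condexp_smr hG0 hW')).
  - apply: filterS2 (condexp_unique hP hN hGi hW (hsg _ hGi))
      (condexp_unique hP hN hG0 hW' (hsg _ hG0)) => w.
    rewrite !subr0 => h1 h2; apply/eqP; rewrite eq_le enorm_ge0// andbT.
    by rewrite (le_trans (enormB hN _ _))// h1 h2 adde0.
have [mB Nv sg'] : [/\ d.-measurable B, N v < +oo & simple_in N d.-measurable g].
  by move: sg; rewrite simple_in_cons.
have Nvf : N v \is a fin_num by rewrite ge0_fin_numE ?(enorm_ge0 hN).
(* The summand 1 keeps the divisor positive when [N v] is zero. The scalar tolerance is an m-th
   power because [Lnorm_le_power] takes an m-th root. *)
pose K := (fine (N v) + 1)%R.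
have K0 : (0 < K)%R by rewrite ltr_wpDl// fine_ge0// enorm_ge0.
have e20 : (0 < eps / 2)%R by rewrite divr_gt0.
have e30 : (0 < (eps / 2 / K) `^ m)%R by rewrite powR_gt0// divr_gt0.
apply: filterS3 hG (ih sg' _ e20) (scal mB e30) => i hGi ihi hi W W' hW hW'.
have [c hc] := condprob_exists hGi mB; have [c' hc'] := condprob_exists hG0 mB.
have [E hE] := condexp_simple_exists hP hGi hN sg'.
have [E' hE'] := condexp_simple_exists hP hG0 hN sg'.
have {}hi := hi _ _ hc hc'; have {}ihi := ihi _ _ hE hE'.
have sgE : simple_fun ((B, v) :: g) = fun w => ((\1_B w : R) *: v + simple_fun g w)%R.
  by apply/funext => w; rewrite simple_fun_cons.
rewrite sgE in hW hW'.
have hcv := condexp_condprob hGi hN mB hc Nv; have hcv' := condexp_condprob hG0 hN mB hc' Nv.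
have u := condexp_unique hP hN hGi hW (condexpD hP hN hGi hcv hE).
have u' := condexp_unique hP hN hG0 hW' (condexpD hP hN hG0 hcv' hE').
have sW := smB hN (condexp_smr hGi hW) (condexp_smr hG0 hW').
have scv := smB hN (condexp_smr hGi hcv) (condexp_smr hG0 hcv').
have sE := smB hN (condexp_smr hGi hE) (condexp_smr hG0 hE').
rewrite (splitr eps) EFinD; apply: le_trans (leeD _ ihi).
  apply: (Lpnorm_leD hP hN hN hN m1' sW scv sE).
  apply: filterS2 u u' => w h h'.
  pose z := ((c w *: v + E w) - (c' w *: v + E' w))%R.
  apply: le_trans (enorm_leDB hN _ z) _.
  rewrite (_ : _ - z = (W w - (c w *: v + E w)) - (W' w - (c' w *: v + E' w)))%R; last first.
    by rewrite /z !opprB addrACA [RHS]addrACA; congr +%R; exact: addrC.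
  rewrite -[leRHS]add0e leeD//; first by rewrite (le_trans (enormB hN _ _))// h h' adde0.
  by rewrite /z opprD addrACA enormD.
have -> : Lpnorm P N m%:E (fun w => c w *: v - c' w *: v)%R =
    'N[P]_m%:E[(fun w => (fine (N v))%:E * `|c w - c' w|%:E)].
  rewrite /Lpnorm; congr ('N[P]_ _ [_]); apply/funext => w /=.
  by rewrite -scalerBl (enormZ hN) fineK// muleC.
have mcc (G' : set (set Omega)) k : complete_sub P G' -> is_condprob P G' B k -> measurable_fun setT k.
  by move=> hG' [/(gmeas_measurable hG') h _ _]; exact/measurable_EFinP.
have md : measurable_fun setT (fun w => `|c w - c' w|%:E).
  apply/measurable_EFinP; apply: measurableT_comp => //.
  by apply: measurable_funB; [exact: mcc hc|exact: mcc hc'].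
have v0 : (0 <= fine (N v))%R by rewrite fine_ge0// enorm_ge0.
apply: le_trans (LnormZ_nonneg P m1' md _ v0) _; first by move=> w; rewrite lee_fin.
have le1 : 'N[P]_m%:E[(fun w => `|c w - c' w|%:E)] <= (eps / 2 / K)%:E.
  apply: le_trans (Lnorm_le_power (ltW m1) md _) _.
    move=> w; rewrite !lee_fin normr_ge0/= ler_norml.
    have [_ /(_ w)/andP[a0 a1] _] := hc; have [_ /(_ w)/andP[b0 b1] _] := hc'.
    by lra.
  have m0 : (0 < m)%R by rewrite (lt_trans ltr01).
  rewrite (_ : (eps / 2 / K)%:E = ((eps / 2 / K) `^ m)%:E `^ m^-1); last first.
    by rewrite poweR_EFin -powRrM divff ?gt_eqF// powRr1// ltW// divr_gt0.
  apply: gt0_ler_poweR hi; rewrite ?invr_ge0 ?(ltW m0)//.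
    by rewrite in_itv/= leey andbT; apply: integral_ge0 => w _; rewrite lee_fin.
  by rewrite in_itv/= leey andbT lee_fin powR_ge0.
apply: le_trans (lee_wpmul2l _ le1) _; first by rewrite lee_fin.
rewrite -EFinM lee_fin mulrA ler_pdivrMr// [leLHS]mulrC ler_wpM2l ?(ltW e20)//.
by rewrite lerDl.
Qed.

(** A three-epsilon argument: the L^m contraction makes the replacement of [Z] by a simple function
    uniform in the sigma-algebra. *)
Lemma condexp_Lp_cvg (Z : Omega -> V) : strongly_measurable P N d.-measurable Z ->
  Lpnorm P N m%:E Z < +oo ->
  forall eps : R, (0 < eps)%R -> \forall i \near Fil, forall W W',
    is_condexp P N (G i) Z W -> is_condexp P N G0 Z W' ->
    Lpnorm P N m%:E (fun w => W w - W' w)%R <= eps%:E.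
Proof.
move=> sZ Zy eps eps0.
have e30 : (0 < eps / 3)%R by rewrite divr_gt0.
have [g sg [_ cv]] := sm_Lp_approx hN hP (ltW m1) sZ Zy.
move/cvge0P : cv => /(_ (fun=> Lpnorm_ge0 _ _ _ _) _ e30)[n _ /(_ n (leqnn n)) hn].
apply: filterS2 hG (condexp_simple_cvg (sg n) e30) => i hGi hi W W' hW hW'.
have [E hE] := condexp_simple_exists hP hGi hN (sg n).
have [E' hE'] := condexp_simple_exists hP hG0 hN (sg n).
have {}hi := hi _ _ hE hE'.
have [sW sW'] := (condexp_smr hGi hW, condexp_smr hG0 hW').
have [sE sE'] := (condexp_smr hGi hE, condexp_smr hG0 hE').
have l1 := le_trans (condexp_Lpnorm_le hP hGi hN m1 (condexpB hP hN hGi hW hE)) hn.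
have l2 := le_trans (condexp_Lpnorm_le hP hG0 hN m1 (condexpB hP hN hG0 hW' hE')) hn.
rewrite (_ : eps = eps / 3 + (eps / 3 + eps / 3))%R; last by field.
rewrite !EFinD; apply: le_trans (Lpnorm_triangle hP hN m1' sW sW' sE) _.
apply: leeD l1 _; apply: le_trans (Lpnorm_triangle hP hN m1' sE sW' sE') _.
by apply: leeD hi _; rewrite Lpnorm_subC.
Qed.

End condexp_filtration.

(** * Convergence of L^p paths *)

Section Lp_convergence.
Context {R : realType} {d : measure_display} {Omega : measurableType d}.
Variable P : probability Omega R.
Hypothesis hP : complete_sub P d.-measurable.
Local Open Scope ereal_scope.
Local Notation in_Lp N p := (in_Lp P N p d.-measurable).

Lemma in_LpD (V : lmodType R) (N : V -> \bar R) p (f h : Omega -> V) : enorm N ->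
  1 <= p -> in_Lp N p f -> in_Lp N p h -> in_Lp N p (fun w => f w + h w)%R.
Proof.
move=> hN p1 [sf fy] [sh hy]; split; first exact: smD.
by rewrite (le_lt_trans (LpnormD hP hN p1 sf sh))// lte_add_pinfty.
Qed.

Lemma in_LpB (V : lmodType R) (N : V -> \bar R) p (f h : Omega -> V) : enorm N ->
  1 <= p -> in_Lp N p f -> in_Lp N p h -> in_Lp N p (fun w => f w - h w)%R.
Proof.
move=> hN p1 [sf fy] [sh hy]; split; first exact: smB.
by rewrite (le_lt_trans (LpnormB hP hN p1 sf sh))// lte_add_pinfty.
Qed.

Lemma Lpnorm_map (U W : lmodType R) (NU : U -> \bar R) (NW : W -> \bar R) p
    (T : U -> W) (c : R) (f : Omega -> U) : enorm NU -> enorm NW -> 1 <= p ->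
  (0 <= c)%R -> linear_on [set u | NU u < +oo] T ->
  (forall u, NU u < +oo -> NW (T u) <= c%:E * NU u) ->
  strongly_measurable P NU d.-measurable f ->
  Lpnorm P NW p (T \o f) <= c%:E * Lpnorm P NU p f.
Proof.
move=> hU hW p1 c0 lT hT sf.
have sTf := sm_map hU hW c0 lT hT sf.
apply: (Lpnorm_leZ hP hW hU p1 c0 sTf sf).
by apply: filterS (sm_lty hU sf) => w; exact: hT.
Qed.

Lemma in_Lp_map (U W : lmodType R) (NU : U -> \bar R) (NW : W -> \bar R) p
    (T : U -> W) (c : R) (f : Omega -> U) : enorm NU -> enorm NW -> 1 <= p ->
  (0 <= c)%R -> linear_on [set u | NU u < +oo] T ->
  (forall u, NU u < +oo -> NW (T u) <= c%:E * NU u) ->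
  in_Lp NU p f -> in_Lp NW p (T \o f).
Proof.
move=> hU hW p1 c0 lT hT [sf fy]; split; first exact: (sm_map hU hW c0 lT hT sf).
rewrite (le_lt_trans (Lpnorm_map hU hW p1 c0 lT hT sf))// lte_mul_pinfty//.
Qed.

Lemma in_Lp_pair (U V W : lmodType R) (NU : U -> \bar R) (NV : V -> \bar R)
    (NW : W -> \bar R) (B : U -> V -> W) p f h : enorm NU -> enorm NV -> enorm NW ->
  pairing NU NV NW B -> 1 <= p -> in_Lp NU +oo f -> in_Lp NV p h ->
  in_Lp NW p (fun w => B (f w) (h w)).
Proof.
move=> hU hV hW hB p1 [sf fy] [sh hy]; split.
  exact: (sm_pair hU hV hW hB (complete_subI hP) sf sh).
rewrite (le_lt_trans (Lpnorm_pair hP hU hV hW hB p1 sf sh fy))//.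
by rewrite lte_mul_pinfty ?Lpnorm_ge0// ge0_fin_numE// Lpnorm_ge0.
Qed.

Lemma Lpnorm_pairB_le (U V W : lmodType R) (NU : U -> \bar R) (NV : V -> \bar R)
    (NW : W -> \bar R) (B : U -> V -> W) p f f' h h' :
  enorm NU -> enorm NV -> enorm NW -> pairing NU NV NW B -> 1 <= p ->
  in_Lp NU +oo f -> in_Lp NU +oo f' -> in_Lp NV p h -> in_Lp NV p h' ->
  Lpnorm P NW p (fun w => B (f w) (h w) - B (f' w) (h' w))%R <=
  Lpnorm P NU +oo (fun w => f w - f' w)%R * Lpnorm P NV p h +
  Lpnorm P NU +oo f' * Lpnorm P NV p (fun w => h w - h' w)%R.
Proof.
move=> hU hV hW hB p1 f1 f'1 h1 h'1.
have hf := in_LpB hU (leey 1) f1 f'1; have hh := in_LpB hV p1 h1 h'1.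
have b1 := Lpnorm_pair hP hU hV hW hB p1 hf.1 h1.1 hf.2.
have b2 := Lpnorm_pair hP hU hV hW hB p1 f'1.1 hh.1 f'1.2.
apply: le_trans (leeD b1 b2).
apply: (Lpnorm_leD hP hW hW hW p1).
- have s1 := in_Lp_pair hU hV hW hB p1 f1 h1; have s2 := in_Lp_pair hU hV hW hB p1 f'1 h'1.
  exact: (smB hW s1.1 s2.1).
- by case: (in_Lp_pair hU hV hW hB p1 hf h1).
- by case: (in_Lp_pair hU hV hW hB p1 f'1 hh).
apply: filterS2 (filterI (sm_lty hU f1.1) (sm_lty hU f'1.1))
  (filterI (sm_lty hV h1.1) (sm_lty hV h'1.1)) => w [fy f'y] [hy h'y].
have eB : (B (f w) (h w) - B (f' w) (h' w) =
    B (f w - f' w) (h w) + B (f' w) (h w - h' w))%R.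
  have -> : (f w - f' w = (-1) *: f' w + f w)%R by rewrite scaleN1r addrC.
  have -> : (h w - h' w = (-1) *: h' w + h w)%R by rewrite scaleN1r addrC.
  rewrite (pairing_linl hB hy)// (pairing_linr hB f'y)// !scaleN1r.
  by rewrite [in RHS](addrC (- B (f' w) (h w))%R) [in RHS](addrC (- B (f' w) (h' w))%R) subrKA.
by rewrite eB; exact: (enormD hW).
Qed.

Lemma integral_mul_lty (U V : lmodType R) (NU : U -> \bar R) (NV : V -> \bar R) p f h :
  enorm NU -> enorm NV -> 1 <= p -> in_Lp NU +oo f -> in_Lp NV p h ->
  \int[P]_w (NU (f w) * NV (h w)) < +oo.
Proof.
move=> hU hV p1 [sf fy] [sh hy].
have c0 := Lpnorm_ge0 P NU +oo f; have cf : Lpnorm P NU +oo f \is a fin_num by rewrite ge0_fin_numE.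
have [mf mh] := (sm_measurable hU hP sf, sm_measurable hV hP sh).
apply: (@le_lt_trans _ _ (\int[P]_w ((fine (Lpnorm P NU +oo f))%:E * NV (h w)))).
  apply: ae_ge0_le_integral => //.
  - by move=> w _; rewrite mule_ge0 ?(enorm_ge0 hU) ?(enorm_ge0 hV).
  - exact: emeasurable_funM.
  - by move=> w _; rewrite mule_ge0 ?lee_fin ?fine_ge0 ?(enorm_ge0 hV).
  - exact: measurable_funeM.
  apply: filterS (Lpnorm_infty_ae P f hU) => w le _.
  by rewrite fineK// lee_wpmul2r// (enorm_ge0 hV).
rewrite ge0_integralZl_EFin ?fine_ge0//; last by move=> w _; exact: (enorm_ge0 hV).
by rewrite lte_mul_pinfty ?lee_fin ?fine_ge0// (Lpnorm_integral_lty hP hV p1 sh hy).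
Qed.

Section Lcvg.
Context {I : Type}.
Implicit Types Fil : set_system I.

(** Membership in L^p is bundled with the convergence because the product estimates need it near the
    limit. The filter is arbitrary, to serve both times in [0, T] and points of [Delta2]. *)
Definition Lcvg (V : lmodType R) (N : V -> \bar R) (p : \bar R) Fil
    (f : I -> Omega -> V) (f0 : Omega -> V) : Prop :=
  [/\ \forall i \near Fil, in_Lp N p (f i), in_Lp N p f0
    & Lpnorm P N p (fun w => f i w - f0 w)%R @[i --> Fil] --> 0].

Variable Fil : set_system I.
Hypothesis FFil : Filter Fil.

Lemma Lcvg_near_le (V : lmodType R) (N : V -> \bar R) p f f0 : enorm N -> 1 <= p ->
  Lcvg N p Fil f f0 -> \forall i \near Fil, Lpnorm P N p (f i) <= 1 + Lpnorm P N p f0.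
Proof.
move=> hN p1 [hf [sf0 _] cv].
have := @cvge0_near_le1 _ _ _ FFil _ (fun i => Lpnorm_ge0 P N p (fun w => f i w - f0 w)%R) cv.
apply: filterS2 hf => i [sf _] le1.
by rewrite (le_trans (Lpnorm_leDB hP hN p1 sf sf0))// leeD2r.
Qed.

Lemma Lcvg_pair (U V W : lmodType R) (NU : U -> \bar R) (NV : V -> \bar R)
    (NW : W -> \bar R) (B : U -> V -> W) p f f0 h h0 :
  enorm NU -> enorm NV -> enorm NW -> pairing NU NV NW B -> 1 <= p ->
  Lcvg NU +oo Fil f f0 -> Lcvg NV p Fil h h0 ->
  Lcvg NW p Fil (fun i w => B (f i w) (h i w)) (fun w => B (f0 w) (h0 w)).
Proof.
move=> hU hV hW hB p1 cf ch; have [sf sf0 f0c] := cf; have [sh sh0 h0c] := ch.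
split; [|exact: (in_Lp_pair hU hV hW hB)|].
  by apply: filterS2 sf sh => i; exact: (in_Lp_pair hU hV hW hB).
apply: (@squeeze_cvge0 _ _ _ FFil _ (fun i =>
   Lpnorm P NV p (h i) * Lpnorm P NU +oo (fun w => f i w - f0 w)%R +
   Lpnorm P NU +oo f0 * Lpnorm P NV p (fun w => h i w - h0 w)%R)).
- by move=> i; exact: Lpnorm_ge0.
- apply: filterS2 sf sh => i sfi shi; rewrite (muleC (Lpnorm P NV p _)).
  exact: (Lpnorm_pairB_le hU hV hW hB).
apply: cvge0D.
- by move=> i; rewrite mule_ge0 ?Lpnorm_ge0.
- by move=> i; rewrite mule_ge0 ?Lpnorm_ge0.
- apply: (cvge0M_bounded (c := 1 + Lpnorm P NV p h0)) => //.
  + by rewrite fin_numD/= ge0_fin_numE ?Lpnorm_ge0//; case: sh0.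
  + by move=> i; exact: Lpnorm_ge0.
  + by move=> i; exact: Lpnorm_ge0.
  + exact: Lcvg_near_le.
- by apply: cvge0Zl => //; rewrite ge0_fin_numE ?Lpnorm_ge0//; case: sf0.
Qed.

Lemma LcvgD (V : lmodType R) (N : V -> \bar R) p f f0 h h0 : enorm N -> 1 <= p ->
  Lcvg N p Fil f f0 -> Lcvg N p Fil h h0 ->
  Lcvg N p Fil (fun i w => f i w + h i w)%R (fun w => f0 w + h0 w)%R.
Proof.
move=> hN p1 [sf sf0 cf] [sh sh0 ch]; split; [|exact: in_LpD|].
  by apply: filterS2 sf sh => i; exact: in_LpD.
apply: (@squeeze_cvge0 _ _ _ FFil _ (fun i =>
   Lpnorm P N p (fun w => f i w - f0 w)%R + Lpnorm P N p (fun w => h i w - h0 w)%R)).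
- by move=> i; exact: Lpnorm_ge0.
- apply: filterS2 sf sh => i sfi shi.
  have -> : (fun w => f i w + h i w - (f0 w + h0 w))%R =
      (fun w => (f i w - f0 w) + (h i w - h0 w))%R.
    by apply/funext => w; rewrite opprD addrACA.
  by apply: (LpnormD hP hN p1); [case: (in_LpB hN p1 sfi sf0)|case: (in_LpB hN p1 shi sh0)].
by apply: cvge0D => // i; exact: Lpnorm_ge0.
Qed.

Lemma LcvgB (V : lmodType R) (N : V -> \bar R) p f f0 h h0 : enorm N -> 1 <= p ->
  Lcvg N p Fil f f0 -> Lcvg N p Fil h h0 ->
  Lcvg N p Fil (fun i w => f i w - h i w)%R (fun w => f0 w - h0 w)%R.
Proof.
move=> hN p1 [sf sf0 cf] [sh sh0 ch]; split; [|exact: in_LpB|].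
  by apply: filterS2 sf sh => i; exact: in_LpB.
apply: (@squeeze_cvge0 _ _ _ FFil _ (fun i =>
   Lpnorm P N p (fun w => f i w - f0 w)%R + Lpnorm P N p (fun w => h i w - h0 w)%R)).
- by move=> i; exact: Lpnorm_ge0.
- apply: filterS2 sf sh => i sfi shi.
  have -> : (fun w => f i w - h i w - (f0 w - h0 w))%R =
      (fun w => (f i w - f0 w) - (h i w - h0 w))%R.
    by apply/funext => w; rewrite !opprB addrACA [RHS]addrACA; congr +%R; exact: addrC.
  by apply: (LpnormB hP hN p1); [case: (in_LpB hN p1 sfi sf0)|case: (in_LpB hN p1 shi sh0)].
by apply: cvge0D => // i; exact: Lpnorm_ge0.
Qed.

Lemma Lcvg_le (V : lmodType R) (N M : V -> \bar R) (c : R) p f f0 : enorm N -> enorm M ->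
  1 <= p -> (0 <= c)%R -> (forall v, M v <= c%:E * N v) ->
  Lcvg N p Fil f f0 -> Lcvg M p Fil f f0.
Proof.
move=> hN hM p1 c0 le [sf sf0 cf].
have i1 g : in_Lp N p g -> in_Lp M p g.
  apply: (in_Lp_map (T := id) hN hM p1 c0); first by move=> a u v.
  by move=> u _; exact: le.
split; [by apply: filterS sf => i; exact: i1|exact: i1|].
apply: (@squeeze_cvge0 _ _ _ FFil _ (fun i => c%:E * Lpnorm P N p (fun w => f i w - f0 w)%R)).
- by move=> i; exact: Lpnorm_ge0.
- apply: filterS sf => i sfi.
  have sd := in_LpB hN p1 sfi sf0.
  apply: (Lpnorm_map (T := id) hN hM p1 c0 _ _ sd.1); first by move=> a u v.
  by move=> u _; exact: le.
exact: cvge0Zl.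
Qed.

Lemma Lcvg_ae (V : lmodType R) (N : V -> \bar R) p f f' f0 f0' : enorm N -> 1 <= p ->
  (\forall i \near Fil, {ae P, forall w, N (f i w - f' i w)%R = 0}) ->
  {ae P, forall w, N (f0 w - f0' w)%R = 0} ->
  Lcvg N p Fil f f0 -> Lcvg N p Fil f' f0'.
Proof.
move=> hN p1 ef ef0 [sf sf0 cf].
have i1 g g' : {ae P, forall w, N (g w - g' w)%R = 0} -> in_Lp N p g -> in_Lp N p g'.
  move=> eg [sg gy]; split; first exact: (sm_ae hN eg).
  by rewrite -(eq_Lpnorm_ae hP hN p1 sg eg).
split; [by apply: filterS2 ef sf => i; exact: i1|exact: i1 sf0|].
apply: (@squeeze_cvge0 _ _ _ FFil _ (fun i => Lpnorm P N p (fun w => f i w - f0 w)%R)) => //.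
- by move=> i; exact: Lpnorm_ge0.
- apply: filterS2 ef sf => i efi sfi; rewrite le_eqVlt; apply/orP; left; apply/eqP.
  symmetry; apply: (eq_Lpnorm_ae hP hN p1); first by case: (in_LpB hN p1 sfi sf0).
  apply: filterS2 efi ef0 => w e1 e2; apply/eqP; rewrite eq_le enorm_ge0// andbT.
  rewrite (_ : f i w - f0 w - (f' i w - f0' w) = (f i w - f' i w) - (f0 w - f0' w))%R; last first.
    by rewrite !opprB addrACA [RHS]addrACA; congr +%R; exact: addrC.
  by rewrite (le_trans (enormB hN _ _))// e1 e2 adde0.
Qed.

End Lcvg.

Lemma Lcvg_comp (I J : Type) (FI : set_system I) (FJ : set_system J) (g : J -> I)
    (V : lmodType R) (N : V -> \bar R) p f f0 : g @ FJ `=>` FI ->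
  Lcvg N p FI f f0 -> Lcvg N p FJ (f \o g) f0.
Proof.
move=> cg [sf sf0 cf]; split => //; first exact: (cg _ sf).
by apply: cvg_trans cf => A hA; exact: (cg _ hA).
Qed.

End Lp_convergence.

Section path_spaces.
Context {R : realType} {d : measure_display} {Omega : measurableType d}.
Variables (P : probability Omega R) (T : R).
Hypothesis hP : complete_sub P d.-measurable.
Local Open Scope ereal_scope.

Section one_space.
Variables (V : lmodType R) (N : V -> \bar R) (p : \bar R).
Hypotheses (hN : enorm N) (p1 : 1 <= p).
Implicit Types (Y : R -> Omega -> V) (A : R -> R -> Omega -> V).
Local Notation Lp := (Lpnorm P N p).

Lemma CL_Lcvg Y : CL P N p T Y <-> forall t, (0 <= t <= T)%R ->
  Lcvg P N p (within `[0%R, T] (nbhs t)) Y (Y t).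
Proof.
have w (t : R) (Q : set R) : (forall s, (0 <= s <= T)%R -> Q s) ->
    (within `[0%R, T] (nbhs t)) Q.
  by move=> hQ; apply: nearW => s /=; rewrite in_itv/=; exact: hQ.
split=> [[hY cY] t tT|hY].
  by split; [apply: w => s sT; apply: hY|exact: hY|exact: cY].
by split => t tT; have [] := hY t tT.
Qed.

Lemma CL_in_Lp Y t : CL P N p T Y -> (0 <= t <= T)%R -> in_Lp P N p d.-measurable (Y t).
Proof. by move=> [hY _] tT; exact: hY. Qed.

Lemma sup_norm_ub Y t : (0 <= t <= T)%R -> Lp (Y t) <= sup_norm P N p T Y.
Proof. by move=> tT; apply: ereal_sup_ubound; exists t => //=; rewrite in_itv. Qed.

Lemma sup_norm_le Y (K : \bar R) : (forall t, (0 <= t <= T)%R -> Lp (Y t) <= K) ->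
  sup_norm P N p T Y <= K.
Proof. by move=> h; apply: ge_ereal_sup => _ [t tT <-]; apply: h; move: tT => /=; rewrite in_itv. Qed.

Lemma holder_norm_ub (b : R) A s t : (0 <= s < t)%R -> (t <= T)%R ->
  Lp (A s t) <= holder_norm P N p T b A * ((t - s) `^ b)%:E.
Proof.
move=> st tT; have ts0 : (0 < (t - s) `^ b)%R.
  by rewrite powR_gt0// subr_gt0; case/andP: st.
rewrite -lee_pdivrMr//; apply: ereal_sup_ubound.
by exists (s, t).
Qed.

Lemma holder_norm_le (b : R) A (K : R) :
  (forall s t, (0 <= s < t)%R -> (t <= T)%R -> Lp (A s t) <= (K * (t - s) `^ b)%:E) ->
  holder_norm P N p T b A <= K%:E.
Proof.
move=> h; apply: ge_ereal_sup => _ [[s t] /= [st tT] <-].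
have ts0 : (0 < (t - s) `^ b)%R by rewrite powR_gt0// subr_gt0; case/andP: st.
by rewrite lee_pdivrMr// -EFinM; exact: h.
Qed.

(** Finiteness of the supremum is not part of [CL]: continuity bounds the norm near each time, and
    compactness of [0, T] makes one bound serve all times. *)
Lemma sup_norm_lty Y : CL P N p T Y -> sup_norm P N p T Y < +oo.
Proof.
move=> cY; have /compact_near_coveringP cov := @segment_compact R 0%R T.
pose Q (n : nat) (t : R) := `[0%R, T]%classic t -> Lp (Y t) <= n%:R%:E.
suff /(cov nat \oo Q)[n _ hn] : forall t, `[0%R, T]%classic t ->
    \forall t' \near t & n \near \oo, Q n t'.
  apply: (@le_lt_trans _ _ n%:R%:E); last exact: ltry.
  by apply: sup_norm_le => t tT; apply: (hn n (leqnn n)); rewrite /= in_itv/=.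
move=> t /=; rewrite in_itv/= => tT.
have cv := (CL_Lcvg Y).1 cY t tT; have [_ [_ Yy] _] := cv.
have [n hn] : exists n : nat, 1 + Lp (Y t) <= n%:R%:E.
  have f : 1 + Lp (Y t) \is a fin_num by rewrite fin_numD/= ge0_fin_numE ?Lpnorm_ge0.
  exists (Num.truncn (fine (1 + Lp (Y t)))).+1; rewrite -[leLHS]fineK// lee_fin ltW//.
  exact: truncnS_gt.
have nl := Lcvg_near_le hP _ hN p1 cv.
exists ([set s | `[0%R, T]%classic s -> Lp (Y s) <= 1 + Lp (Y t)], [set k | (n <= k)%N]).
  by split; [exact: nl|exists n].
move=> [s k] /= [hs nk] sT; apply: (le_trans (hs sT)); apply: (le_trans hn).
by rewrite lee_fin ler_nat.
Qed.

End one_space.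

Lemma CL_le (V : lmodType R) (N M : V -> \bar R) (c : R) p Y : enorm N -> enorm M ->
  1 <= p -> (0 <= c)%R -> (forall v, M v <= c%:E * N v) ->
  CL P N p T Y -> CL P M p T Y.
Proof.
move=> hN hM p1 c0 le /CL_Lcvg cY; apply/CL_Lcvg => t tT.
exact: (Lcvg_le hP _ hN hM p1 c0 le (cY t tT)).
Qed.

Lemma CLD (V : lmodType R) (N : V -> \bar R) p Y Z : enorm N -> 1 <= p ->
  CL P N p T Y -> CL P N p T Z -> CL P N p T (fun t w => Y t w + Z t w)%R.
Proof.
move=> hN p1 /CL_Lcvg cY /CL_Lcvg cZ; apply/CL_Lcvg => t tT.
exact: (LcvgD hP _ hN p1 (cY t tT) (cZ t tT)).
Qed.

Section pair.
Variables (U V W : lmodType R) (NU : U -> \bar R) (NV : V -> \bar R).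
Variables (NW : W -> \bar R) (B : U -> V -> W) (p : \bar R).
Hypotheses (hU : enorm NU) (hV : enorm NV) (hW : enorm NW).
Hypotheses (hB : pairing NU NV NW B) (p1 : 1 <= p).
Variables (f : R -> Omega -> U) (h : R -> Omega -> V).
Hypotheses (cf : CL P NU +oo T f) (ch : CL P NV p T h).

Lemma CL_pair : CL P NW p T (fun t w => B (f t w) (h t w)).
Proof.
move/CL_Lcvg : cf => cf'; move/CL_Lcvg : ch => ch'; apply/CL_Lcvg => t tT.
exact: (Lcvg_pair hP _ hU hV hW hB p1 (cf' t tT) (ch' t tT)).
Qed.

Variables (a b : R).
Hypotheses (fa : forall t, (0 <= t <= T)%R -> Lpnorm P NU +oo (f t) <= a%:E).
Hypotheses (hb : forall t, (0 <= t <= T)%R -> Lpnorm P NV p (h t) <= b%:E).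

Lemma Lpnorm_pair_le t : (0 <= t <= T)%R ->
  Lpnorm P NW p (fun w => B (f t w) (h t w)) <= (a * b)%:E.
Proof.
move=> tT; have [sf fy] := CL_in_Lp cf tT; have [sh hy] := CL_in_Lp ch tT.
apply: le_trans (Lpnorm_pair hP hU hV hW hB p1 sf sh fy) _.
by rewrite EFinM lee_pmul ?Lpnorm_ge0 ?fa ?hb.
Qed.

(** The discrete Leibniz rule delta(f h) = (delta f) h_t + f_s (delta h), with the supremum of each
    factor set against the Hoelder bound of the other. *)
Lemma delta_pair_le (a' b' g : R) :
  (forall s t, (0 <= s < t)%R -> (t <= T)%R ->
    Lpnorm P NU +oo (delta f s t) <= (a' * (t - s) `^ g)%:E) ->
  (forall s t, (0 <= s < t)%R -> (t <= T)%R ->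
    Lpnorm P NV p (delta h s t) <= (b' * (t - s) `^ g)%:E) ->
  forall s t, (0 <= s < t)%R -> (t <= T)%R ->
    Lpnorm P NW p (delta (fun t w => B (f t w) (h t w)) s t) <=
    ((a' * b + a * b') * (t - s) `^ g)%:E.
Proof.
move=> df dh s t st tT.
have tI : (0 <= t <= T)%R by rewrite tT andbT; case/andP: st => s0 /ltW; exact: le_trans.
have sI : (0 <= s <= T)%R by case/andP: st => -> /ltW st /=; exact: le_trans tT.
apply: le_trans (Lpnorm_pairB_le hP hU hV hW hB p1 (CL_in_Lp cf tI) (CL_in_Lp cf sI)
  (CL_in_Lp ch tI) (CL_in_Lp ch sI)) _.
rewrite mulrDl EFinD; apply: leeD.
  rewrite mulrAC EFinM; apply: lee_pmul; rewrite ?Lpnorm_ge0//; [exact: df|exact: hb].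
rewrite -mulrA EFinM; apply: lee_pmul; rewrite ?Lpnorm_ge0//; [exact: fa|exact: dh].
Qed.

End pair.

Lemma deltaD_le (V : lmodType R) (N : V -> \bar R) p (Y Z : R -> Omega -> V) (a b g : R) :
  enorm N -> 1 <= p -> CL P N p T Y -> CL P N p T Z ->
  (forall s t, (0 <= s < t)%R -> (t <= T)%R ->
    Lpnorm P N p (delta Y s t) <= (a * (t - s) `^ g)%:E) ->
  (forall s t, (0 <= s < t)%R -> (t <= T)%R ->
    Lpnorm P N p (delta Z s t) <= (b * (t - s) `^ g)%:E) ->
  forall s t, (0 <= s < t)%R -> (t <= T)%R ->
    Lpnorm P N p (delta (fun t w => Y t w + Z t w)%R s t) <=
    ((a + b) * (t - s) `^ g)%:E.
Proof.
move=> hN p1 cY cZ dY dZ s t st tT.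
have tI : (0 <= t <= T)%R by rewrite tT andbT; case/andP: st => s0 /ltW; exact: le_trans.
have sI : (0 <= s <= T)%R by case/andP: st => -> /ltW st /=; exact: le_trans tT.
have -> : delta (fun t w => Y t w + Z t w)%R s t = (fun w => delta Y s t w + delta Z s t w)%R.
  by apply/funext => w; rewrite /delta opprD addrACA.
have [sY _] := in_LpB hP hN p1 (CL_in_Lp cY tI) (CL_in_Lp cY sI).
have [sZ _] := in_LpB hP hN p1 (CL_in_Lp cZ tI) (CL_in_Lp cZ sI).
apply: le_trans (LpnormD hP hN p1 sY sZ) _.
by rewrite mulrDl EFinD leeD ?dY ?dZ.
Qed.

End path_spaces.

Section condexp_paths.
Context {R : realType} {d : measure_display} {Omega : measurableType d}.
Variable P : probability Omega R.
Hypothesis hP : complete_sub P d.-measurable.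
Local Open Scope ereal_scope.
Local Notation in_Lp N p := (in_Lp P N p d.-measurable).

(* [f] is its own conditional expectation given [G] for the weaker norm [N], hence also
   for [M]. *)
Lemma sm_stronger_norm (V : lmodType R) (N M : V -> \bar R) (c : R) G f :
  complete_sub P G -> enorm N -> enorm M -> ecomplete M -> ecomplete N -> edefinite N ->
  (0 <= c)%R -> (forall v, N v <= c%:E * M v) ->
  strongly_measurable P M d.-measurable f -> \int[P]_w M (f w) < +oo ->
  strongly_measurable P N G f -> strongly_measurable P M G f.
Proof.
move=> hG hN hM cM cN dN c0 le sf fy sNf.
have [W hW] := condexp_exists hP hG hM cM sf fy.
have hW' := condexp_norm_le hP hG hM hN c0 le hW.
have fNy : \int[P]_w N (f w) < +oo.
  have [_ mf] := (sm_measurable hN hP (sm_subset (complete_sub_measurable hG) sNf),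
    sm_measurable hM hP sf).
  apply: (@le_lt_trans _ _ (\int[P]_w (c%:E * M (f w)))).
    apply: ge0_le_integral => //.
    - by move=> w _; exact: (enorm_ge0 hN).
    - exact: (sm_measurable hN hP (sm_subset (complete_sub_measurable hG) sNf)).
    - exact: measurable_funeM.
  rewrite ge0_integralZl_EFin//; last by move=> w _; exact: (enorm_ge0 hM).
  by rewrite lte_mul_pinfty.
have hf := condexp_self hP hN hG cN sNf fNy.
apply: (sm_ae hM _ (condexp_smG hW)).
apply: filterS (condexp_unique hP hN hG hW' hf) => w /dN ->.
exact: (enorm0 hM).
Qed.

Lemma condexp_is (V : lmodType R) (N : V -> \bar R) p G Z : complete_sub P G ->
  enorm N -> ecomplete N -> 1 <= p -> in_Lp N p Z -> is_condexp P N G Z (condexp P N G Z).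
Proof.
move=> hG hN cN p1 [sZ Zy].
have [W hW] := condexp_exists hP hG hN cN sZ (Lpnorm_integral_lty hP hN p1 sZ Zy).
by apply: (@xgetPex _ _ [set W | is_condexp P N G Z W]); exists W.
Qed.

Lemma condexp_in_Lp (V : lmodType R) (N : V -> \bar R) (m : R) G Z W : complete_sub P G ->
  enorm N -> (1 < m)%R -> in_Lp N m%:E Z -> is_condexp P N G Z W -> in_Lp N m%:E W.
Proof.
move=> hG hN m1 [sZ Zy] hW; split; first exact: condexp_smr hW.
exact: le_lt_trans (condexp_Lpnorm_le hP hG hN m1 hW) Zy.
Qed.

(** Integrand and sigma-algebra both move. The L^m contraction handles E_i(Z_i - Z_0), and
    [condexp_Lp_cvg] handles E_i Z_0 - E_0 Z_0, where the integrand is fixed. *)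
Lemma condexp_Lcvg (I : Type) (Fil : set_system I) (V : lmodType R) (N : V -> \bar R)
    (m : R) (G : I -> set (set Omega)) G0 Z Z0 E E0 : Filter Fil ->
  enorm N -> ecomplete N -> (1 < m)%R ->
  (\forall i \near Fil, complete_sub P (G i)) -> complete_sub P G0 ->
  (forall B, measurable B -> forall eps : R, (0 < eps)%R ->
    \forall i \near Fil, forall c c', is_condprob P (G i) B c -> is_condprob P G0 B c' ->
      \int[P]_w `|c w - c' w|%:E <= eps%:E) ->
  Lcvg P N m%:E Fil Z Z0 ->
  (\forall i \near Fil, is_condexp P N (G i) (Z i) (E i)) -> is_condexp P N G0 Z0 E0 ->
  Lcvg P N m%:E Fil E E0.
Proof.
move=> FFil hN cN m1 hG hG0 scal [hZ hZ0 cZ] hE hE0.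
have m1' : 1 <= m%:E by rewrite lee_fin ltW.
have lE0 := condexp_in_Lp hG0 hN m1 hZ0 hE0.
have lE : \forall i \near Fil, in_Lp N m%:E (E i).
  by apply: filterS3 hG hZ hE => i hGi hZi; exact: condexp_in_Lp.
split => //; apply/cvge0P; first by move=> i; exact: Lpnorm_ge0.
move=> eps eps0; have e20 : (0 < eps / 2)%R by rewrite divr_gt0.
move/cvge0P : cZ => /(_ (fun i => Lpnorm_ge0 _ _ _ _) _ e20) cZ.
have cv := condexp_Lp_cvg hP hN m1 FFil hG hG0 scal hZ0.1 hZ0.2 e20.
have fI := @filterI _ Fil FFil.
have h := fI _ _ (fI _ _ (fI _ _ hG hE) (fI _ _ cZ lE)) cv.
apply: (@filterS _ Fil FFil _ _ _ h) => i [[[hGi hEi] [cZi lEi]] cvi].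
have [W hW] := condexp_exists hP hGi hN cN hZ0.1
  (Lpnorm_integral_lty hP hN m1' hZ0.1 hZ0.2).
apply: le_trans (Lpnorm_triangle hP hN m1' lEi.1 lE0.1 (condexp_smr hGi hW)) _.
rewrite (splitr eps) EFinD leeD//; last exact: cvi.
exact: le_trans (condexp_Lpnorm_le hP hGi hN m1 (condexpB hP hN hGi hEi hW)) cZi.
Qed.

(** Two pairs of norms appear because R^G is estimated as an operator from H_{gamma1}, whereas G_s
    acts at the lower level where R^Y lives. *)
Lemma condexp_product (U V W : lmodType R) (NU NU' : U -> \bar R) (NV NV' : V -> \bar R)
    (NW : W -> \bar R) (B : U -> V -> W) p G (g rg eg : Omega -> U) (y ry ey : Omega -> V)
    (z ez : Omega -> W) :
  complete_sub P G -> enorm NU -> enorm NU' -> enorm NV -> enorm NV' -> enorm NW ->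
  ecomplete NW -> pairing NU NV NW B -> pairing NU' NV' NW B -> 1 <= p ->
  in_Lp NU +oo rg -> in_Lp NU +oo eg -> is_condexp P NU G rg eg ->
  strongly_measurable P NV G y -> in_Lp NV p y ->
  in_Lp NV' p ry -> in_Lp NV' p ey -> is_condexp P NV' G ry ey ->
  strongly_measurable P NU' G g -> in_Lp NU' +oo g ->
  is_condexp P NW G z ez ->
  is_condexp P NW G (fun w => B (rg w) (y w) + B (g w) (ry w) + z w)%R
    (fun w => B (eg w) (y w) + B (g w) (ey w) + ez w)%R.
Proof.
move=> hG hU hU' hV hV' hW cW hB hB' p1 lrg leg hrg sy ly lry ley hry sg lg hz.
apply: (condexpD hP hW hG _ hz); apply: (condexpD hP hW hG).
  apply: (condexp_pull_out hP hG hV hU hW (pairing_flip hB) cW sy hrg).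
    by under eq_integral do rewrite muleC; exact: integral_mul_lty ly.
  by under eq_integral do rewrite muleC; exact: integral_mul_lty ly.
apply: (condexp_pull_out hP hG hU' hV' hW hB' cW sg hry).
  exact: (integral_mul_lty hP hU' hV' p1 lg lry).
exact: (integral_mul_lty hP hU' hV' p1 lg ley).
Qed.

End condexp_paths.

(** * The product rule *)

Section triangle_domain.
Context {R : realType}.
Variable T : R.
Implicit Types (q : R * R) (J : R * R -> set (R * R)).

Lemma nbhs_fst q (Q : set R) : nbhs q.1 Q -> nbhs q [set r | Q r.1].
Proof. by case: q => s t /= hQ; exact: (@cvg_fst _ _ (nbhs s) (nbhs t) _ Q hQ). Qed.

Lemma nbhs_snd q (Q : set R) : nbhs q.2 Q -> nbhs q [set r | Q r.2].
Proof. by case: q => s t /= hQ; exact: (@cvg_snd _ _ (nbhs s) (nbhs t) _ Q hQ). Qed.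

Lemma Delta2_fst q : Delta2 T q -> 0 <= q.1 <= T.
Proof. by case=> /andP[-> qq] /(le_trans qq) ->. Qed.

Lemma Delta2_snd q : Delta2 T q -> 0 <= q.2 <= T.
Proof. by case=> /andP[h qq] ->; rewrite (le_trans h qq). Qed.

Lemma within_Delta2_fst q J :
  (fst : R * R -> R) r @[r --> within (Delta2 T `&` J q) (nbhs q)] `=>`
    within `[0, T] (nbhs q.1).
Proof.
move=> Q hQ; apply: filterS (nbhs_fst hQ) => r /= + [/Delta2_fst rT _]; apply.
by rewrite in_itv.
Qed.

Lemma within_Delta2_snd q J :
  (snd : R * R -> R) r @[r --> within (Delta2 T `&` J q) (nbhs q)] `=>`
    within `[0, T] (nbhs q.2).
Proof.
move=> Q hQ; apply: filterS (nbhs_snd hQ) => r /= + [/Delta2_snd rT _]; apply.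
by rewrite in_itv.
Qed.

End triangle_domain.

Section condprob_along.
Context {R : realType} {d : measure_display} {Omega : measurableType d}.
Variables (P : probability Omega R) (T : R) (F : R -> set (set Omega)).
Hypotheses (T0 : 0 < T) (hF : usual_filtration P T F).
Local Open Scope ereal_scope.

(** With [J] as a parameter, one proof of the product rule yields both continuity from the right
    and, for left-continuous filtrations, continuity on the whole triangle. *)
Definition condprob_cvg_along (J : R * R -> set (R * R)) : Prop :=
  forall q, Delta2 T q -> forall B, measurable B -> forall eps : R, (0 < eps)%R ->
    \forall r \near within (Delta2 T `&` J q) (nbhs q), forall c c',
      is_condprob P (F r.1) B c -> is_condprob P (F q.1) B c' ->
      \int[P]_w `|c w - c' w|%:E <= eps%:E.

Lemma condprob_cvg_right_points : condprob_cvg_along right_points.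
Proof.
move=> q qD B mB eps eps0.
have [del del0 h] := condprob_right_cvg T0 hF mB (Delta2_fst qD) eps0.
have lt : nbhs q.1 [set s | (s < q.1 + del)%R].
  by apply: open_nbhs_nbhs; split; [exact: open_lt|rewrite /= ltrDl].
apply: filterS (nbhs_fst lt) => r /= rlt [rD qr] c c'.
by apply: h => //; rewrite qr; case/andP: (Delta2_fst rD).
Qed.

Lemma condprob_cvg_all_points : left_continuous_filtration T F ->
  condprob_cvg_along all_points.
Proof.
move=> hL q qD B mB eps eps0.
have [del del0 h] := condprob_right_cvg T0 hF mB (Delta2_fst qD) eps0.
have [del' del'0 h'] := condprob_left_cvg T0 hF mB hL (Delta2_fst qD) eps0.
have lt : nbhs q.1 [set s | (s < q.1 + del)%R].
  by apply: open_nbhs_nbhs; split; [exact: open_lt|rewrite /= ltrDl].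
have gt : nbhs q.1 [set s | (q.1 - del' < s)%R].
  by apply: open_nbhs_nbhs; split; [exact: open_gt|rewrite /= ltrBlDr ltrDl].
apply: filterS2 (nbhs_fst lt) (nbhs_fst gt) => r /= rlt rgt [rD _] c c'.
have /andP[r0 rT] := Delta2_fst rD.
have [qr|/ltW rq] := leP q.1 r.1; first by apply: h => //; rewrite qr.
by apply: h' => //; rewrite r0.
Qed.

End condprob_along.

Section slices.
Context {R : realType}.
Variable H : monotone_family R.
Local Open Scope ereal_scope.

Lemma onorm_pairing (e1 e2 : nat) (g1 g2 : R) :
  pairing (@onorm R H e1 e2 g1 g2) (@hnorme R H e1 g1) (@hnorme R H e2 g2) (fun f u => f u).
Proof. exact: pairing_apply (hnorme_enorm _ _ _) (hnorme_enorm _ _ _). Qed.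

Lemma onorm_pairing_comp (e1 e2 e : nat) (g1 g2 : R) :
  pairing (@onorm R H e1 e2 g1 g2) (@hnormee R H e1 e g1) (@hnormee R H e2 e g2)
    (fun f u x => f (u x)).
Proof.
exact: pairing_comp euclid_enorm (hnorme_enorm _ _ _) (hnorme_enorm _ _ _) euclid_lty.
Qed.

Lemma onorme_pairing (e1 e2 e : nat) (g1 g2 : R) :
  pairing (@onorme R H e1 e2 e g1 g2) (@hnorme R H e1 g1) (@hnormee R H e2 e g2)
    (fun f u => f u).
Proof. exact: pairing_apply (hnorme_enorm _ _ _) (hnormee_enorm _ _ _ _). Qed.

Lemma hnorme_slice_le (e1 e : nat) (g : R) (x : 'rV[R]_e) :
  exists2 c : R, (0 <= c)%R & forall f : 'rV[R]_e -> 'rV[R]_e1 -> mf_amb H,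
    hnormee g f < +oo -> hnorme g (f x) <= c%:E * hnormee g f.
Proof.
exists (fine (euclid x)); first by rewrite fine_ge0// (enorm_ge0 euclid_enorm).
move=> f fy; rewrite muleC fineK ?(enorm_fin_num euclid_enorm) ?euclid_lty//.
by apply: (opnorm_apply euclid_enorm (hnorme_enorm _ _ _) fy); exact: euclid_lty.
Qed.

Lemma onorm_slice_le (e1 e2 e : nat) (g1 g2 : R) (x : 'rV[R]_e) :
  exists2 c : R, (0 <= c)%R &
    forall f : ('rV[R]_e1 -> mf_amb H) -> 'rV[R]_e -> 'rV[R]_e2 -> mf_amb H,
    onorme g1 g2 f < +oo -> onorm g1 g2 (f ^~ x) <= c%:E * onorme g1 g2 f.
Proof.
exists (fine (euclid x)); first by rewrite fine_ge0// (enorm_ge0 euclid_enorm).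
move=> f fy; rewrite muleC fineK ?(enorm_fin_num euclid_enorm) ?euclid_lty//.
apply: (opnorm_slice_le (hnorme_enorm _ _ _) euclid_enorm (hnorme_enorm _ _ _) _ fy).
exact: euclid_lty.
Qed.

End slices.

(** The splitting of R^{GY}, where a = G_t Y_t, b = G_s Y_s, p = G_t Y_s, q = G_s Y_t, while c and
    d' stand for G_s (Y'_s delta X) and (G'_s Y_s) delta X. *)
Lemma remainder_product (V : zmodType) (a b c d' p q : V) :
  a - b - (c + d') = (p - b - d') + (q - b - c) + ((a - q) - (p - b)).
Proof.
rewrite !opprB !opprD !addrA.
rewrite [RHS](ACl (7*2*6*3*(1*10)*(4*8)*(5*9)))%AC/=.
by rewrite !subrr ?addrN ?addNr !addr0.
Qed.

Section summands.
Context {R : realType}.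
Local Open Scope ereal_scope.

Let addl (x a b : \bar R) : x <= a -> 0 <= b -> x <= a + b.
Proof. by move=> xa b0; rewrite (le_trans xa)// leeDl. Qed.

Let addr (x a b : \bar R) : x <= b -> 0 <= a -> x <= a + b.
Proof. by move=> xa b0; rewrite (le_trans xa)// leeDr. Qed.

Ltac le_summand := first [exact: lexx
  | apply: addl; [le_summand|by rewrite ?adde_ge0]
  | apply: addr; [le_summand|by rewrite ?adde_ge0]].

(* The sums are bracketed as in [DLH_norm] and [DLop_norm]. *)
Lemma le_sum5 (x1 x2 x3 x4 x5 : \bar R) :
  0 <= x1 -> 0 <= x2 -> 0 <= x3 -> 0 <= x4 -> 0 <= x5 ->
  let S := x1 + x2 + (x3 + x4) + x5 in
  [/\ x1 <= S, x2 <= S, x3 <= S, x4 <= S & x5 <= S].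
Proof. by move=> h1 h2 h3 h4 h5 S; rewrite /S; split; le_summand. Qed.

Lemma le_sum10 (x1 x2 x3 x4 x5 x6 x7 x8 x9 x10 : \bar R) :
  0 <= x1 -> 0 <= x2 -> 0 <= x3 -> 0 <= x4 -> 0 <= x5 ->
  0 <= x6 -> 0 <= x7 -> 0 <= x8 -> 0 <= x9 -> 0 <= x10 ->
  let S := x1 + x2 + x3 + (x4 + x5 + x6) + (x7 + x8 + x9) + x10 in
  [/\ x1 <= S, x2 <= S, x3 <= S, x4 <= S & x5 <= S] /\
  [/\ x6 <= S, x7 <= S, x8 <= S, x9 <= S & x10 <= S].
Proof. by move=> h1 h2 h3 h4 h5 h6 h7 h8 h9 h10 S; rewrite /S; split; split; le_summand. Qed.

End summands.

(** * Estimates for the product of a controlled operator family and a controlled path *)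

Section product_rule.
Context {R : realType} {d : measure_display} {Omega : measurableType d}.
Variables (P : probability Omega R) (T : R) (F : R -> set (set Omega)).
Variable H : monotone_family R.
Variables (e e1 e2 : nat) (X : R -> 'rV[R]_e) (m beta beta' gamma1 gamma2 : R).
Variables (Y : R -> Omega -> 'rV[R]_e1 -> mf_amb H).
Variables (Y' : R -> Omega -> 'rV[R]_e -> 'rV[R]_e1 -> mf_amb H).
Variables (G : R -> Omega -> ('rV[R]_e1 -> mf_amb H) -> 'rV[R]_e2 -> mf_amb H).
Variables (G' : R -> Omega -> ('rV[R]_e1 -> mf_amb H) ->
  'rV[R]_e -> 'rV[R]_e2 -> mf_amb H).
Hypotheses (T0 : 0 < T) (hF : usual_filtration P T F).
Hypotheses (b'0 : 0 < beta') (b'b : beta' <= beta) (m1 : 1 < m).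
Hypothesis hY : DLH P T F X m beta beta' gamma1 Y Y'.
Hypothesis hG : DLop P T F X beta beta' gamma1 gamma2 G G'.
Local Open Scope ereal_scope.

Local Notation N1 := (@hnorme R H e1).
Local Notation N2 := (@hnorme R H e2).
Local Notation Ne1 := (@hnormee R H e1 e).
Local Notation Ne2 := (@hnormee R H e2 e).
Local Notation O := (@onorm R H e1 e2).
Local Notation Oe := (@onorme R H e1 e2 e).
Local Notation g1b := (gamma1 - beta)%R.
Local Notation g1b' := (gamma1 - beta')%R.
Local Notation g1bb := (gamma1 - beta - beta')%R.
Local Notation g2b := (gamma2 - beta)%R.
Local Notation g2bb := (gamma2 - beta - beta')%R.
Local Notation normG := (DLop_norm P T F X beta beta' gamma1 gamma2 G G').
Local Notation normY := (DLH_norm P T F X m beta beta' gamma1 Y Y').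

Let hP : complete_sub P d.-measurable.
Proof. exact: usual_complete_all T0 hF. Qed.

Let m1' : 1 <= m%:E.
Proof. by rewrite lee_fin ltW. Qed.

Let y1 : 1 <= +oo :> \bar R.
Proof. exact: leey. Qed.

Lemma sup_norm_ge0 (V : lmodType R) (N : V -> \bar R) p Z : 0 <= sup_norm P N p T Z.
Proof.
have T0' : (0 <= (0 : R) <= T)%R by rewrite lexx ltW.
exact: le_trans (Lpnorm_ge0 P N p (Z 0%R)) (sup_norm_ub P N p Z T0').
Qed.

Lemma holder_norm_ge0 (V : lmodType R) (N : V -> \bar R) p b A :
  0 <= holder_norm P N p T b A.
Proof.
have T0' : (0 <= (0 : R) < T)%R by rewrite lexx.
have := holder_norm_ub P N p b A T0' (lexx T).
rewrite subr0 -lee_pdivrMr ?powR_gt0// => /(le_trans _); apply.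
by rewrite mule_ge0 ?Lpnorm_ge0// lee_fin invr_ge0 powR_ge0.
Qed.

Lemma DLH_norm_lty : normY < +oo.
Proof.
have [[c1 [c2 _ h2]] [c3 [c4 _ h4]] [_ _ _ h5]] := hY.
have s1 := sup_norm_lty hP (hnorme_enorm _ _ _) m1' c1.
have s3 := sup_norm_lty hP (hnormee_enorm _ _ _ _) m1' c3.
exact: (lte_add_pinfty (lte_add_pinfty (lte_add_pinfty s1 h2) (lte_add_pinfty s3 h4)) h5).
Qed.

Lemma DLop_norm_lty : normG < +oo.
Proof.
have [[c1 [c2 _ h2]] [c3 [c4 _ h4]] [c5 [c6 _ h6]] [_ _ _ h7]] := hG.
have s1 := sup_norm_lty hP (onorm_enorm _ _ _ _ _) y1 c1.
have s2 := sup_norm_lty hP (onorm_enorm _ _ _ _ _) y1 c2.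
have s3 := sup_norm_lty hP (onorm_enorm _ _ _ _ _) y1 c3.
have s4 := sup_norm_lty hP (onorm_enorm _ _ _ _ _) y1 c4.
have s5 := sup_norm_lty hP (onorme_enorm _ _ _ _ _ _) y1 c5.
have s6 := sup_norm_lty hP (onorme_enorm _ _ _ _ _ _) y1 c6.
have q1 := lte_add_pinfty (lte_add_pinfty s1 s2) h2.
have q2 := lte_add_pinfty (lte_add_pinfty s3 s4) h4.
have q3 := lte_add_pinfty (lte_add_pinfty s5 s6) h6.
exact: (lte_add_pinfty (lte_add_pinfty (lte_add_pinfty q1 q2) q3) h7).
Qed.

Let a : R := fine normG.
Let b : R := fine normY.

Lemma DLop_norm_ge0 : 0 <= normG.
Proof. by rewrite /DLop_norm /ELop_norm !adde_ge0 ?sup_norm_ge0 ?holder_norm_ge0. Qed.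

Lemma DLH_norm_ge0 : 0 <= normY.
Proof. by rewrite /DLH_norm /ELH_norm /ELH'_norm !adde_ge0 ?sup_norm_ge0 ?holder_norm_ge0. Qed.

Let aE : a%:E = normG.
Proof. by rewrite fineK// ge0_fin_numE ?DLop_norm_ge0// DLop_norm_lty. Qed.

Let bE : b%:E = normY.
Proof. by rewrite fineK// ge0_fin_numE ?DLH_norm_ge0// DLH_norm_lty. Qed.

Let a0 : (0 <= a)%R. Proof. by rewrite -lee_fin aE DLop_norm_ge0. Qed.
Let b0 : (0 <= b)%R. Proof. by rewrite -lee_fin bE DLH_norm_ge0. Qed.

Let sup_le (V : lmodType R) (N : V -> \bar R) p Z (c : R) : sup_norm P N p T Z <= c%:E ->
  forall t, (0 <= t <= T)%R -> Lpnorm P N p (Z t) <= c%:E.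
Proof. by move=> h t tT; apply: le_trans h; exact: sup_norm_ub. Qed.

Let hol_le (V : lmodType R) (N : V -> \bar R) p g A (c : R) :
  holder_norm P N p T g A <= c%:E ->
  forall s t, (0 <= s < t)%R -> (t <= T)%R ->
    Lpnorm P N p (A s t) <= (c * (t - s) `^ g)%:E.
Proof.
move=> h s t st tT; apply: le_trans (holder_norm_ub P N p g A st tT) _.
by rewrite EFinM lee_wpmul2r// lee_fin powR_ge0.
Qed.

Local Notation sup_bound N p Z c :=
  (forall t, (0 <= t <= T)%R -> Lpnorm P N p (Z t) <= c%:E).
Local Notation hol_bound N p g A c :=
  (forall s t, (0 <= s < t)%R -> (t <= T)%R ->
    Lpnorm P N p (A s t) <= (c * (t - s) `^ g)%:E).

Let Ybounds : [/\ sup_bound (N1 gamma1) m%:E Y b, hol_bound (N1 g1b) m%:E beta (delta Y) b,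
  sup_bound (Ne1 g1b) m%:E Y' b, hol_bound (Ne1 g1bb) m%:E beta' (delta Y') b &
  hol_bound (N1 g1bb) m%:E (beta + beta')%R
    (ERY P F X beta beta' gamma1 Y Y') b].
Proof.
have [h1 h2 h3 h4 h5] := le_sum5 (sup_norm_ge0 (N1 gamma1) m%:E Y)
  (holder_norm_ge0 (N1 g1b) m%:E beta (delta Y))
  (sup_norm_ge0 (Ne1 g1b) m%:E Y') (holder_norm_ge0 (Ne1 g1bb) m%:E beta' (delta Y'))
  (holder_norm_ge0 (N1 g1bb) m%:E (beta + beta') (ERY P F X beta beta' gamma1 Y Y')).
have up x : x <= normY -> x <= b%:E by rewrite bE.
split; [exact: (sup_le (up _ h1))|exact: (hol_le (up _ h2))|exact: (sup_le (up _ h3))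
  |exact: (hol_le (up _ h4))|exact: (hol_le (up _ h5))].
Qed.

Let Gbounds :
  [/\ sup_bound (O gamma1 gamma2) +oo G a, sup_bound (O g1b g2b) +oo G a,
    hol_bound (O g1b g2b) +oo beta (delta G) a, sup_bound (O g1bb g2bb) +oo G a &
    hol_bound (O g1bb g2bb) +oo beta' (delta G) a] /\
  [/\ sup_bound (Oe gamma1 g2b) +oo G' a, sup_bound (Oe g1b' g2bb) +oo G' a,
    hol_bound (Oe g1b' g2bb) +oo beta' (delta G') a &
    hol_bound (O gamma1 g2bb) +oo (beta + beta')%R
      (ERG P F X beta beta' gamma1 gamma2 G G') a].
Proof.
have [[h1 h2 h3 _ h5] [h6 h7 h8 h9 h10]] := le_sum10
  (sup_norm_ge0 (O gamma1 gamma2) +oo G) (sup_norm_ge0 (O g1b g2b) +oo G)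
  (holder_norm_ge0 (O g1b g2b) +oo beta (delta G))
  (sup_norm_ge0 (O g1b g2b) +oo G) (sup_norm_ge0 (O g1bb g2bb) +oo G)
  (holder_norm_ge0 (O g1bb g2bb) +oo beta' (delta G))
  (sup_norm_ge0 (Oe gamma1 g2b) +oo G') (sup_norm_ge0 (Oe g1b' g2bb) +oo G')
  (holder_norm_ge0 (Oe g1b' g2bb) +oo beta' (delta G'))
  (holder_norm_ge0 (O gamma1 g2bb) +oo (beta + beta')
    (ERG P F X beta beta' gamma1 gamma2 G G')).
have up x : x <= normG -> x <= a%:E by rewrite aE.
split; split; [exact: (sup_le (up _ h1))|exact: (sup_le (up _ h2))|exact: (hol_le (up _ h3))
  |exact: (sup_le (up _ h5))|exact: (hol_le (up _ h6))|exact: (sup_le (up _ h7))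
  |exact: (sup_le (up _ h8))|exact: (hol_le (up _ h9))|exact: (hol_le (up _ h10))].
Qed.

(** Constants of the scale, kept abstract so that they are fixed before T, the probability space and
    the processes; the uniformity of the final constant rests on this. *)
Variables (C1 C2 C3 C4 C5 : R).
Hypotheses (C1_gt0 : (0 < C1)%R) (C2_gt0 : (0 < C2)%R) (C3_gt0 : (0 < C3)%R).
Hypotheses (C4_gt0 : (0 < C4)%R) (C5_gt0 : (0 < C5)%R).
Hypothesis C1_le : forall f, N1 g1b f <= C1%:E * N1 gamma1 f.
Hypothesis C2_le : forall f, N1 g1b' f <= C2%:E * N1 gamma1 f.
Hypothesis C3_le : forall (h : R) f, (0 < h)%R ->
  N1 g1b' f <= C3%:E * ((h `^ (beta' - beta))%:E * N1 g1b f + (h `^ beta')%:E * N1 gamma1 f).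
Hypothesis C4_le : forall f, Ne1 g1bb f <= C4%:E * Ne1 g1b f.
Hypothesis C5_le : forall f, N1 g1bb f <= C5%:E * N1 g1b f.

Let hN1 g : enorm (N1 g). Proof. exact: hnorme_enorm. Qed.
Let hN2 g : enorm (N2 g). Proof. exact: hnorme_enorm. Qed.
Let hNe1 g : enorm (Ne1 g). Proof. exact: hnormee_enorm. Qed.
Let hNe2 g : enorm (Ne2 g). Proof. exact: hnormee_enorm. Qed.
Let hO g g' : enorm (O g g'). Proof. exact: onorm_enorm. Qed.
Let hOe g g' : enorm (Oe g g'). Proof. exact: onorme_enorm. Qed.

Let le_embed (V : lmodType R) (N M : V -> \bar R) (c : R) p f (k : R) : enorm N -> enorm M ->
  1 <= p -> (0 < c)%R -> (forall v, M v <= c%:E * N v) ->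
  in_Lp P N p d.-measurable f -> Lpnorm P N p f <= k%:E -> Lpnorm P M p f <= (c * k)%:E.
Proof.
move=> hN hM p1 c0 le [sf _] fk.
apply: le_trans (Lpnorm_map hP hN hM p1 (ltW c0) (T := id) _ (fun u _ => le u) sf) _.
  by move=> x u v.
by rewrite EFinM lee_wpmul2l// lee_fin ltW.
Qed.

Let tI s t : (0 <= s < t)%R -> (t <= T)%R -> (0 <= t <= T)%R.
Proof. by move=> /andP[s0 /ltW st] ->; rewrite (le_trans s0). Qed.

Let sI s t : (0 <= s < t)%R -> (t <= T)%R -> (0 <= s <= T)%R.
Proof. by move=> /andP[-> /ltW st] /(le_trans st). Qed.

Let cY : CL P (N1 gamma1) m%:E T Y. Proof. by have [[]] := hY. Qed.
Let cYb : CL P (N1 g1b) m%:E T Y. Proof. by have [[_ []]] := hY. Qed.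
Let cYb' : CL P (N1 g1b') m%:E T Y.
Proof. exact: (CL_le hP (hN1 _) (hN1 _) m1' (ltW C2_gt0) C2_le cY). Qed.
Let cYbb : CL P (N1 g1bb) m%:E T Y.
Proof. exact: (CL_le hP (hN1 _) (hN1 _) m1' (ltW C5_gt0) C5_le cYb). Qed.
Let cY' : CL P (Ne1 g1b) m%:E T Y'. Proof. by have [_ []] := hY. Qed.
Let cY'bb : CL P (Ne1 g1bb) m%:E T Y'. Proof. by have [_ [_ []]] := hY. Qed.
Let cG : CL P (O gamma1 gamma2) +oo T G. Proof. by have [[]] := hG. Qed.
Let cGb : CL P (O g1b g2b) +oo T G. Proof. by have [[_ []]] := hG. Qed.
Let cGbb : CL P (O g1bb g2bb) +oo T G. Proof. by have [_ [_ []]] := hG. Qed.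
Let cG' : CL P (Oe gamma1 g2b) +oo T G'. Proof. by have [_ _ []] := hG. Qed.
Let cG'b : CL P (Oe g1b' g2bb) +oo T G'. Proof. by have [_ _ [_ []]] := hG. Qed.

Let tM t : (0 <= t <= T)%R -> t \in `[0%R, T].
Proof. by rewrite in_itv. Qed.

Let sYb t : (0 <= t <= T)%R -> strongly_measurable P (N1 g1b) (F t) (Y t).
Proof. by move=> /tM; have [[_ [_ + _]] _ _] := hY; exact. Qed.
Let sY'bb t : (0 <= t <= T)%R -> strongly_measurable P (Ne1 g1bb) (F t) (Y' t).
Proof. by move=> /tM; have [_ [_ [_ + _]] _] := hY; exact. Qed.
Let sGb t : (0 <= t <= T)%R -> strongly_measurable P (O g1b g2b) (F t) (G t).
Proof. by move=> /tM; have [[_ [_ + _]] _ _ _] := hG; exact. Qed.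
Let sGbb t : (0 <= t <= T)%R -> strongly_measurable P (O g1bb g2bb) (F t) (G t).
Proof. by move=> /tM; have [_ [_ [_ + _]] _ _] := hG; exact. Qed.
Let sG'b t : (0 <= t <= T)%R -> strongly_measurable P (Oe g1b' g2bb) (F t) (G' t).
Proof. by move=> /tM; have [_ _ [_ [_ + _]] _] := hG; exact. Qed.

Let hFt t : (0 <= t <= T)%R -> complete_sub P (F t).
Proof. exact: usual_complete hF t. Qed.

(** To take Y_s out of E_s(R^G Y_s), its F_s-measurability is needed in H_{gamma1}, where R^G
    starts; adaptedness is given in H_{gamma1 - beta}. *)
Let sY t : (0 <= t <= T)%R -> strongly_measurable P (N1 gamma1) (F t) (Y t).
Proof.
move=> tT; have [s y] := CL_in_Lp cY tT.
exact: (sm_stronger_norm hP (hFt tT) (hN1 _) (hN1 _) (@hnorme_complete _ _ _ _)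
  (@hnorme_complete _ _ _ _) (@hnorme_definite _ _ _ _) (ltW C1_gt0) C1_le s
  (Lpnorm_integral_lty hP (hN1 _) m1' s y) (sYb tT)).
Qed.

Let Yb_sup : sup_bound (N1 g1b) m%:E Y (C1 * b)%R.
Proof.
move=> t tT; have [h _ _ _ _] := Ybounds.
exact: (le_embed (hN1 _) (hN1 _) m1' C1_gt0 C1_le (CL_in_Lp cY tT) (h t tT)).
Qed.

Let Yb'_sup : sup_bound (N1 g1b') m%:E Y (C2 * b)%R.
Proof.
move=> t tT; have [h _ _ _ _] := Ybounds.
exact: (le_embed (hN1 _) (hN1 _) m1' C2_gt0 C2_le (CL_in_Lp cY tT) (h t tT)).
Qed.

Let Y'bb_sup : sup_bound (Ne1 g1bb) m%:E Y' (C4 * b)%R.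
Proof.
move=> t tT; have [_ _ h _ _] := Ybounds.
exact: (le_embed (hNe1 _) (hNe1 _) m1' C4_gt0 C4_le (CL_in_Lp cY' tT) (h t tT)).
Qed.

Let Ybb_hol : hol_bound (N1 g1bb) m%:E beta (delta Y) (C5 * b)%R.
Proof.
move=> s t st tT; have [_ h _ _ _] := Ybounds; rewrite -mulrA.
have i := in_LpB hP (hN1 _) m1' (CL_in_Lp cYb (tI st tT)) (CL_in_Lp cYb (sI st tT)).
exact: (le_embed (hN1 _) (hN1 _) m1' C5_gt0 C5_le i (h s t st tT)).
Qed.

(** Interpolation with h = t - s. The Hoelder bound contributes h^(beta' - beta) times b h^beta,
    which is b h^beta'; the crude bound by the norms of Y_t and Y_s contributes 2 b h^beta'.
    Together they give 3 C3. *)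
Let Yb'_hol : hol_bound (N1 g1b') m%:E beta' (delta Y) (3 * C3 * b)%R.
Proof.
move=> s t st tT; have [h1 h2 _ _ _] := Ybounds.
have [tT' sT'] := (tI st tT, sI st tT).
have st0 : (0 < t - s)%R by rewrite subr_gt0; case/andP: st.
have [i _] := in_LpB hP (hN1 _) m1' (CL_in_Lp cY tT') (CL_in_Lp cY sT').
have [ib _] := in_LpB hP (hN1 _) m1' (CL_in_Lp cYb tT') (CL_in_Lp cYb sT').
have [ib' _] := in_LpB hP (hN1 _) m1' (CL_in_Lp cYb' tT') (CL_in_Lp cYb' sT').
have two : Lpnorm P (N1 gamma1) m%:E (delta Y s t) <= (b + b)%:E.
  apply: le_trans (LpnormB hP (hN1 _) m1' (CL_in_Lp cY tT').1 (CL_in_Lp cY sT').1) _.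
  by rewrite EFinD; apply: leeD; exact: h1.
(* The weights are moved into the functions as scalar multiples, so that Minkowski's inequality
   applies to the pointwise interpolation bound. *)
pose x := (C3 * (t - s) `^ (beta' - beta))%R; pose z := (C3 * (t - s) `^ beta')%R.
have x0 : (0 <= x)%R by rewrite mulr_ge0 ?powR_ge0// ltW.
have z0 : (0 <= z)%R by rewrite mulr_ge0 ?powR_ge0// ltW.
have sx := smZ (hN1 _) x ib; have sz := smZ (hN1 _) z i.
have leZ (N : ('rV[R]_e1 -> mf_amb H) -> \bar R) (c : R) f : enorm N -> (0 <= c)%R ->
    strongly_measurable P N d.-measurable f ->
    Lpnorm P N m%:E (fun w => c *: f w)%R <= c%:E * Lpnorm P N m%:E f.
  move=> hN c0 sf; apply: (Lpnorm_leZ hP hN hN m1' c0 (smZ hN c sf) sf).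
  by apply: aeW => w; rewrite (enormZ hN) ger0_norm.
apply: le_trans (Lpnorm_leD hP (hN1 _) (hN1 _) (hN1 _) m1' ib' sx sz _) _.
  apply: aeW => w; rewrite !enormZ// !ger0_norm//.
  apply: le_trans (C3_le _ st0) _.
  rewrite /x /z !EFinM -!muleA -ge0_muleDr//.
    by rewrite mule_ge0 ?lee_fin ?powR_ge0// (enorm_ge0 (hN1 _)).
  by rewrite mule_ge0 ?lee_fin ?powR_ge0// (enorm_ge0 (hN1 _)).
have e1' : (x * (b * (t - s) `^ beta) = C3 * b * (t - s) `^ beta')%R.
  rewrite /x -mulrA [(_ * (b * _))%R]mulrCA -powRD; last by rewrite (gt_eqF st0) implybT.
  by rewrite subrK mulrA.
have -> : (3 * C3 * b * (t - s) `^ beta' = x * (b * (t - s) `^ beta) + z * (b + b))%R.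
  by rewrite e1' /z; ring.
rewrite EFinD; apply: leeD.
  apply: le_trans (leZ _ _ _ (hN1 _) x0 ib) _.
  by rewrite [leRHS]EFinM; apply: lee_wpmul2l; [rewrite lee_fin|exact: h2].
apply: le_trans (leZ _ _ _ (hN1 _) z0 i) _.
by rewrite [leRHS]EFinM; apply: lee_wpmul2l; [rewrite lee_fin|exact: two].
Qed.

Local Notation GY := (opY G Y).
Local Notation GY' := (opY' G G' Y Y').

Lemma ELH_opY : ELH P T F m beta gamma2 GY.
Proof.
split; first exact: (CL_pair hP (hO _ _) (hN1 _) (hN2 _) (onorm_pairing _ _ _ _ _) m1' cG cY).
have pB := onorm_pairing H e1 e2 g1b g2b.
have [h1 h2 _ _ _] := Ybounds; have [[_ q2 q3 _ _] _] := Gbounds.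
split.
- exact: (CL_pair hP (hO _ _) (hN1 _) (hN2 _) pB m1' cGb cYb).
- move=> t; rewrite in_itv/= => tT.
  exact: (sm_pair (hO _ _) (hN1 _) (hN2 _) pB (complete_subI (hFt tT)) (sGb tT) (sYb tT)).
apply: le_lt_trans (ltry _); apply: holder_norm_le.
exact: (delta_pair_le hP (hO _ _) (hN1 _) (hN2 _) pB m1' cGb cYb q2 Yb_sup q3 h2).
Qed.

(** The supremum contributes [a * b]. In the Hoelder part delta G acts on Y at level gamma1 - beta,
    which costs [C1], and G acts on delta Y at no further cost. *)
Lemma ELH_norm_opY : ELH_norm P T m beta gamma2 GY <= ((C1 + 2) * (a * b))%:E.
Proof.
have [h1 h2 _ _ _] := Ybounds; have [[q1 q2 q3 _ _] _] := Gbounds.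
rewrite (_ : (C1 + 2) * (a * b) = a * b + (a * (C1 * b) + a * b))%R; last by ring.
rewrite EFinD; apply: leeD.
  apply: sup_norm_le.
  exact: (Lpnorm_pair_le hP (hO _ _) (hN1 _) (hN2 _) (onorm_pairing _ _ _ _ _) m1' cG cY q1 h1).
apply: holder_norm_le.
exact: (delta_pair_le hP (hO _ _) (hN1 _) (hN2 _) (onorm_pairing _ _ _ _ _)
  m1' cGb cYb q2 Yb_sup q3 h2).
Qed.

Let p1 := onorm_pairing_comp H e1 e2 e g1b g2b.
Let p2 := onorme_pairing H e1 e2 e gamma1 g2b.
Let p3 := onorm_pairing_comp H e1 e2 e g1bb g2bb.
Let p4 := onorme_pairing H e1 e2 e g1b' g2bb.

Let cGY' : CL P (Ne2 g2b) m%:E T GY'.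
Proof.
exact: (CLD hP (hNe2 _) m1' (CL_pair hP (hO _ _) (hNe1 _) (hNe2 _) p1 m1' cGb cY')
  (CL_pair hP (hOe _ _) (hN1 _) (hNe2 _) p2 m1' cG' cY)).
Qed.

(** The four terms are (delta G) Y', G (delta Y'), (delta G') Y and G' (delta Y). The undifferenced
    Y' and Y are measured in weaker norms, whence [C4] and [C2]; delta Y enters through
    interpolation, whence [3 * C3]. *)
Let GY'_hol : hol_bound (Ne2 g2bb) m%:E beta' (delta GY')
  ((a * (C4 * b) + a * b) + (a * (C2 * b) + a * (3 * C3 * b)))%R.
Proof.
have [_ _ _ h4 _] := Ybounds; have [[_ _ _ q4 q5] [_ q7 q8 _]] := Gbounds.
have d1 := delta_pair_le hP (hO _ _) (hNe1 _) (hNe2 _) p3 m1' cGbb cY'bb q4 Y'bb_sup q5 h4.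
have d2 := delta_pair_le hP (hOe _ _) (hN1 _) (hNe2 _) p4 m1' cG'b cYb' q7 Yb'_sup q8 Yb'_hol.
have c1 := CL_pair hP (hO _ _) (hNe1 _) (hNe2 _) p3 m1' cGbb cY'bb.
have c2 := CL_pair hP (hOe _ _) (hN1 _) (hNe2 _) p4 m1' cG'b cYb'.
exact: (deltaD_le hP (hNe2 _) m1' c1 c2 d1 d2).
Qed.

Lemma ELH'_opY : ELH' P T F m beta beta' gamma2 GY'.
Proof.
split; first exact: cGY'.
have c1 := CL_pair hP (hO _ _) (hNe1 _) (hNe2 _) p3 m1' cGbb cY'bb.
have c2 := CL_pair hP (hOe _ _) (hN1 _) (hNe2 _) p4 m1' cG'b cYb'.
split; first exact: (CLD hP (hNe2 _) m1' c1 c2).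
- move=> t; rewrite in_itv/= => tT; have cI := complete_subI (hFt tT).
  have sYb' := sm_le (hN1 _) (hN1 _) (ltW C2_gt0) C2_le (sY tT).
  exact: (smD (hNe2 _) (sm_pair (hO _ _) (hNe1 _) (hNe2 _) p3 cI (sGbb tT) (sY'bb tT))
    (sm_pair (hOe _ _) (hN1 _) (hNe2 _) p4 cI (sG'b tT) sYb')).
apply: le_lt_trans (ltry _); apply: holder_norm_le; exact: GY'_hol.
Qed.

Lemma ELH'_norm_opY :
  ELH'_norm P T m beta beta' gamma2 GY' <= ((C2 + 3 * C3 + C4 + 3) * (a * b))%:E.
Proof.
have [h1 _ h3 _ _] := Ybounds; have [[_ q2 _ _ _] [q6 _ _ _]] := Gbounds.
rewrite (_ : (C2 + 3 * C3 + C4 + 3) * (a * b) = (a * b + a * b) +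
  ((a * (C4 * b) + a * b) + (a * (C2 * b) + a * (3 * C3 * b))))%R; last by ring.
rewrite EFinD; apply: leeD; last by apply: holder_norm_le; exact: GY'_hol.
apply: sup_norm_le => t tT.
have c1 := CL_pair hP (hO _ _) (hNe1 _) (hNe2 _) p1 m1' cGb cY'.
have c2 := CL_pair hP (hOe _ _) (hN1 _) (hNe2 _) p2 m1' cG' cY.
have l1 := Lpnorm_pair_le hP (hO _ _) (hNe1 _) (hNe2 _) p1 m1' cGb cY' q2 h3 tT.
have l2 := Lpnorm_pair_le hP (hOe _ _) (hN1 _) (hNe2 _) p2 m1' cG' cY q6 h1 tT.
apply: le_trans (LpnormD hP (hNe2 _) m1' (CL_in_Lp c1 tT).1 (CL_in_Lp c2 tT).1) _.
by rewrite EFinD; apply: leeD; [exact: l1|exact: l2].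
Qed.

Local Notation R_Y := (RY X Y Y').
Local Notation R_G := (RG X G G').
Local Notation E_RY := (ERY P F X beta beta' gamma1 Y Y').
Local Notation E_RG := (ERG P F X beta beta' gamma1 gamma2 G G').
Local Notation R_GY := (RY X GY GY').
Local Notation E_RGY := (ERY P F X beta beta' gamma2 GY GY').

Let g2bb_le : (g2bb <= g2b)%R. Proof. by rewrite gerBl ltW. Qed.
Let g2b_le : (g2b <= gamma2)%R.
Proof. by rewrite gerBl (le_trans (ltW b'0)). Qed.

Let in_Lp_embed (V : lmodType R) (N M : V -> \bar R) (c : R) p f : enorm N -> enorm M ->
  1 <= p -> (0 < c)%R -> (forall v, M v <= c%:E * N v) ->
  in_Lp P N p d.-measurable f -> in_Lp P M p d.-measurable f.
Proof.
move=> hN hM q c0 le; apply: (in_Lp_map hP hN hM q (ltW c0) (T := id)) => //.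
Qed.

Let in_RG s t : (0 <= s <= T)%R -> (0 <= t <= T)%R ->
  in_Lp P (O gamma1 g2bb) +oo d.-measurable (R_G s t).
Proof.
move=> sT tT.
have [c c0 hc] := onorm_embedding H e1 e2 gamma1 (le_trans g2bb_le g2b_le).
have [c' c'0 hc'] := onorm_embedding H e1 e2 gamma1 g2bb_le.
have i1 := in_Lp_embed (hO _ _) (hO _ _) y1 c0 hc (CL_in_Lp cG tT).
have i2 := in_Lp_embed (hO _ _) (hO _ _) y1 c0 hc (CL_in_Lp cG sT).
have [k k0 hk] := @onorm_slice_le _ H e1 e2 e gamma1 g2b (X t - X s)%R.
have i3 := in_Lp_map hP (hOe _ _) (hO _ _) y1 k0 (T := fun f u => f u (X t - X s)%R)
  (fun x u v _ _ => erefl) hk (CL_in_Lp cG' sT).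
have i4 := in_Lp_embed (hO _ _) (hO _ _) y1 c'0 hc' i3.
exact: (in_LpB hP (hO _ _) y1 (in_LpB hP (hO _ _) y1 i1 i2) i4).
Qed.

Let in_RY s t : (0 <= s <= T)%R -> (0 <= t <= T)%R ->
  in_Lp P (N1 g1bb) m%:E d.-measurable (R_Y s t).
Proof.
move=> sT tT.
have i1 := CL_in_Lp cYbb tT; have i2 := CL_in_Lp cYbb sT.
have [k k0 hk] := @hnorme_slice_le _ H e1 e g1b (X t - X s)%R.
have i3 := in_Lp_map hP (hNe1 _) (hN1 _) m1' k0 (T := fun f => f (X t - X s)%R)
  (fun x u v _ _ => erefl) hk (CL_in_Lp cY' sT).
have i4 := in_Lp_embed (hN1 _) (hN1 _) m1' C5_gt0 C5_le i3.
exact: (in_LpB hP (hN1 _) m1' (in_LpB hP (hN1 _) m1' i1 i2) i4).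
Qed.

Let dGdY s t w := (delta G s t w (delta Y s t w)).

Let pbb := onorm_pairing H e1 e2 g1bb g2bb.
Let pR := onorm_pairing H e1 e2 gamma1 g2bb.

Let in_dG s t : (0 <= s <= T)%R -> (0 <= t <= T)%R ->
  in_Lp P (O g1bb g2bb) +oo d.-measurable (delta G s t).
Proof. by move=> sT tT; exact: (in_LpB hP (hO _ _) y1 (CL_in_Lp cGbb tT) (CL_in_Lp cGbb sT)). Qed.

Let in_dY s t : (0 <= s <= T)%R -> (0 <= t <= T)%R ->
  in_Lp P (N1 g1bb) m%:E d.-measurable (delta Y s t).
Proof. by move=> sT tT; exact: (in_LpB hP (hN1 _) m1' (CL_in_Lp cYbb tT) (CL_in_Lp cYbb sT)). Qed.

Let in_dGdY s t : (0 <= s <= T)%R -> (0 <= t <= T)%R ->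
  in_Lp P (N2 g2bb) m%:E d.-measurable (dGdY s t).
Proof.
move=> sT tT.
exact: (in_Lp_pair hP (hO _ _) (hN1 _) (hN2 _) pbb m1' (in_dG sT tT) (in_dY sT tT)).
Qed.

Let E_dGdY s t := condexp P (N2 g2bb) (F s) (dGdY s t).

Let cN1 g : ecomplete (N1 g). Proof. exact: hnorme_complete. Qed.
Let cN2 g : ecomplete (N2 g). Proof. exact: hnorme_complete. Qed.
Let cO g g' : ecomplete (O g g'). Proof. exact: onorm_complete. Qed.

Let is_E_RY s t : (0 <= s <= T)%R -> (0 <= t <= T)%R ->
  is_condexp P (N1 g1bb) (F s) (R_Y s t) (E_RY s t).
Proof. by move=> sT tT; exact: (condexp_is hP (hFt sT) (hN1 _) (@cN1 _) m1' (in_RY sT tT)). Qed.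

Let is_E_RG s t : (0 <= s <= T)%R -> (0 <= t <= T)%R ->
  is_condexp P (O gamma1 g2bb) (F s) (R_G s t) (E_RG s t).
Proof. by move=> sT tT; exact: (condexp_is hP (hFt sT) (hO _ _) (@cO _ _) y1 (in_RG sT tT)). Qed.

Let is_E_dGdY s t : (0 <= s <= T)%R -> (0 <= t <= T)%R ->
  is_condexp P (N2 g2bb) (F s) (dGdY s t) (E_dGdY s t).
Proof. by move=> sT tT; exact: (condexp_is hP (hFt sT) (hN2 _) (@cN2 _) m1' (in_dGdY sT tT)). Qed.

Let in_E_RY q : Delta2 T q -> in_Lp P (N1 g1bb) m%:E d.-measurable (E_RY q.1 q.2).
Proof.
move=> qD; have [_ _ [h _ _ _]] := hY; have [sq yq] := h q qD; split => //.
exact: (sm_subset (complete_sub_measurable (hFt (Delta2_snd qD))) sq).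
Qed.

Let in_E_RG q : Delta2 T q -> in_Lp P (O gamma1 g2bb) +oo d.-measurable (E_RG q.1 q.2).
Proof.
move=> qD; have [_ _ _ [h _ _ _]] := hG; have [sq yq] := h q qD; split => //.
exact: (sm_subset (complete_sub_measurable (hFt (Delta2_snd qD))) sq).
Qed.

Let in_E_dGdY q : Delta2 T q -> in_Lp P (N2 g2bb) m%:E d.-measurable (E_dGdY q.1 q.2).
Proof.
move=> qD; have [sT tT] := (Delta2_fst qD, Delta2_snd qD).
exact: (condexp_in_Lp hP (hFt sT) (hN2 _) m1 (in_dGdY sT tT) (is_E_dGdY sT tT)).
Qed.

Let E_prod s t w := (E_RG s t w (Y s w) + G s w (E_RY s t w) + E_dGdY s t w)%R.

(** The algebraic splitting holds almost surely only: operators are linear at finite-norm vectors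
    alone, and the values of Y, Y' and G have finite norm off a null set. *)
Let R_GY_ae s t : (0 <= s <= T)%R -> (0 <= t <= T)%R -> {ae P, forall w,
  N2 g2bb (R_G s t w (Y s w) + G s w (R_Y s t w) + dGdY s t w - R_GY s t w)%R = 0}.
Proof.
move=> sT tT.
have [Gs Gt] := (sm_lty (hO _ _) (CL_in_Lp cGbb sT).1, sm_lty (hO _ _) (CL_in_Lp cGbb tT).1).
have [Ys Yt] := (sm_lty (hN1 _) (CL_in_Lp cYbb sT).1, sm_lty (hN1 _) (CL_in_Lp cYbb tT).1).
have Y's := sm_lty (hNe1 _) (CL_in_Lp cY'bb sT).1.
apply: filterS2 (filterI Gs Gt) (filterI (filterI Ys Yt) Y's)
  => w [gs gt] [[ys yt] y's].
set x := (X t - X s)%R.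
have yx : N1 g1bb (Y' s w x) < +oo.
  exact: (pairing_lty (hNe1 _) euclid_enorm (pairing_apply euclid_enorm (hN1 _)) y's (euclid_lty x)).
have linB f u v : O g1bb g2bb f < +oo -> N1 g1bb u < +oo -> N1 g1bb v < +oo ->
    f (u - v)%R = (f u - f v)%R.
  move=> fy uy vy; rewrite -scaleN1r addrC (opnorm_linear fy)//.
  by rewrite scaleN1r addrC.
have ysy := enormB_lty (hN1 g1bb) yt ys.
have -> : (R_G s t w (Y s w) + G s w (R_Y s t w) + dGdY s t w = R_GY s t w)%R.
  rewrite /dGdY /R_Y /RY /R_G /delta /opY /opY' -/x.
  symmetry; rewrite !linB//; last exact: (enormB_lty (hO _ _) gt gs).
  exact: remainder_product.
by rewrite subrr (enorm0 (hN2 _)).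
Qed.

Let is_E_prod q : Delta2 T q ->
  is_condexp P (N2 g2bb) (F q.1) (R_GY q.1 q.2) (E_prod q.1 q.2).
Proof.
move=> qD; have [sT tT] := (Delta2_fst qD, Delta2_snd qD).
apply: (condexp_eq_norm hP (hN2 _) (hFt sT) (R_GY_ae sT tT)).
exact: (condexp_product hP (hFt sT) (hO _ _) (hO _ _) (hN1 _) (hN1 _) (hN2 _) (@cN2 _) pR pbb
  m1' (in_RG sT tT) (in_E_RG qD) (is_E_RG sT tT) (sY sT) (CL_in_Lp cY sT)
  (in_RY sT tT) (in_E_RY qD) (is_E_RY sT tT) (sGbb sT) (CL_in_Lp cGbb sT) (is_E_dGdY sT tT)).
Qed.

(** The choice made by [condexp] is a conditional expectation as soon as one exists, and [E_prod] is
    a witness. *)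
Let is_E_RGY q : Delta2 T q ->
  is_condexp P (N2 g2bb) (F q.1) (R_GY q.1 q.2) (E_RGY q.1 q.2).
Proof.
move=> qD; apply: (@xgetPex _ _ [set W | is_condexp P (N2 g2bb) (F q.1) (R_GY q.1 q.2) W]).
by exists (E_prod q.1 q.2); exact: is_E_prod.
Qed.

Let E_prod_ae q : Delta2 T q ->
  {ae P, forall w, N2 g2bb (E_prod q.1 q.2 w - E_RGY q.1 q.2 w)%R = 0}.
Proof.
move=> qD; exact: (condexp_unique hP (hN2 _) (hFt (Delta2_fst qD)) (is_E_prod qD) (is_E_RGY qD)).
Qed.

Let E_RGY_le q (x y z : R) : Delta2 T q ->
  Lpnorm P (O gamma1 g2bb) +oo (E_RG q.1 q.2) <= x%:E ->
  Lpnorm P (N1 g1bb) m%:E (E_RY q.1 q.2) <= y%:E ->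
  Lpnorm P (N2 g2bb) m%:E (dGdY q.1 q.2) <= z%:E ->
  Lpnorm P (N2 g2bb) m%:E (E_RGY q.1 q.2) <= (x * b + a * y + z)%:E.
Proof.
move=> qD hx hy hz; have [sT tT] := (Delta2_fst qD, Delta2_snd qD).
have [h1 _ _ _ _] := Ybounds; have [[_ _ _ q4 _] _] := Gbounds.
have sE := condexp_smr (hFt sT) (is_E_prod qD).
rewrite -(eq_Lpnorm_ae hP (hN2 _) m1' sE (E_prod_ae qD)).
have i1 := in_Lp_pair hP (hO _ _) (hN1 _) (hN2 _) pR m1' (in_E_RG qD) (CL_in_Lp cY sT).
have i2 := in_Lp_pair hP (hO _ _) (hN1 _) (hN2 _) pbb m1' (CL_in_Lp cGbb sT) (in_E_RY qD).
have i3 := in_E_dGdY qD; have i12 := in_LpD hP (hN2 _) m1' i1 i2.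
apply: le_trans (LpnormD hP (hN2 _) m1' i12.1 i3.1) _; rewrite EFinD; apply: leeD; last first.
  exact: le_trans (condexp_Lpnorm_le hP (hFt sT) (hN2 _) m1 (is_E_dGdY sT tT)) hz.
apply: le_trans (LpnormD hP (hN2 _) m1' i1.1 i2.1) _; rewrite EFinD; apply: leeD.
  apply: le_trans (Lpnorm_pair hP (hO _ _) (hN1 _) (hN2 _) pR m1' (in_E_RG qD).1
    (CL_in_Lp cY sT).1 (in_E_RG qD).2) _.
  by rewrite EFinM; apply: lee_pmul; rewrite ?Lpnorm_ge0//; exact: h1.
apply: le_trans (Lpnorm_pair hP (hO _ _) (hN1 _) (hN2 _) pbb m1' (CL_in_Lp cGbb sT).1
  (in_E_RY qD).1 (CL_in_Lp cGbb sT).2) _.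
by rewrite EFinM; apply: lee_pmul; rewrite ?Lpnorm_ge0//; exact: q4.
Qed.

Let dGdY_le s t (x y : R) : (0 <= s <= T)%R -> (0 <= t <= T)%R ->
  Lpnorm P (O g1bb g2bb) +oo (delta G s t) <= x%:E ->
  Lpnorm P (N1 g1bb) m%:E (delta Y s t) <= y%:E ->
  Lpnorm P (N2 g2bb) m%:E (dGdY s t) <= (x * y)%:E.
Proof.
move=> sT tT hx hy; have [i1 i2] := (in_dG sT tT, in_dY sT tT).
apply: le_trans (Lpnorm_pair hP (hO _ _) (hN1 _) (hN2 _) pbb m1' i1.1 i2.1 i1.2) _.
by rewrite EFinM; apply: lee_pmul; rewrite ?Lpnorm_ge0//.
Qed.

(** The terms with R^G and R^Y contribute [a * b] each. In the third, the order beta' of delta G and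
    the order beta of delta Y add up, and moving delta Y down to H_{gamma1 - beta - beta'} costs
    [C5]. *)
Let E_RGY_hol : hol_bound (N2 g2bb) m%:E (beta + beta')%R E_RGY ((C5 + 2) * (a * b))%R.
Proof.
move=> s t st tT; have [_ _ _ _ h5] := Ybounds; have [[_ _ _ _ q5] [_ _ _ q9]] := Gbounds.
have [tT' sT'] := (tI st tT, sI st tT).
have st0 : (0 < t - s)%R by rewrite subr_gt0; case/andP: st.
have qD : Delta2 T (s, t) by split => //=; case/andP: st => -> /ltW.
have l3 := dGdY_le sT' tT' (q5 s t st tT) (Ybb_hol st tT).
apply: le_trans (E_RGY_le qD (q9 s t st tT) (h5 s t st tT) l3) _.
rewrite lee_fin powRD; last by rewrite (gt_eqF st0) implybT.
by rewrite le_eqVlt; apply/orP; left; apply/eqP; ring.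
Qed.

Let in_E_RGY q : Delta2 T q -> in_Lp P (N2 g2bb) m%:E (F q.2) (E_RGY q.1 q.2).
Proof.
move=> qD; have [sT tT] := (Delta2_fst qD, Delta2_snd qD).
have h := is_E_RGY qD; split.
  apply: sm_subset (condexp_smG h); case: qD => /andP[s0 st] tT'.
  exact: (usual_le hF s0 st tT').
have sE := condexp_smr (hFt sT) (is_E_prod qD).
rewrite -(eq_Lpnorm_ae hP (hN2 _) m1' sE (E_prod_ae qD)).
have i1 := in_Lp_pair hP (hO _ _) (hN1 _) (hN2 _) pR m1' (in_E_RG qD) (CL_in_Lp cY sT).
have i2 := in_Lp_pair hP (hO _ _) (hN1 _) (hN2 _) pbb m1' (CL_in_Lp cGbb sT) (in_E_RY qD).
exact: (in_LpD hP (hN2 _) m1' (in_LpD hP (hN2 _) m1' i1 i2) (in_E_dGdY qD)).2.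
Qed.

(** The Hoelder bound speaks of s < t only, whereas [Delta2] contains the diagonal; the supremum is
    therefore bounded separately, from the suprema of the factors. *)
Let E_RGY_bounded :
  ereal_sup [set Lpnorm P (N2 g2bb) m%:E (E_RGY q.1 q.2) | q in Delta2 T] < +oo.
Proof.
have [_ _ [_ bY _ _]] := hY; have [_ _ _ [_ bG _ _]] := hG.
have [_ _ _ _ _] := Ybounds; have [[_ _ _ q4 _] _] := Gbounds.
set SY := ereal_sup _ in bY; set SG := ereal_sup _ in bG.
have leY q : Delta2 T q -> Lpnorm P (N1 g1bb) m%:E (E_RY q.1 q.2) <= (fine SY)%:E.
  move=> qD; have le : Lpnorm P (N1 g1bb) m%:E (E_RY q.1 q.2) <= SY.
    by apply: ereal_sup_ubound; exists q.
  by rewrite fineK// ge0_fin_numE// (le_trans _ le)// Lpnorm_ge0.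
have leG q : Delta2 T q -> Lpnorm P (O gamma1 g2bb) +oo (E_RG q.1 q.2) <= (fine SG)%:E.
  move=> qD; have le : Lpnorm P (O gamma1 g2bb) +oo (E_RG q.1 q.2) <= SG.
    by apply: ereal_sup_ubound; exists q.
  by rewrite fineK// ge0_fin_numE// (le_trans _ le)// Lpnorm_ge0.
apply: (@le_lt_trans _ _ (fine SG * b + a * fine SY + (a + a) *
  (C5 * (C1 * b) + C5 * (C1 * b)))%:E); last exact: ltry.
apply: ge_ereal_sup => _ [q qD <-]; have [sT tT] := (Delta2_fst qD, Delta2_snd qD).
apply: (E_RGY_le qD (leG q qD) (leY q qD)); apply: dGdY_le => //.
  apply: le_trans (LpnormB hP (hO _ _) y1 (CL_in_Lp cGbb tT).1 (CL_in_Lp cGbb sT).1) _.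
  by rewrite EFinD; apply: leeD; exact: q4.
have lY t : (0 <= t <= T)%R -> Lpnorm P (N1 g1bb) m%:E (Y t) <= (C5 * (C1 * b))%:E.
  move=> hT.
  exact: (le_embed (hN1 _) (hN1 _) m1' C5_gt0 C5_le (CL_in_Lp cYb hT) (Yb_sup hT)).
apply: le_trans (LpnormB hP (hN1 _) m1' (CL_in_Lp cYbb tT).1 (CL_in_Lp cYbb sT).1) _.
by rewrite EFinD; apply: leeD; exact: lY.
Qed.

(** The terms with R^G and R^Y are products of families that are continuous by hypothesis,
    restricted here to the points of [J q]. Only E_s of (delta G)(delta Y) calls on [hJ]: its
    integrand converges in L^m while the conditioning sigma-algebra moves with s. *)
Let E_RGY_cvg J q : condprob_cvg_along P T F J -> Delta2 T q ->
  Lpnorm P (N2 g2bb) m%:E (fun w => E_RGY r.1 r.2 w - E_RGY q.1 q.2 w)%R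
    @[r --> within (Delta2 T `&` J q) (nbhs q)] --> 0.
Proof.
move=> hJ qD; have [sT tT] := (Delta2_fst qD, Delta2_snd qD).
set Fil := within _ _; have FFil : Filter Fil by exact: within_filter.
have nD : \forall r \near Fil, Delta2 T r.
  have hw : Fil (Delta2 T `&` J q) by exact: withinT.
  by apply: filterS hw => r [rD _]; exact: rD.
have cvf := @within_Delta2_fst R T q J; have cvs := @within_Delta2_snd R T q J.
have toDelta (V : lmodType R) (N : V -> \bar R) p (A : R -> R -> Omega -> V) :
    (forall r, Delta2 T r -> in_Lp P N p d.-measurable (A r.1 r.2)) ->
    Lpnorm P N p (fun w => A r.1 r.2 w - A q.1 q.2 w)%R
      @[r --> within (Delta2 T `&` all_points q) (nbhs q)] --> 0 ->
    Lcvg P N p Fil (fun r => A r.1 r.2) (A q.1 q.2).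
  move=> iA cA; split; [by apply: filterS nD|exact: iA|].
  have sub : Delta2 T `&` J q `<=` Delta2 T `&` all_points q by move=> r [rD _]; split.
  exact: cvg_trans (cvg_app _ (within_subset _ sub)) cA.
have [_ _ [_ _ cEY _]] := hY; have [_ _ _ [_ _ cEG _]] := hG.
have l1 := toDelta _ _ _ _ in_E_RG (cEG q qD).
have l2 := toDelta _ _ _ _ in_E_RY (cEY q qD).
have l3 := Lcvg_comp cvf ((CL_Lcvg _ _ _ _ _).1 cY _ sT).
have l4 := Lcvg_comp cvf ((CL_Lcvg _ _ _ _ _).1 cGbb _ sT).
have l4' := Lcvg_comp cvs ((CL_Lcvg _ _ _ _ _).1 cGbb _ tT).
have l5 := Lcvg_comp cvf ((CL_Lcvg _ _ _ _ _).1 cYbb _ sT).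
have l5' := Lcvg_comp cvs ((CL_Lcvg _ _ _ _ _).1 cYbb _ tT).
have l6 := Lcvg_pair hP FFil (hO _ _) (hN1 _) (hN2 _) pbb m1'
  (LcvgB hP FFil (hO _ _) y1 l4' l4) (LcvgB hP FFil (hN1 _) m1' l5' l5).
have nF : \forall r \near Fil, complete_sub P (F r.1).
  by apply: filterS nD => r /Delta2_fst; exact: hFt.
have nE : \forall r \near Fil, is_condexp P (N2 g2bb) (F r.1) (dGdY r.1 r.2) (E_dGdY r.1 r.2).
  by apply: filterS nD => r rD; exact: is_E_dGdY (Delta2_fst rD) (Delta2_snd rD).
have l7 := condexp_Lcvg hP FFil (hN2 _) (@cN2 _) m1 nF (hFt sT) (hJ q qD) l6 nE
  (is_E_dGdY sT tT).
have l8 := Lcvg_pair hP FFil (hO _ _) (hN1 _) (hN2 _) pR m1' l1 l3.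
have l9 := Lcvg_pair hP FFil (hO _ _) (hN1 _) (hN2 _) pbb m1' l4 l2.
have l10 := LcvgD hP FFil (hN2 _) m1' (LcvgD hP FFil (hN2 _) m1' l8 l9) l7.
have nae : \forall r \near Fil,
    {ae P, forall w, N2 g2bb (E_prod r.1 r.2 w - E_RGY r.1 r.2 w)%R = 0}.
  by apply: filterS nD => r; exact: E_prod_ae.
by have [_ _] := Lcvg_ae hP FFil (hN2 _) m1' nae (E_prod_ae qD) l10.
Qed.

Lemma DLH_along_opY J : condprob_cvg_along P T F J ->
  DLH_along P T F X m beta beta' gamma2 J GY GY'.
Proof.
move=> hJ; split; [exact: ELH_opY|exact: ELH'_opY|split].
- by move=> q qD; exact: in_E_RGY.
- exact: E_RGY_bounded.
- by move=> q qD; exact: E_RGY_cvg.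
- by apply: le_lt_trans (ltry _); apply: holder_norm_le; exact: E_RGY_hol.
Qed.

Lemma Lpnorm_opY0_le :
  Lpnorm P (N2 gamma2) m%:E (GY 0%R) <= normG * Lpnorm P (N1 gamma1) m%:E (Y 0%R).
Proof.
have T0' : (0 <= (0 : R) <= T)%R by rewrite lexx ltW.
have [sG yG] := CL_in_Lp cG T0'; have [[q1 _ _ _ _] _] := Gbounds.
apply: le_trans (Lpnorm_pair hP (hO _ _) (hN1 _) (hN2 _) (onorm_pairing _ _ _ _ _) m1'
  sG (CL_in_Lp cY T0').1 yG) _.
by rewrite -aE; apply: lee_wpmul2r; [exact: Lpnorm_ge0|exact: q1].
Qed.

Lemma DLH_norm_opY_le :
  DLH_norm P T F X m beta beta' gamma2 GY GY' <=
  (C1 + C2 + 3 * C3 + C4 + C5 + 7)%:E * (normG * normY).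
Proof.
rewrite -aE -bE -!EFinM.
rewrite (_ : (_ * (a * b) = (C1 + 2) * (a * b) + (C2 + 3 * C3 + C4 + 3) * (a * b) +
  (C5 + 2) * (a * b))%R); last by ring.
rewrite 2!EFinD; apply: leeD; first by apply: leeD; [exact: ELH_norm_opY|exact: ELH'_norm_opY].
by apply: holder_norm_le; exact: E_RGY_hol.
Qed.

End product_rule.

Theorem proposition3p7 (R : realType) (H : monotone_family R)
    (e e1 e2 : nat) (alpha beta beta' gamma1 gamma2 m : R)
    (halpha : 3^-1 < alpha /\ alpha <= 2^-1)
    (hbeta : [/\ 0 < beta', beta' <= beta & beta <= alpha])
    (hm : 2 <= m) :
  exists C : R -> R,
  forall (T : R) (d : measure_display) (Omega : measurableType d)
    (P : probability Omega R) (F : R -> set (set Omega))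
    (X : R -> 'rV[R]_e)
    (Y : R -> Omega -> 'rV[R]_e1 -> mf_amb H)
    (Y' : R -> Omega -> 'rV[R]_e -> 'rV[R]_e1 -> mf_amb H)
    (G : R -> Omega -> ('rV[R]_e1 -> mf_amb H) -> 'rV[R]_e2 -> mf_amb H)
    (G' : R -> Omega -> ('rV[R]_e1 -> mf_amb H) ->
          'rV[R]_e -> 'rV[R]_e2 -> mf_amb H),
  0 < T ->
  usual_filtration P T F ->
  holder_path T alpha X ->
  DLH P T F X m beta beta' gamma1 Y Y' ->
  DLop P T F X beta beta' gamma1 gamma2 G G' ->
  [/\ DLH_along P T F X m beta beta' gamma2 right_points
        (opY G Y) (opY' G G' Y Y'),
      left_continuous_filtration T F ->
        DLH P T F X m beta beta' gamma2 (opY G Y) (opY' G G' Y Y'),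
      (Lpnorm P (@hnorme R H e2 gamma2) m%:E (opY G Y 0%R)
       <= (C (Num.max T 1))%R%:E *
          (DLop_norm P T F X beta beta' gamma1 gamma2 G G' *
           Lpnorm P (@hnorme R H e1 gamma1) m%:E (Y 0%R)))%E
    & (DLH_norm P T F X m beta beta' gamma2 (opY G Y) (opY' G G' Y Y')
       <= (C (Num.max T 1))%R%:E *
          (DLop_norm P T F X beta beta' gamma1 gamma2 G G' *
           DLH_norm P T F X m beta beta' gamma1 Y Y'))%E].
Proof.
have [b'0 b'b _] := hbeta; have b0 : 0 < beta by exact: lt_le_trans b'b.
have m1 : 1 < m by rewrite (lt_le_trans _ hm)// ltr1n.
have l1 : gamma1 - beta <= gamma1 by rewrite gerBl ltW.
have l2 : gamma1 - beta' <= gamma1 by rewrite gerBl ltW.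
have l3 : gamma1 - beta - beta' <= gamma1 - beta by rewrite gerBl ltW.
have [C1 C1p h1] := hnorme_embedding H e1 l1.
have [C2 C2p h2] := hnorme_embedding H e1 l2.
have [C3 C3p h3] := hnorme_interpolation H e1 gamma1 b'0 b'b.
have [C4 C4p h4] := hnormee_embedding H e1 e l3.
have [C5 C5p h5] := hnorme_embedding H e1 l3.
(* The sum of the constants for the three parts of the norm: C1 + 2, C2 + 3 C3 + C4 + 3 and C5 +
   2. *)
pose K := C1 + C2 + 3 * C3 + C4 + C5 + 7.
have K1 : 1 <= K by rewrite /K; lra.
(* The constants of the scale do not involve T, so a constant function serves. The bound at time 0
   holds with constant 1 and is weakened by means of 1 <= K. *)
exists (fun=> K) => T d Omega P F X Y Y' G G' T0 hF _ hY hG; split.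
- apply: (DLH_along_opY T0 hF b'0 b'b m1 hY hG C1p C2p C3p C4p C5p h1 h2 h3 h4 h5).
  exact: condprob_cvg_right_points.
- move=> hL.
  apply: (DLH_along_opY T0 hF b'0 b'b m1 hY hG C1p C2p C3p C4p C5p h1 h2 h3 h4 h5).
  exact: condprob_cvg_all_points.
- apply: le_trans (Lpnorm_opY0_le T0 hF m1 hY hG) _.
  by rewrite lee_pemull ?lee_fin// mule_ge0 ?Lpnorm_ge0 ?DLop_norm_ge0.
- exact: (DLH_norm_opY_le T0 hF b'0 b'b m1 hY hG C1p C2p C3p C4p C5p h1 h2 h3 h4 h5).
Qed.
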